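(* Let $M$ be a compact Riemannian manifold without boundary and let $X$ be a $C^1$ vector field on $M$. If $X$ is rescaling separating and every singularity of $X$ is hyperbolic, then for every integer $k\ge 1$, $X$ has quasi-trivial $C^k$-centralizer; that is, for any $Y\in\mathcal{Z}^k(X)$ there exists a $C^1$ function $f:M\to\mathbb{R}$ with $X(f)\equiv 0$ such that $Y=f\cdot X$.
   Context: $\mathcal{X}^k(M)$ denotes the set of $C^k$ vector fields on $M$ and $d$ is the Riemannian distance. Let $\varphi_t$ be the flow generated by $X$, and $\mathrm{Orb}(x)=\{\varphi_t(x):t\in\mathbb{R}\}$. A singularity of $X$ is a point $x$ with $X(x)=0$. Rescaling separating: $X$ is rescaling separating (on $M$) if there is $\varepsilon>0$ such that for any $x,y\in M$, if $d(\varphi_t(x),\varphi_t(y))\le\varepsilon\|X(\varphi_t(x))\|$ for all $t\in\mathbb{R}$, then $y\in\mathrm{Orb}(x)$. Centralizer: $\mathcal{Z}^k(X)$ is the set of $Y\in\mathcal{X}^k(M)$ whose generated flow $\psi_t$ satisfies $\psi_s\circ\varphi_t=\varphi_t\circ\psi_s$ on $M$ for all $t,s\in\mathbb{R}$. $X(f)$ denotes the derivative of $f$ in the direction $X$. *)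

(* Defs.v *)
From HB Require Import structures.
From mathcomp Require Import all_boot all_order all_algebra.
From mathcomp.real_closed Require Import complex.
From mathcomp Require Import all_classical all_reals all_analysis.

Set Implicit Arguments.
Unset Strict Implicit.
Unset Printing Implicit Defensive.

Import Order.TTheory GRing.Theory Num.Theory.
Import numFieldNormedType.Exports.
Local Open Scope classical_set_scope.
Local Open Scope ring_scope.

(* U is meant to be open and V finite-dimensional. *)
Fixpoint Ck (R : realType) (V W : normedModType R) (k : nat)
    (U : set V) (f : V -> W) : Prop :=
  if k is k'.+1 then
    (forall x, U x -> differentiable f x) /\
    (forall v : V, Ck k' U (fun x => 'D_v f x))
  else forall x, U x -> {for x, continuous f}.

Definition smooth (R : realType) (V W : normedModType R)
    (U : set V) (f : V -> W) : Prop :=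
  forall k, Ck k U f.

(* Both maps are total; only their values on [chart_dom] and on
   [chart_codom] matter.  Since these sets are open, pointwise continuity
   there is continuity of the partial maps. *)
Record chart (R : realType) (n : nat) (M : topologicalType) := Chart {
  chart_dom : set M ;
  chart_map :> M -> 'rV[R]_n ;
  chart_inv : 'rV[R]_n -> M ;
  chart_dom_open : open chart_dom ;
  chart_codom_open : open (chart_map @` chart_dom) ;
  chart_mapK : forall x, chart_dom x -> chart_inv (chart_map x) = x ;
  chart_map_continuous :
    forall x, chart_dom x -> {for x, continuous chart_map} ;
  chart_inv_continuous :
    forall y, (chart_map @` chart_dom) y -> {for y, continuous chart_inv}
}.

Definition chart_codom (R : realType) (n : nat) (M : topologicalType)
    (c : chart R n M) : set 'rV[R]_n :=
  c @` chart_dom c.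

Record manifold (R : realType) (n : nat) := Manifold {
  msort :> topologicalType ;
  atlas : set (chart R n msort) ;
  manifold_hausdorff : hausdorff_space msort ;
  manifold_second_countable : @second_countable msort ;
  atlas_cover : forall x : msort, exists2 c, atlas c & chart_dom c x ;
  atlas_compat : forall c c', atlas c -> atlas c' ->
    smooth (c @` (chart_dom c `&` chart_dom c')) (c' \o chart_inv c)
}.

Definition chart_at (R : realType) (n : nat) (M : manifold R n) (x : M) :
    chart R n M :=
  sval (cid2 (atlas_cover x)).

(* A tangent vector at x is represented by its coordinates in the preferred
   chart [chart_at x].  As [chart_at x] need not depend continuously on x,
   regularity of a field of tangent vectors cannot be read off the map
   M -> 'rV_n: it is expressed through [to_coord], the coordinates of the
   tangent vector in a chart c around x. *)
Definition vector_field (R : realType) (n : nat) (M : manifold R n) : Type :=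
  M -> 'rV[R]_n.

Definition to_coord (R : realType) (n : nat) (M : manifold R n)
    (c : chart R n M) (x : M) (v : 'rV[R]_n) : 'rV[R]_n :=
  'd (c \o chart_inv (chart_at x)) (chart_at x x) v.

Definition of_coord (R : realType) (n : nat) (M : manifold R n)
    (c : chart R n M) (x : M) (u : 'rV[R]_n) : 'rV[R]_n :=
  'd (chart_at x \o chart_inv c) (c x) u.

Definition local_rep (R : realType) (n : nat) (M : manifold R n)
    (X : vector_field M) (c : chart R n M) (y : 'rV[R]_n) : 'rV[R]_n :=
  to_coord c (chart_inv c y) (X (chart_inv c y)).

Definition Ck_vector_field (R : realType) (n : nat) (M : manifold R n)
    (k : nat) (X : vector_field M) : Prop :=
  forall c, atlas c -> Ck k (chart_codom c) (local_rep X c).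

Definition Ck_function (R : realType) (n : nat) (M : manifold R n)
    (k : nat) (f : M -> R) : Prop :=
  forall c, atlas c -> Ck k (chart_codom c) (f \o chart_inv c).

(* The function X(f). *)
Definition lie_derivative (R : realType) (n : nat) (M : manifold R n)
    (X : vector_field M) (f : M -> R) (x : M) : R :=
  'D_(X x) (f \o chart_inv (chart_at x)) (chart_at x x).

Record riemannian_metric (R : realType) (n : nat) (M : manifold R n) :=
RiemannianMetric {
  gram : M -> 'M[R]_n ;
  gram_sym : forall x, (gram x)^T = gram x ;
  gram_posdef : forall x (v : 'rV[R]_n), v != 0 ->
    0 < (v *m gram x *m v^T) 0 0 ;
  gram_smooth : forall c, atlas c -> forall u v : 'rV[R]_n,
    smooth (chart_codom c) (fun y : 'rV[R]_n =>
      let x := chart_inv c y in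
      (of_coord c x u *m gram x *m (of_coord c x v)^T) 0 0)
}.

Definition tnorm (R : realType) (n : nat) (M : manifold R n)
    (g : riemannian_metric M) (x : M) (v : 'rV[R]_n) : R :=
  Num.sqrt ((v *m gram g x *m v^T) 0 0).

Definition C1_curve (R : realType) (n : nat) (M : manifold R n)
    (gam : R -> M) : Prop :=
  continuous gam /\
  forall c, atlas c -> Ck 1 (gam @^-1` chart_dom c) (c \o gam).

Definition velocity (R : realType) (n : nat) (M : manifold R n)
    (gam : R -> M) (t : R) : 'rV[R]_n :=
  'D_1 (chart_at (gam t) \o gam) t.

Definition curve_length (R : realType) (n : nat) (M : manifold R n)
    (g : riemannian_metric M) (gam : R -> M) : \bar R :=
  (\int[lebesgue_measure]_(t in `[0%R, 1%R])
     (tnorm g (gam t) (velocity gam t))%:E)%E.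

(* [piecewise_C1_path g x y l]: some piecewise C^1 path from x to y has
   length l.  Such a path is a finite concatenation of C^1 curves on [0, 1];
   a C^1 curve on [0, 1] is the restriction of a C^1 curve on the line. *)
Inductive piecewise_C1_path (R : realType) (n : nat) (M : manifold R n)
    (g : riemannian_metric M) : M -> M -> \bar R -> Prop :=
| path_nil x : piecewise_C1_path g x x 0%E
| path_cons (gam : R -> M) y l :
    C1_curve gam -> piecewise_C1_path g (gam 1) y l ->
    piecewise_C1_path g (gam 0) y (curve_length g gam + l)%E.

(* +oo when x and y lie in different connected components. *)
Definition riemannian_distance (R : realType) (n : nat) (M : manifold R n)
    (g : riemannian_metric M) (x y : M) : \bar R :=
  ereal_inf [set l | piecewise_C1_path g x y l].

Definition integral_curve (R : realType) (n : nat) (M : manifold R n)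
    (X : vector_field M) (gam : R -> M) : Prop :=
  continuous gam /\
  forall t : R, is_derive t 1 (chart_at (gam t) \o gam) (X (gam t)).

(* On a compact manifold a C^1 vector field generates exactly one flow. *)
Definition is_flow (R : realType) (n : nat) (M : manifold R n)
    (X : vector_field M) (phi : R -> M -> M) : Prop :=
  forall x, phi 0 x = x /\ integral_curve X (phi ^~ x).

Definition orbit_of (R : realType) (n : nat) (M : manifold R n)
    (phi : R -> M -> M) (x : M) : set M :=
  [set phi t x | t in [set: R]].

Definition rescaling_separating (R : realType) (n : nat) (M : manifold R n)
    (g : riemannian_metric M) (X : vector_field M) (phi : R -> M -> M) : Prop :=
  exists2 e : R, 0 < e &
    forall x y : M,
      (forall t : R, (riemannian_distance g (phi t x) (phi t y)
         <= (e * tnorm g (phi t x) (X (phi t x)))%:E)%E) ->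
      orbit_of phi x y.

Definition singularity (R : realType) (n : nat) (M : manifold R n)
    (X : vector_field M) (x : M) : Prop :=
  X x = 0.

Definition hyperbolic (R : realType) (n : nat) (M : manifold R n)
    (X : vector_field M) (x : M) : Prop :=
  let c := chart_at x in
  let DX : 'M[R]_n := jacobian (local_rep X c) (c x) in
  forall l : complex.complex R,
    eigenvalue (map_mx (complex.real_complex R) DX) l -> complex.Re l != 0.

(* Y belongs to Z^k(X), where phi is the flow of X. *)
Definition centralizer (R : realType) (n : nat) (M : manifold R n)
    (k : nat) (phi : R -> M -> M) (Y : vector_field M) : Prop :=
  Ck_vector_field k Y /\
  exists2 psi : R -> M -> M, is_flow Y psi &
    forall (s t : R) (x : M), psi s (phi t x) = phi t (psi s x).

Definition quasi_trivial_centralizer (R : realType) (n : nat)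
    (M : manifold R n) (k : nat) (X : vector_field M) (phi : R -> M -> M) :
    Prop :=
  forall Y : vector_field M, centralizer k phi Y ->
    exists f : M -> R,
      [/\ Ck_function 1 f,
          forall x, lie_derivative X f x = 0 &
          forall x, Y x = f x *: X x].

(* Main.v *)
(* Let [psi] be the flow of [Y].  Hyperbolic singularities of [X] are isolated, so
   they are fixed by [psi], and [|Y| <= K |X|] locally.  Hence, by compactness,
   [d (phi t x) (phi t (psi s x)) <= e |X (phi t x)|] for all [t] once [s] is small,
   and rescaling separation puts [psi s x] on the orbit of [x].  If [X x] and [Y x]
   were linearly independent, the integer part of the (rescaled) time at which
   [phi] reaches [psi s x] would inject an interval of parameters [s] into the
   integers; so [Y = f X].  Away from the singularities [f] is a quotient of C^1
   functions, and [X(f) = 0] because the fields commute.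

   At a singularity [x], [DY] maps each vector to a multiple of its image under
   [DX], so [DY = l DX]; this gives [f x := l], and [f] is continuous at [x].  It
   remains to see that [df] tends to 0 at [x].  Along orbits the gradient of the
   first integral [f] solves the adjoint variational equation.  A quadratic
   Lyapunov form for the hyperbolic matrix [DX] is strictly monotone along its
   solutions, so in one time direction the gradient at a point near [x] is at most
   a constant over the time spent in a fixed box times the gradient at the exit.
   Points near [x] spend a long time in the box, and those trapped in it have
   [f = l]. *)

Require Import Defs.
From HB Require Import structures.
From mathcomp Require Import all_boot all_order all_algebra.
From mathcomp.real_closed Require Import complex.
From mathcomp Require Import all_classical all_reals all_analysis.
From mathcomp Require Import ring lra.

Set Implicit Arguments.
Unset Strict Implicit.
Unset Printing Implicit Defensive.

Import Order.TTheory GRing.Theory Num.Theory.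
Import numFieldNormedType.Exports.
Local Open Scope classical_set_scope.
Local Open Scope ring_scope.

(** Both fields may be no better than C^1, so [f] has no second derivatives to work with.
    Infinitesimal facts are drawn from finite displacements: two nearby orbits separate as the
    linearised field predicts, up to [eta * |h|] times their initial distance. Commutation turns
    this estimate into the vanishing of the bracket. Invariance of [f] turns it into the adjoint
    equation, so the gradient is differentiable along orbits although [f] is merely C^1.

    The time at which [phi] reaches [psi s x] is only chosen, with no regularity in [s]; this is why
    collinearity rests on counting rather than on differentiating in [s].

    At a singularity [Y = f X] leaves the value of [f] free, and the quotient that gives [f]
    elsewhere degenerates. The sign of the dual Lyapunov form at a gradient tells in which time
    direction that gradient grows, whatever its stable and unstable components. Gradients on the
    exit sphere are bounded by compactness, so long growth forces a small start. The obstacle is an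
    orbit trapped in precisely the growing direction; the value of [f] on trapped orbits, combined
    with continuity of the gradient, removes it. *)

(* The differential as a locked plain function: unification of ['d f x] at
   distinct points is prohibitively slow. *)
HB.lock Definition dif (R : realType) (V W : normedModType R) (f : V -> W) (x v : V) : W :=
  'd f x v.

(** * Epsilon-delta calculus, mean value inequalities and first hitting times *)

Section Calculus.
Context {R : realType}.

Lemma near_normP (V : normedModType R) (x : V) (P : set V) :
  (\forall y \near x, P y) <->
  exists2 r : R, 0 < r & forall y, `|y - x| < r -> P y.
Proof.
split=> [/nbhs_ballP[r /= r0 rP]|[r r0 rP]].
  by exists r => // y yx; apply: rP; rewrite -ball_normE /= distrC.
by apply/nbhs_ballP; exists r => //= y; rewrite -ball_normE /= distrC; exact: rP.
Qed.

Lemma continuous_normP (V W : normedModType R) (g : V -> W) (x : V) :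
  {for x, continuous g} <-> forall e : R, 0 < e ->
  exists2 r : R, 0 < r & forall y, `|y - x| < r -> `|g y - g x| < e.
Proof.
split=> [/cvgrPdist_lt gx e e0|H].
  have /near_normP[r r0 hr] := gx _ e0; exists r => // y /hr.
  by rewrite distrC.
apply/cvgrPdist_lt => e e0; apply/near_normP.
by have [r r0 hr] := H _ e0; exists r => // y /hr; rewrite distrC.
Qed.

Lemma difE (V W : normedModType R) (f : V -> W) x v : dif f x v = 'd f x v.
Proof. by rewrite dif.unlock. Qed.

Lemma dif_linear (V W : normedModType R) (f : V -> W) x : linear (dif f x).
Proof. by move=> a u v; rewrite !difE linearP. Qed.

HB.instance Definition _ (V W : normedModType R) (f : V -> W) x :=
  GRing.isLinear.Build R V W *:%R (dif f x) (dif_linear f x).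

Lemma difD (V W : normedModType R) (f : V -> W) x u v :
  dif f x (u + v) = dif f x u + dif f x v.
Proof. exact: linearD. Qed.

Lemma difB (V W : normedModType R) (f : V -> W) x u v :
  dif f x (u - v) = dif f x u - dif f x v.
Proof. exact: linearB. Qed.

Lemma difZ (V W : normedModType R) (f : V -> W) x a v :
  dif f x (a *: v) = a *: dif f x v.
Proof. exact: linearZ. Qed.

Lemma derive_dif (V W : normedModType R) (f : V -> W) x v :
  differentiable f x -> 'D_v f x = dif f x v.
Proof. by move=> dfx; rewrite difE deriveE. Qed.

Lemma dif_lipschitz (V W : normedModType R) (f : V -> W) x : differentiable f x ->
  exists2 k : R, 0 < k & forall v, `|dif f x v| <= k * `|v|.
Proof.
move=> /diff_continuous/linear_lipschitz[k k0 hk]; exists k => // v.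
by rewrite difE; exact: hk.
Qed.

Lemma dif_comp (U V W : normedModType R) (g : U -> V) (f : V -> W) x v :
  differentiable g x -> differentiable f (g x) ->
  dif (f \o g) x v = dif f (g x) (dif g x v).
Proof.
move=> dg df; rewrite !difE.
exact: (congr1 (@^~ v) (diff_comp dg df)).
Qed.

Lemma dist_continuous (V : normedModType R) (y0 : V) : continuous (fun y => `|y - y0|).
Proof. by move=> y; apply: cvg_norm; apply: cvgB; [exact: cvg_id|exact: cvg_cst]. Qed.

Lemma diff_approx (V W : normedModType R) (f : V -> W) (x : V) :
  differentiable f x -> forall e : R, 0 < e ->
  exists2 r : R, 0 < r & forall y, `|y - x| < r ->
    `|f y - f x - dif f x (y - x)| <= e * `|y - x|.
Proof.
move=> /diff_locally; set k := (the_littleo _ _ _ _ _) => dfx e e0.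
have /(littleoP [littleo of k]) : 0 < e by [].
move=> /near_normP[r r0 hr]; exists r => // y yx; rewrite difE.
have /= := hr (y - x); rewrite subr0 => /(_ yx); apply: le_trans.
have /(congr1 (fun g => g (y - x))) /= := dfx.
rewrite /shift /= subrK => ->.
have E (a b c : W) : a + b + c - a - b = c.
  by rewrite -(addrA _ (- a)) -opprD addrC addKr.
by rewrite -[X in `|X|]/(f x + 'd f x (y - x) + k (y - x) - f x - 'd f x (y - x)) E.
Qed.

Lemma diff_of_approx (V W : normedModType R) (f F : V -> W) (x : V) :
  linear F -> continuous F -> (forall e : R, 0 < e ->
  exists2 r : R, 0 < r & forall y, `|y - x| < r ->
    `|f y - f x - F (y - x)| <= e * `|y - x|) ->
  differentiable f x /\ forall v, dif f x v = F v.
Proof.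
move=> lF cF H.
pose LF := GRing.isLinear.Build R V W *:%R F lF.
pose F' : {linear V -> W} := HB.pack F LF.
have fE : f \o shift x = cst (f x) + (F' : V -> W) +o_ (0 : V) id.
  apply/eqaddoP => e e0; have [r r0 hr] := H _ e0.
  apply/near_normP; exists r => // h; rewrite subr0 => hr1.
  have := hr (h + x); rewrite addrK => /(_ hr1).
  by rewrite -addrA -opprD.
have cF' : continuous (F' : V -> W) by [].
have dE := diff_unique cF' fE.
split; last by move=> v; rewrite difE; exact: (congr1 (@^~ v) dE).
by apply/diff_locallyP; rewrite dE.
Qed.

Lemma near_eq_diff (V W : normedModType R) (f g : V -> W) (x : V) :
  (\forall y \near x, f y = g y) -> differentiable f x ->
  differentiable g x /\ forall v, dif g x v = dif f x v.
Proof.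
move=> fg df; have fgx := nbhs_singleton fg.
apply: diff_of_approx; first exact: dif_linear.
  have -> : dif f x = 'd f x :> (V -> W) by apply/funext => v; rewrite difE.
  exact: diff_continuous.
move=> e e0; have [r r0 hr] := diff_approx df e0.
have /near_normP[r' r'0 hr'] := fg.
exists (Num.min r r'); first by rewrite lt_min r0.
move=> y; rewrite lt_min => /andP[/hr hy /hr' fgy].
by rewrite -fgy -fgx; exact: hy.
Qed.

Lemma is_derive_approx (V : normedModType R) (u : R -> V) (t : R) (l : V) :
  is_derive t 1 u l <-> forall e : R, 0 < e ->
  exists2 r : R, 0 < r & forall s, `|s - t| < r ->
    `|u s - u t - (s - t) *: l| <= e * `|s - t|.
Proof.
split=> [[ut <-] e e0|H].
  have ud : differentiable u t by apply/derivable1_diffP.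
  have [r r0 hr] := diff_approx ud e0; exists r => // s st.
  have -> : (s - t) *: 'D_1 u t = dif u t (s - t).
    by rewrite derive_dif // -linearZ /= [_ *: _]mulr1.
  exact: hr.
have cv : (fun h => h^-1 *: (u (h *: 1 + t) - u t)) @ 0^' --> l.
  apply/cvgrPdist_le => e e0.
  have [r r0 hr] := H _ e0.
  near=> h.
  have h0 : h != 0 by near: h; exact: nbhs_dnbhs_neq.
  have hr' : `|h| < r by near: h; apply: dnbhs0_lt.
  have := hr (h + t); rewrite addrK => /(_ hr') hh.
  rewrite /GRing.scale /= mulr1 distrC.
  rewrite -(@ler_pM2l _ `|h|) ?normr_gt0 // [`|h| * e]mulrC (le_trans _ hh) //.
  by rewrite -normrZ scalerBr scalerA divff // scale1r.
apply: DeriveDef.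
  by apply/cvg_ex; exists l.
by apply/cvg_lim.
Unshelve. all: by end_near. Qed.

Lemma is_derive_unique (V : normedModType R) (u : R -> V) (t : R) (l l' : V) :
  is_derive t 1 u l -> is_derive t 1 u l' -> l = l'.
Proof. by move=> [_ <-] [_ <-]. Qed.

Lemma is_derive_continuous (V : normedModType R) (u : R -> V) (t : R) (l : V) :
  is_derive t 1 u l -> {for t, continuous u}.
Proof.
move=> [ut _]; apply: differentiable_continuous; exact/derivable1_diffP.
Qed.

Lemma is_derive_chain (V W : normedModType R) (f : V -> W) (u : R -> V) (t : R) (l : V) :
  differentiable f (u t) -> is_derive t 1 u l ->
  is_derive t 1 (f \o u) (dif f (u t) l).
Proof.
move=> df [ut <-].
have ud : differentiable u t by apply/derivable1_diffP.
have fud : differentiable (f \o u) t by exact: differentiable_comp.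
apply: DeriveDef; first exact/derivable1_diffP.
by rewrite !derive_dif // (dif_comp _ ud df).
Qed.

Lemma is_derive_rescale (V : normedModType R) (u : R -> V) (a t : R) (l : V) :
  is_derive (a * t) 1 u l -> is_derive t 1 (fun s => u (a * s)) (a *: l).
Proof.
move=> H.
have ds : is_derive t 1 (fun t : R => a * t) a.
  apply/is_derive_approx => e e0; exists 1 => // r _.
  by rewrite -mulrBr mulrC subrr normr0 mulr_ge0 // ltW.
have dH : differentiable u (a * t) by apply/derivable1_diffP; have [] := H.
have H2 := is_derive_chain (dH : differentiable _ ((fun t : R => a * t) t)) ds.
apply: (is_derive_eq H2); rewrite -[X in dif _ _ X]mulr1 -[a * 1]/(a *: (1 : R)) difZ.
by rewrite -derive_dif // derive_val.
Qed.

Lemma norm_coord_le m n (A : 'M[R]_(m, n)) i j : `|A i j| <= `|A|.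
Proof. by rewrite [leRHS]/Num.norm /= mx_normrE; apply: (le_bigmax _ _ (i, j)). Qed.

Lemma mx_norm_le m n (A : 'M[R]_(m, n)) (K : R) : 0 <= K ->
  (forall i j, `|A i j| <= K) -> `|A| <= K.
Proof.
move=> K0 h; rewrite [leLHS]/Num.norm /= mx_normrE.
by apply: bigmax_le => // -[i j] _ /=.
Qed.

Lemma is_derive_coord m n (u : R -> 'M[R]_(m, n)) (t : R) l i j :
  is_derive t 1 u l -> is_derive t 1 (fun s => u s i j) (l i j).
Proof.
move=> ul.
have dc : differentiable (fun A : 'M[R]_(m, n) => A i j : R) (u t).
  exact: differentiable_coord.
have := is_derive_chain dc ul; congr (is_derive _ _ _ _); rewrite difE.
have @f : {linear 'M[R]_(m, n) -> R}.
  by exists (fun N : 'M[R]_(_, _) => N i j); do 2![eexists]; do ?[constructor];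
     rewrite ?mxE// => ? *; rewrite ?mxE//; move=> ?; rewrite !mxE.
by have := @diff_lin _ _ _ f (u t) (@coord_continuous _ _ _ i j) => /(congr1 (fun g => g l)).
Qed.

Lemma scalar_mvt (g g' : R -> R) (a b : R) : a <= b ->
  (forall t, a <= t <= b -> is_derive t 1 g (g' t)) ->
  exists2 c, a <= c <= b & g b - g a = g' c * (b - a).
Proof.
move=> ab dg.
have [|t tab|c cab ->] := @MVT_segment R g g' a b ab.
- by move=> x /[!in_itv] /= /andP[h1 h2]; apply: dg; rewrite !ltW.
- apply: continuous_in_subspaceT => x /[!inE] /= /[!in_itv] /= xab.
  exact: is_derive_continuous (dg _ xab).
by exists c => //; move: cab; rewrite in_itv.
Qed.

(** Mean value inequality around a reference velocity [w]; [w = 0] gives the plain bound on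
    displacement. The norm is the largest entry, so the scalar theorem is applied entry by entry,
    each with its own intermediate time. *)
Lemma curve_mvt m n (u u' : R -> 'M[R]_(m, n)) (a b K : R) (w : 'M[R]_(m, n)) :
  a <= b -> (forall t, a <= t <= b -> is_derive t 1 u (u' t)) ->
  (forall t, a <= t <= b -> `|u' t - w| <= K) ->
  `|u b - u a - (b - a) *: w| <= K * (b - a).
Proof.
move=> ab du uK.
have K0 : 0 <= K by apply: le_trans (uK a _); rewrite ?lexx ?ab.
apply: mx_norm_le => [|i j]; first by rewrite mulr_ge0 // subr_ge0.
have [|c cab] := @scalar_mvt (fun s => u s i j) (fun s => u' s i j) _ _ ab.
  by move=> t tab; apply: is_derive_coord; exact: du.
rewrite !mxE => ->; rewrite mulrC -mulrBr normrM (ger0_norm (_ : 0 <= b - a)) ?subr_ge0 //.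
rewrite mulrC ler_wpM2r ?subr_ge0 // (le_trans _ (uK _ cab)) //.
by have := norm_coord_le (u' c - w) i j; rewrite !mxE.
Qed.

Lemma curve_mvt_sym m n (u u' : R -> 'M[R]_(m, n)) (a b K : R) (w : 'M[R]_(m, n)) :
  (forall t, `|t - a| <= `|b - a| -> is_derive t 1 u (u' t)) ->
  (forall t, `|t - a| <= `|b - a| -> `|u' t - w| <= K) ->
  `|u b - u a - (b - a) *: w| <= K * `|b - a|.
Proof.
move=> du uK; have [ab|/ltW ba] := lerP a b.
  by apply: (@curve_mvt _ _ _ u') => // t /andP[at_ tb]; [apply: du|apply: uK];
    rewrite !ger0_norm ?subr_ge0 ?lerD2r.
have := @curve_mvt _ _ u u' _ _ K w ba.
rewrite -(normrN (u a - _ - _)) !opprD !opprK -scaleNr opprB addrC.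
rewrite [- u a + _]addrC addrC; apply.
  move=> t /andP[h1 h2]; apply: du; rewrite distrC (distrC b) !ger0_norm ?subr_ge0 //; lra.
move=> t /andP[h1 h2]; apply: uK; rewrite distrC (distrC b) !ger0_norm ?subr_ge0 //; lra.
Qed.

(* The minimal |t| is attained, which treats past and future at once. *)
Lemma first_hitting (A : set R) (t1 : R) : closed A -> A t1 ->
  exists t0, [/\ A t0, `|t0| <= `|t1| & forall t, `|t| < `|t0| -> ~ A t].
Proof.
move=> cA At1.
pose B := A `&` [set` `[- `|t1|, `|t1|]].
have cB : compact B.
  by rewrite /B setIC; apply: compact_closedI => //; exact: segment_compact.
have Bt1 : B t1 by split => //=; rewrite in_itv /= -ler_norml.
have [//||t0 /[!inE] -[At0 /= /[!in_itv] /= t0t1] tmin] :=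
  @compact_EVT_min R R Num.norm B _ cB.
- by exists t1.
- by apply: continuous_subspaceT => x; exact: norm_continuous.
exists t0; split => //; first by rewrite ler_norml.
move=> t tt0 At; have : t \in B.
  rewrite inE; split => //=; rewrite in_itv /= -ler_norml.
  by rewrite (le_trans (ltW tt0)) // ler_norml.
by move=> /tmin; rewrite leNgt tt0.
Qed.

Lemma first_hitting_ge0 (A : set R) (t1 : R) : closed A -> A t1 -> 0 <= t1 ->
  exists t0, [/\ A t0, 0 <= t0 <= t1 & forall t, 0 <= t < t0 -> ~ A t].
Proof.
move=> cA At1 t10.
have cA' : closed (A `&` [set t | 0 <= t]).
  by apply: closedI => //; exact: closed_ge.
have [|t0 [[At0 /= t00] t0t1 h]] := first_hitting cA' (t1 := t1); first by [].
exists t0; rewrite t00; split => //; first by rewrite !ger0_norm in t0t1.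
move=> t /andP[tge tt0] At; apply: (h t); last by split.
by rewrite !ger0_norm.
Qed.

End Calculus.

(** * C^1 regularity at a point, strict differentiability and growth estimates *)

Section C1Maps.
Context {R : realType}.

Lemma linear_delta_sum (W : lmodType R) n (f : {linear 'rV[R]_n -> W}) v :
  f v = \sum_i v 0 i *: f (delta_mx 0 i).
Proof. by rewrite [v in LHS]row_sum_delta linear_sum /=; apply: eq_bigr => i _; rewrite linearZ. Qed.

(** It suffices to compare on the basis, each coordinate of [v] being at most its norm. Dividing by
    [n.+1] rather than [n] keeps the tolerance meaningful in dimension 0. *)
Lemma linear_dist (W : normedModType R) n (F G : {linear 'rV[R]_n -> W}) (e : R) v :
  0 < e -> (forall i, `|F (delta_mx 0 i) - G (delta_mx 0 i)| <= e / n.+1%:R) ->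
  `|F v - G v| <= e * `|v|.
Proof.
move=> e0 hi; rewrite (linear_delta_sum F v) (linear_delta_sum G v) -sumrB.
apply: (le_trans (ler_norm_sum _ _ _)).
apply: (@le_trans _ _ (\sum_(i < n) (`|v| * (e / n.+1%:R)))).
  apply: ler_sum => i _.
  by rewrite -scalerBr normrZ ler_pM // ?norm_coord_le //.
rewrite sumr_const card_ord -[_ *+ n]mulr_natr -mulrA mulrC ler_wpM2r //.
rewrite mulrAC -mulrA ler_piMr ?(ltW e0) // ler_pdivrMr // mul1r ler_nat.
exact: leqnSn.
Qed.

(** Differentiability on a whole neighbourhood, with the differential continuous at [x] alone, in
    operator norm. As a statement about one point it can be proved by different means at regular
    points and at singularities; over an open set it amounts to [Ck 1]. *)
Definition C1_at n (W : normedModType R) (f : 'rV[R]_n -> W) (x : 'rV[R]_n) :=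
  forall e : R, 0 < e -> exists2 r : R, 0 < r & forall y, `|y - x| < r ->
    differentiable f y /\ forall v, `|dif f y v - dif f x v| <= e * `|v|.

Lemma C1_at_diff n (W : normedModType R) (f : 'rV[R]_n -> W) x :
  C1_at f x -> differentiable f x.
Proof. by move=> /(_ _ ltr01)[r r0 /(_ x)]; rewrite subrr normr0 => /(_ r0)[]. Qed.

Lemma near_C1_at n (W : normedModType R) (f : 'rV[R]_n -> W) x :
  (\forall y \near x, differentiable f y) ->
  (forall v, {for x, continuous (fun y => 'D_v f y)}) -> C1_at f x.
Proof.
move=> df Df e e0.
have dfx := nbhs_singleton df.
have en0 : 0 < e / n.+1%:R by rewrite divr_gt0.
have : \forall y \near x, differentiable f y /\
    forall i, `|'D_(delta_mx 0 i) f y - 'D_(delta_mx 0 i) f x| < e / n.+1%:R.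
  near=> y; split; first by near: y.
  near: y.
  apply: filter_forall => i.
  by have /cvgrPdist_lt/(_ _ en0) := Df (delta_mx 0 i); apply: filterS => y; rewrite distrC.
move=> /near_normP[r r0 hr]; exists r => // y /hr[dfy hy]; split => // v.
apply: linear_dist => // i; have := ltW (hy i).
suff -> : 'D_(delta_mx 0 i) f y - 'D_(delta_mx 0 i) f x =
  dif f y (delta_mx 0 i) - dif f x (delta_mx 0 i) by [].
by rewrite !derive_dif.
Unshelve. all: by end_near. Qed.

Lemma C1_at_continuous_derive n (W : normedModType R) (f : 'rV[R]_n -> W) x v :
  C1_at f x -> {for x, continuous (fun y => 'D_v f y)}.
Proof.
move=> fC1; have dfx := C1_at_diff fC1.
apply/continuous_normP => e e0.
have e0' : 0 < e / (`|v| + 1) by rewrite divr_gt0 // ltr_wpDl.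
have [r r0 hr] := fC1 _ e0'.
exists r => // y /hr[dfy /(_ v)].
have -> : 'D_v f y - 'D_v f x = dif f y v - dif f x v.
  by rewrite !derive_dif.
move=> /le_lt_trans; apply.
by rewrite -mulrA gtr_pMr // mulrC ltr_pdivrMr ?ltr_wpDl // mul1r ltrDl.
Qed.

Lemma Ck1P n (W : normedModType R) (U : set 'rV[R]_n) (f : 'rV[R]_n -> W) :
  open U -> Ck 1 U f <-> forall x, U x -> C1_at f x.
Proof.
move=> oU; split=> [[df Df] x Ux|H].
  apply: near_C1_at; last by move=> v; exact: Df.
  by apply: filterS (open_nbhs_nbhs (conj oU Ux)); exact: df.
split=> [x /H/C1_at_diff //|v x Ux]; exact: C1_at_continuous_derive (H _ Ux).
Qed.

Lemma Ck_S (V W : normedModType R) k (U : set V) (f : V -> W) :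
  Ck k.+1 U f -> Ck k U f.
Proof.
elim: k f => [|k IH] f [df Df]; first by move=> x /df/differentiable_continuous.
by split=> // v; exact: IH.
Qed.

Lemma Ck_le (V W : normedModType R) k l (U : set V) (f : V -> W) :
  (l <= k)%N -> Ck k U f -> Ck l U f.
Proof.
move=> /subnK <-; elim: (k - l)%N => // j IH; rewrite addSn => /Ck_S; exact: IH.
Qed.

(** The composites are compared through [f0 (g1 v)], each half costing [e / 2]. The [1] in the
    minimum gives [|g1 v| <= (Kg + 1) * |v|], which explains the denominator [2 * (Kg + 1)]. *)
Lemma chain_dist (U V W : normedModType R) (g0 g1 : U -> V) (f0 : {linear V -> W})
    (f1 : V -> W) (Kg Kf e : R) (v : U) :
  0 < Kg -> 0 < Kf -> 0 < e ->
  `|g0 v| <= Kg * `|v| -> (forall w, `|f0 w| <= Kf * `|w|) ->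
  `|g1 v - g0 v| <= Num.min 1 (e / (2 * Kf)) * `|v| ->
  (forall w, `|f1 w - f0 w| <= e / (2 * (Kg + 1)) * `|w|) ->
  `|f1 (g1 v) - f0 (g0 v)| <= e * `|v|.
Proof.
move=> Kg0 Kf0 e0 hKg hKf gy fgy.
rewrite -(subrKA (f0 (g1 v))) (le_trans (ler_normD _ _)) //.
have hv : `|g1 v| <= (Kg + 1) * `|v|.
  rewrite -(subrK (g0 v) (g1 v)) (le_trans (ler_normD _ _)) //.
  rewrite mulrDl addrC lerD // (le_trans gy) // ler_wpM2r //.
  by rewrite ge_min lexx.
have e1 : 0 < e / (2 * (Kg + 1)) by rewrite divr_gt0 // mulr_gt0 // ltr_wpDl // ltW.
rewrite (splitr e) mulrDl lerD //.
  rewrite (le_trans (fgy _)) //.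
  apply: (le_trans (ler_wpM2l (ltW e1) hv)).
  by rewrite le_eqVlt; apply/orP; left; apply/eqP; field; rewrite gt_eqF // ltr_wpDl // ltW.
rewrite -linearB (le_trans (hKf _)) //.
apply: (@le_trans _ _ (Kf * (e / (2 * Kf) * `|v|))).
  by rewrite ler_wpM2l ?(ltW Kf0) // (le_trans gy) // ler_wpM2r // ge_min lexx orbT.
by rewrite le_eqVlt; apply/orP; left; apply/eqP; field; rewrite gt_eqF.
Qed.

Lemma C1_at_comp n m (W : normedModType R) (g : 'rV[R]_n -> 'rV[R]_m)
    (f : 'rV[R]_m -> W) x : C1_at g x -> C1_at f (g x) -> C1_at (f \o g) x.
Proof.
move=> gC fC e e0.
have dg := C1_at_diff gC; have df := C1_at_diff fC.
have [Kg Kg0 hKg] := dif_lipschitz dg.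
have [Kf Kf0 hKf] := dif_lipschitz df.
have e1 : 0 < e / (2 * (Kg + 1)) by rewrite divr_gt0 // mulr_gt0 // ltr_wpDl // ltW.
have e2 : 0 < Num.min 1 (e / (2 * Kf)).
  by rewrite lt_min ltr01 divr_gt0 // mulr_gt0.
have [r1 r10 h1] := fC _ e1; have [r2 r20 h2] := gC _ e2.
have /near_normP[r3 r30 h3] : \forall y \near x, `|g y - g x| < r1.
  have /cvgrPdist_lt/(_ _ r10) := differentiable_continuous dg.
  by apply: filterS => y; rewrite distrC.
exists (Num.min r2 r3); first by rewrite lt_min r20.
move=> y; rewrite lt_min => /andP[/h2[dgy gy] /h3/h1[dfgy fgy]].
split=> [|v]; first exact: differentiable_comp.
rewrite (dif_comp _ dgy dfgy) (dif_comp _ dg df).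
exact: (@chain_dist _ _ _ (dif g x) (dif g y) (dif f (g x)) (dif f (g y)) Kg Kf e v).
Qed.

Lemma C1_at_near_eq n (W : normedModType R) (f g : 'rV[R]_n -> W) x :
  (\forall y \near x, f y = g y) -> C1_at f x -> C1_at g x.
Proof.
move=> /near_join fg fC.
have dgx v : dif g x v = dif f x v.
  by apply: (near_eq_diff _ (C1_at_diff fC)).2; exact: nbhs_singleton fg.
move=> e e0; have [r r0 hr] := fC _ e0.
have /near_normP[r' r'0 hr'] := fg.
exists (Num.min r r'); first by rewrite lt_min r0.
move=> y; rewrite lt_min => /andP[/hr[dfy hy] /hr' fgy].
by have [dgy dgE] := near_eq_diff fgy dfy; split => // v; rewrite dgE dgx.
Qed.

(** The segment from [b] to [a] stays in the ball, where the velocity of its image differs from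
    [dif f x (a - b)] by at most [e * |a - b|]; the mean value inequality is used with that
    reference velocity. *)
Lemma C1_at_strict n m (f : 'rV[R]_n -> 'rV[R]_m) x : C1_at f x ->
  forall e : R, 0 < e -> exists2 r : R, 0 < r & forall a b,
    `|a - x| < r -> `|b - x| < r ->
    `|f a - f b - dif f x (a - b)| <= e * `|a - b|.
Proof.
move=> fC e e0; have [r r0 hr] := fC _ e0; exists r => // a b ax bx.
pose p (t : R) := b + t *: (a - b).
have pd (t : R) : is_derive t 1 p (a - b).
  apply/is_derive_approx => e1 e10; exists 1 => // s _.
  by rewrite /p [b + _]addrC addrKA -scalerBl subrr normr0 mulr_ge0 // ltW.
have pr t : 0 <= t <= 1 -> `|p t - x| < r.
  move=> /andP[t0 t1].
  have -> : p t - x = t *: (a - x) + (1 - t) *: (b - x).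
    by apply/rowP => i; rewrite /p !mxE; ring.
  (* Strictness is drawn from the term of weight [1 - t], which vanishes at [t = 1]. *)
  have [->|tn1] := eqVneq t 1; first by rewrite scale1r subrr scale0r addr0.
  rewrite (le_lt_trans (ler_normD _ _)) // !normrZ (ger0_norm t0) ger0_norm ?subr_ge0 //.
  have t1' : 0 < 1 - t by rewrite subr_gt0 lt_neqAle tn1.
  have h1 := ler_wpM2l t0 (ltW ax); have h2 : (1 - t) * `|b - x| < (1 - t) * r by rewrite ltr_pM2l.
  lra.
have -> : f a = (f \o p) 1 by rewrite /p /= scale1r addrC subrK.
have -> : f b = (f \o p) 0 by rewrite /p /= scale0r addr0.
have := @curve_mvt R _ _ (f \o p) (fun t => dif f (p t) (a - b)) 0 1
  (e * `|a - b|) (dif f x (a - b)) ler01.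
rewrite subr0 scale1r mulr1; apply.
  by move=> t /pr/hr[dft _]; apply: is_derive_chain.
by move=> t /pr/hr[].
Qed.

(** [g t * expR (- C * t)] is nonincreasing and [g t * expR (C * t)] nondecreasing, whence one bound
    in each time direction. *)
Lemma gronwall (g g' : R -> R) (C a b : R) : a <= b ->
  (forall t, a <= t <= b -> is_derive t 1 g (g' t)) ->
  (forall t, a <= t <= b -> `|g' t| <= C * g t) ->
  g b <= g a * expR (C * (b - a)) /\ g a <= g b * expR (C * (b - a)).
Proof.
move=> ab dg hg.
have dexp (k t : R) : a <= t <= b ->
  is_derive t 1 (fun s => g s * expR (k * s)) ((g' t + k * g t) * expR (k * t)).
  move=> /dg dgt.
  have dk : is_derive t 1 (fun s : R => k * s) k.
    apply/is_derive_approx => e1 e10; exists 1 => // s _.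
    by rewrite -mulrBr mulrC subrr normr0 mulr_ge0 // ltW.
  have de := is_derive1_comp (is_derive_expR (k * t)) dk.
  have H := is_deriveM dgt de; apply: (is_derive_eq H).
  rewrite /GRing.scale /=; ring.
split.
  have [c /andP[ac cb] E] := @scalar_mvt R _ _ a b ab (dexp (- C)).
  have : (g' c + - C * g c) * expR (- C * c) * (b - a) <= 0.
    rewrite mulr_le0_ge0 ?subr_ge0 // mulr_le0_ge0 ?expR_ge0 //.
    rewrite mulNr subr_le0 (le_trans (ler_norm _)) // hg //.
    by rewrite ac.
  rewrite -E subr_le0 => h.
  have := ler_wpM2r (expR_ge0 (C * b)) h.
  by rewrite -!mulrA -!expRD mulNr addNr expR0 mulr1 mulNr addrC -mulrBr.
have [c /andP[ac cb] E] := @scalar_mvt R _ _ a b ab (dexp C).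
have : 0 <= (g' c + C * g c) * expR (C * c) * (b - a).
  rewrite mulr_ge0 ?subr_ge0 // mulr_ge0 ?expR_ge0 //.
  rewrite -lerBlDr sub0r lerNl (le_trans (ler_norm _)) // normrN hg //.
  by rewrite ac.
rewrite -E subr_ge0 => h.
have := ler_wpM2r (expR_ge0 (- (C * a))) h.
by rewrite -!mulrA -!expRD addrN expR0 mulr1 -mulrBr.
Qed.

(* [e] decays at most like [expR (- C t)], so [L 1 >= mu * expR (- C) * e 0]; then
   [e t >= L 1 / K] makes [L] grow linearly up to [L tau <= K * e tau]. *)
Lemma growth (L L' e e' : R -> R) (mu C K tau : R) :
  0 < mu -> 0 <= C -> 0 < K -> 1 <= tau ->
  (forall t, 0 <= t <= tau -> is_derive t 1 L (L' t)) ->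
  (forall t, 0 <= t <= tau -> is_derive t 1 e (e' t)) ->
  (forall t, 0 <= t <= tau -> 0 <= e t) ->
  (forall t, 0 <= t <= tau -> mu * e t <= L' t) ->
  (forall t, 0 <= t <= tau -> `|e' t| <= C * e t) ->
  (forall t, 0 <= t <= tau -> L t <= K * e t) ->
  0 <= L 0 ->
  e 0 * (tau - 1) * (mu ^+ 2 * expR (- C)) <= K ^+ 2 * e tau.
Proof.
move=> mu0 C0 K0 tau1 dL de e0 hL he hK L0.
have tau0 : 0 <= tau by apply: le_trans tau1.
have mono s t : 0 <= s -> s <= t -> t <= tau -> L s <= L t.
  move=> s0 st tt; have [|c /andP[sc ct] E] := @scalar_mvt R L L' s t st.
    by move=> r /andP[sr rt]; apply: dL; rewrite (le_trans s0 sr) (le_trans rt tt).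
  rewrite -subr_ge0 E mulr_ge0 ?subr_ge0 //.
  have c1 : 0 <= c <= tau by rewrite (le_trans s0 sc) (le_trans ct tt).
  by rewrite (le_trans _ (hL _ c1)) // mulr_ge0 ?e0 // ltW.
have e00 : 0 <= e 0 by apply: e0; rewrite lexx.
have L1 : mu * (e 0 * expR (- C)) <= L 1.
  have [|c /andP[c0 c1] E] := @scalar_mvt R L L' 0 1 ler01.
    by move=> r /andP[r0 r1]; apply: dL; rewrite r0 (le_trans r1).
  have c1' : 0 <= c <= tau by rewrite c0 (le_trans c1).
  have -> : L 1 = L 0 + L' c by move: E; rewrite subr0 mulr1 => <-; rewrite addrC subrK.
  rewrite ler_wpDl // (le_trans _ (hL _ c1')) // ler_pM2l //.
  have [||_] := @gronwall e e' C 0 c c0.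
  - by move=> t /andP[t0 tc]; apply: de; rewrite t0 (le_trans tc) // (le_trans c1).
  - by move=> t /andP[t0 tc]; apply: he; rewrite t0 (le_trans tc) // (le_trans c1).
  rewrite subr0 => h.
  apply: (le_trans (ler_wpM2r (expR_ge0 _) h)).
  rewrite -mulrA -expRD ler_piMr ?e0 // -expR0 ler_expR.
  by rewrite subr_le0 ler_piMr.
have L2 t : 1 <= t -> t <= tau -> mu * (e 0 * expR (- C)) <= K * e t.
  move=> t1 tt; rewrite (le_trans L1) // (le_trans (mono 1 t _ _ _)) //.
  by apply: hK; rewrite tt (le_trans _ t1).
have [|c /andP[c1 ct] E] := @scalar_mvt R L L' 1 tau tau1.
  by move=> r /andP[r0 r1]; apply: dL; rewrite r1 (le_trans _ r0).
have c1' : 0 <= c <= tau by rewrite ct (le_trans _ c1).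
have L10 : 0 <= L 1 by apply: le_trans L0 (mono _ _ _ _ _).
have : L' c * (tau - 1) <= K * e tau.
  rewrite -E (le_trans _ (hK _ _)) ?tau0 ?lexx //.
  by rewrite lerBlDr lerDl.
have hc : mu * (e c) * (tau - 1) <= L' c * (tau - 1).
  by rewrite ler_wpM2r ?subr_ge0 // hL.
move=> /(le_trans hc) h.
have h2 := ler_wpM2l (_ : 0 <= mu * (tau - 1)) (L2 c c1 ct).
have {}h2 := h2 (mulr_ge0 (ltW mu0) (_ : 0 <= tau - 1)).
have h3 := ler_wpM2l (ltW K0) h.
have -> : e 0 * (tau - 1) * (mu ^+ 2 * expR (- C)) =
  mu * (tau - 1) * (mu * (e 0 * expR (- C))) by ring.
rewrite (le_trans (h2 _)) ?subr_ge0 //.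
have -> : mu * (tau - 1) * (K * e c) = K * (mu * e c * (tau - 1)) by ring.
by rewrite (le_trans h3) // expr2 mulrA.
Qed.

End C1Maps.

(** * Lyapunov forms of hyperbolic matrices *)

Section Lyapunov.
Context {R : realType}.
Local Notation C := (complex R).
Local Notation Re := complex.Re.
Local Notation Im := complex.Im.

(** The real part of [z] times the conjugate of [w], that is, the Euclidean inner product of the
    complex plane. *)
Definition rdot (z w : C) : R := Re z * Re w + Im z * Im w.

Lemma rdotC z w : rdot z w = rdot w z.
Proof. by rewrite /rdot; ring. Qed.

Lemma rdotDl z1 z2 w : rdot (z1 + z2) w = rdot z1 w + rdot z2 w.
Proof. by case: z1 z2 w => [a b] [c d] [e f]; rewrite /rdot /=; ring. Qed.

Lemma rdot0l w : rdot 0 w = 0.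
Proof. by case: w => [e f]; rewrite /rdot /= !mul0r addr0. Qed.

Lemma rdot_suml (I : finType) (F : I -> C) w :
  rdot (\sum_i F i) w = \sum_i rdot (F i) w.
Proof.
by rewrite (big_morph (rdot^~ w) (fun a b => rdotDl a b w) (rdot0l w)).
Qed.

Lemma rdot_sumr (I : finType) (F : I -> C) w :
  rdot w (\sum_i F i) = \sum_i rdot w (F i).
Proof. by rewrite rdotC rdot_suml; apply: eq_bigr => i _; rewrite rdotC. Qed.

Lemma rdotZ (a b : R) z w :
  rdot (real_complex R a * z) (real_complex R b * w) = a * b * rdot z w.
Proof. by case: z w => [c d] [e f]; rewrite /rdot /=; ring. Qed.

(** Here the real parts of eigenvalues enter: the imaginary part of [t] contributes a vector
    orthogonal to [z]. *)
Lemma rdot_mulr t z : rdot (z * t) z = Re t * rdot z z.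
Proof. by case: z t => [c d] [e f]; rewrite /rdot /=; ring. Qed.

Lemma rdot_ge0 z : 0 <= rdot z z.
Proof. by rewrite /rdot -!expr2 addr_ge0 // sqr_ge0. Qed.

Lemma rdot_eq0 z : (rdot z z == 0) = (z == 0).
Proof.
case: z => a b; rewrite /rdot /= -!expr2 paddr_eq0 ?sqr_ge0 // !sqrf_eq0.
by rewrite eq_complex /=.
Qed.

(** For each sign [e] the gap between the two sides is a sum of two squares divided by [2 * s]. The
    free weight [s] decides how much of the product is charged to [w]. *)
Lemma rdot_amgm (s : R) z w a : 0 < s ->
  `|rdot (z * a) w| <= s / 2 * rdot w w + (rdot a a / (2 * s)) * rdot z z.
Proof.
move=> s0.
have H (e : R) : e ^+ 2 = 1 -> e * rdot (z * a) w <= s / 2 * rdot w w + (rdot a a / (2 * s)) * rdot z z.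
  move=> e1; rewrite -subr_ge0.
  have -> : s / 2 * rdot w w + (rdot a a / (2 * s)) * rdot z z - e * rdot (z * a) w =
    ((s * Re w - e * Re (z * a)) ^+ 2 + (s * Im w - e * Im (z * a)) ^+ 2) / (2 * s).
    have -> : ((s * Re w - e * Re (z * a)) ^+ 2 + (s * Im w - e * Im (z * a)) ^+ 2) =
      s ^+ 2 * rdot w w + e ^+ 2 * rdot (z * a) (z * a) - 2 * s * e * rdot (z * a) w.
      by rewrite /rdot; ring.
    have -> : rdot (z * a) (z * a) = rdot a a * rdot z z.
      by case: z a => [c d] [e' f]; rewrite /rdot /=; ring.
    rewrite e1; field; exact: lt0r_neq0.
  by rewrite divr_ge0 ?addr_ge0 ?sqr_ge0 // mulr_ge0 // ltW.
rewrite ler_norml; apply/andP; split; last by have := H 1 (expr1n _ _); rewrite mul1r.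
have := H (-1); rewrite sqrrN expr1n mulN1r => /(_ erefl) h.
by rewrite lerNl.
Qed.

(* The weight of each new coordinate is chosen small enough for the off-diagonal
   terms to be absorbed by the weights already chosen. *)
Lemma trig_lyapunov n (T : 'M[C]_n) : is_trig_mx T ->
  (forall i, Re (T i i) != 0) ->
  exists d : 'I_n -> R, exists2 mu : R, 0 < mu & forall y : 'rV[C]_n,
    mu * (\sum_i rdot (y 0 i) (y 0 i)) <= \sum_i d i * rdot ((y *m T) 0 i) (y 0 i).
Proof.
elim: n T => [T _ _|n IH T Ttrig Tdiag].
  by exists (fun=> 0); exists 1 => // y; rewrite !big_ord0 mulr0.
pose l (i : 'I_n) : 'I_n.+1 := lift ord0 i.
pose T' := \matrix_(i, j) T (l i) (l j).
have [||d [mu mu0 hmu]] := IH T'.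
- apply/is_trig_mxP => i j ij; rewrite mxE; move/is_trig_mxP: Ttrig; apply.
  by rewrite /l /= /bump /=.
- by move=> i; rewrite mxE; exact: Tdiag.
pose t := T ord0 ord0; pose rho := `|Re t|.
have rho0 : 0 < rho by rewrite normr_gt0 Tdiag.
(* Each of the [n] off-diagonal terms is charged [s / 2] times [N0], so together they use at most
   half of the diagonal term [rho * N0]. *)
pose s : R := rho / n.+1%:R.
have s0 : 0 < s by rewrite divr_gt0.
pose B := \sum_(i < n) (rdot (T (l i) ord0) (T (l i) ord0) / (2 * s)).
have B0 : 0 <= B.
  by apply: sumr_ge0 => i _; rewrite divr_ge0 ?rdot_ge0 // mulr_ge0 // ltW.
pose k := mu / (2 * (B + 1)).
have B10 : 0 < 2 * (B + 1) by rewrite mulr_gt0 // ltr_wpDl.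
have k0 : 0 < k by rewrite divr_gt0.
(* The sign of [Re t] makes the diagonal contribution of the new coordinate positive. *)
exists (fun i => if unlift ord0 i is Some j then d j else k * Num.sg (Re t)).
exists (Num.min (k * (rho / 2)) (mu / 2)).
  by rewrite lt_min !divr_gt0 // mulr_gt0 // divr_gt0.
move=> y; pose y' := \row_j y 0 (l j).
rewrite !big_ord_recl unlift_none /=.
under [X in _ <= _ + X]eq_bigr do rewrite liftK.
have E1 : \sum_(i < n) d i * rdot ((y *m T) 0 (lift ord0 i)) (y 0 (lift ord0 i)) =
    \sum_i d i * rdot ((y' *m T') 0 i) (y' 0 i).
  apply: eq_bigr => i _; congr (_ * rdot _ _); last by rewrite mxE.
  rewrite !mxE big_ord_recl.
  have -> : T ord0 (lift ord0 i) = 0 by move/is_trig_mxP: Ttrig; apply.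
  by rewrite mulr0 add0r; apply: eq_bigr => j _; rewrite !mxE.
have {E1}-> := E1.
have := hmu y'.
have -> : \sum_i rdot (y' 0 i) (y' 0 i) = \sum_(i < n) rdot (y 0 (lift ord0 i)) (y 0 (lift ord0 i)).
  by apply: eq_bigr => i _; rewrite mxE.
set N := \sum_(i < n) rdot _ _; set N0 := rdot (y 0 ord0) (y 0 ord0).
move=> h.
have N_ge0 : 0 <= N by apply: sumr_ge0 => i _; exact: rdot_ge0.
have N0_ge0 : 0 <= N0 by exact: rdot_ge0.
have h0 : rho * N0 - (rho / 2 * N0 + B * N) <= Num.sg (Re t) * rdot ((y *m T) 0 ord0) (y 0 ord0).
  rewrite mxE big_ord_recl rdotDl [leRHS]mulrDr rdot_mulr (mulrA (Num.sg _)) -/t.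
  rewrite -normrEsg -/rho -/N0 lerD2l rdot_suml.
  apply: lerNnormlW; rewrite normrM.
  have -> : `|Num.sg (Re t)| = 1 by rewrite normr_sg Tdiag.
  rewrite mul1r (le_trans (ler_norm_sum _ _ _)) //.
  apply: (@le_trans _ _ (\sum_(i < n) (s / 2 * N0 +
    (rdot (T (l i) ord0) (T (l i) ord0) / (2 * s)) * rdot (y 0 (l i)) (y 0 (l i))))).
    by apply: ler_sum => i _; exact: rdot_amgm.
  rewrite big_split /= sumr_const card_ord lerD //.
    rewrite -mulrnAl ler_wpM2r // -mulr_natr /s.
    rewrite mulrAC ler_wpM2r // mulrAC -mulrA ler_piMr // ?(ltW rho0) //.
    by rewrite ler_pdivrMr // mul1r ler_nat leqnSn.
  rewrite /B mulr_suml; apply: ler_sum => i _; rewrite ler_wpM2l //.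
    by rewrite divr_ge0 ?rdot_ge0 // mulr_ge0 // ltW.
  rewrite /N (bigD1 i) //= lerDl; apply: sumr_ge0 => j _; exact: rdot_ge0.
have h1 := ler_wpM2l (ltW k0) h0.
have kB : k * B <= mu / 2.
  rewrite /k mulrAC ler_pdivrMr // mulrA divfK // ler_pM2l //.
  by rewrite lerDl.
have h2 := ler_wpM2r N_ge0 kB.
have m1 : Num.min (k * (rho / 2)) (mu / 2) * N0 <= k * (rho / 2) * N0.
  by rewrite ler_wpM2r // ge_min lexx.
have m2 : Num.min (k * (rho / 2)) (mu / 2) * N <= mu / 2 * N.
  by rewrite ler_wpM2r // ge_min lexx orbT.
move: h1 h2 h m1 m2; move: (Num.min _ _) => m; move: (rdot _ (y 0 ord0)) => P.
move: (\sum_(i < n) _) => S.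
rewrite -[k * _ * P]mulrA; move: (Num.sg _ * P) => Q.
lra.
Qed.

(** Schur triangularisation over the complex numbers gives access to [trig_lyapunov]. The diagonal
    form found there, read on real vectors through [Q = invmx P], has a real symmetric matrix
    because [rdot] is real valued. The positive quantity is half the derivative of the form of [S]
    along the row equation [x' = x *m A]. *)
Lemma lyapunov n (A : 'M[R]_n) :
  (forall l : C, eigenvalue (map_mx (real_complex R) A) l -> Re l != 0) ->
  exists2 S : 'M[R]_n, S^T = S &
    forall x : 'rV[R]_n, x != 0 -> 0 < (x *m A *m S *m x^T) 0 0.
Proof.
(* Schur's theorem asks for positive dimension; in dimension 0 there is no nonzero vector to
   test. *)
case: n A => [A _|n A hA].
  by exists 0; [rewrite trmx0|move=> x; rewrite [x]thinmx0 eqxx].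
set Ac := map_mx (real_complex R) A.
have [P Pu] := Schur Ac (ltn0Sn n).
have Pun := unitarymx_unit Pu.
set T := conjmx P Ac => Ttrig.
have TE : T = P *m Ac *m invmx P by rewrite /T conjumx.
have Tdiag i : Re (T i i) != 0.
  apply: hA; apply: (@eigenvalue_conjmx _ _ _ P); rewrite ?row_free_unit //.
    by rewrite submx_full // row_full_unit.
  rewrite -/T [_ \in _]eigenvalue_root_char char_poly_trig //.
  by rewrite (bigD1 i) //= rootM root_XsubC eqxx.
have [d [mu mu0 hd]] := trig_lyapunov Ttrig Tdiag.
pose Q := invmx P.
exists (\matrix_(j, k) \sum_i d i * rdot (Q j i) (Q k i)).
  by apply/matrixP => j k; rewrite !mxE; apply: eq_bigr => i _; rewrite rdotC.
set S := \matrix_(j, k) _.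
have SE (u w : 'rV[R]_n.+1) : (u *m S *m w^T) 0 0 =
    \sum_i d i * rdot ((map_mx (real_complex R) u *m Q) 0 i) ((map_mx (real_complex R) w *m Q) 0 i).
  have mE (v : 'rV[R]_n.+1) i : (map_mx (real_complex R) v *m Q) 0 i =
      \sum_j real_complex R (v 0 j) * Q j i.
    by rewrite mxE; apply: eq_bigr => j _; rewrite mxE.
  transitivity (\sum_i \sum_k \sum_j d i * (u 0 j * w 0 k * rdot (Q j i) (Q k i))).
    rewrite mxE exchange_big /=; apply: eq_bigr => k _.
    rewrite mxE mulr_suml exchange_big /=; apply: eq_bigr => j _.
    by rewrite !mxE mulr_sumr mulr_suml; apply: eq_bigr => i _; ring.
  apply: eq_bigr => i _; rewrite !mE rdot_sumr mulr_sumr; apply: eq_bigr => k _.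
  rewrite rdot_suml mulr_sumr; apply: eq_bigr => j _.
  by rewrite rdotZ.
move=> x x0; rewrite SE map_mxM -/Ac.
pose y := map_mx (real_complex R) x *m Q.
have yT : map_mx (real_complex R) x *m Ac *m Q = y *m T.
  by rewrite TE !mulmxA /y mulmxKV.
rewrite yT -/y; apply: lt_le_trans (hd y).
rewrite mulr_gt0 // lt_neqAle sumr_ge0 ?andbT => [|i _]; last exact: rdot_ge0.
rewrite eq_sym psumr_eq0 => [|i _]; last exact: rdot_ge0.
apply: contra x0 => /allP h.
have y0 : y = 0.
  apply/rowP => i; have := h i (mem_index_enum _); rewrite /= rdot_eq0 => /eqP ->.
  by rewrite mxE.
have : map_mx (real_complex R) x = 0 by rewrite -[LHS](mulmxKV Pun) // -/Q -/y y0 mul0mx.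
move=> /rowP hx; apply/eqP/rowP => i; have := hx i; rewrite !mxE.
by case.
Qed.

End Lyapunov.

(** * Norm estimates, coercivity and differentiation of quadratic forms *)

Section QuadraticForms.
Context {R : realType}.

(** The largest-entry norm is not submultiplicative; this factor [n] is the source of the powers of
    [n] in all later constants. *)
Lemma mulmx_norm_le m n p (A : 'M[R]_(m, n)) (B : 'M[R]_(n, p)) :
  `|A *m B| <= n%:R * `|A| * `|B|.
Proof.
apply: mx_norm_le => [|i j]; first by rewrite !mulr_ge0.
rewrite mxE (le_trans (ler_norm_sum _ _ _)) //.
apply: (@le_trans _ _ (\sum_(k < n) `|A| * `|B|)).
  by apply: ler_sum => k _; rewrite normrM ler_pM // norm_coord_le.
by rewrite sumr_const card_ord -mulrnAl -mulr_natl.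
Qed.

Lemma trmx_norm m n (A : 'M[R]_(m, n)) : `|A^T| = `|A|.
Proof.
have H p q (B : 'M[R]_(p, q)) : `|B^T| <= `|B|.
  by apply: mx_norm_le => // i j; rewrite mxE norm_coord_le.
by apply/eqP; rewrite eq_le H -{1}(trmxK A) H.
Qed.

Definition bform n (G : 'M[R]_n) (x y : 'rV[R]_n) : R := (x *m G *m y^T) 0 0.

Lemma bform_le n (G : 'M[R]_n) x y :
  `|bform G x y| <= n%:R ^+ 2 * `|G| * `|x| * `|y|.
Proof.
rewrite /bform (le_trans (norm_coord_le _ _ _)) // (le_trans (mulmx_norm_le _ _)) //.
rewrite trmx_norm.
have h := ler_wpM2r (normr_ge0 y) (ler_wpM2l (ler0n R n) (mulmx_norm_le x G)).
by rewrite (le_trans h) // le_eqVlt; apply/orP; left; apply/eqP; ring.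
Qed.

Lemma bformDl n (G : 'M[R]_n) x y z : bform G (x + y) z = bform G x z + bform G y z.
Proof. by rewrite /bform !mulmxDl mxE. Qed.

Lemma bformDr n (G : 'M[R]_n) x y z : bform G z (x + y) = bform G z x + bform G z y.
Proof. by rewrite /bform raddfD /= mulmxDr mxE. Qed.

Lemma bformNl n (G : 'M[R]_n) x z : bform G (- x) z = - bform G x z.
Proof. by rewrite /bform !mulNmx mxE. Qed.

Lemma bformNr n (G : 'M[R]_n) x z : bform G z (- x) = - bform G z x.
Proof. by rewrite /bform raddfN /= mulmxN mxE. Qed.

Lemma bformZl n (G : 'M[R]_n) a x z : bform G (a *: x) z = a * bform G x z.
Proof. by rewrite /bform -!scalemxAl mxE. Qed.

Lemma bformZr n (G : 'M[R]_n) a x z : bform G z (a *: x) = a * bform G z x.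
Proof. by rewrite /bform linearZ /= -scalemxAr mxE. Qed.

Lemma bformC n (G : 'M[R]_n) x y : G^T = G -> bform G x y = bform G y x.
Proof.
move=> GT; rewrite /bform.
have -> : (y *m G *m x^T) 0 0 = (y *m G *m x^T)^T 0 0 by rewrite [RHS]mxE.
by rewrite trmx_mul trmx_mul trmxK mulmxA GT.
Qed.

Lemma bformE n (G : 'M[R]_n) x y : bform G x y = \sum_k \sum_j x 0 j * G j k * y 0 k.
Proof.
rewrite /bform mxE; apply: eq_bigr => k _.
by rewrite !mxE mulr_suml; apply: eq_bigr => j _.
Qed.

Lemma qform_continuous n (G : 'M[R]_n) : continuous (fun x => bform G x x).
Proof.
move=> x; apply/continuous_normP => e e0.
pose K := n%:R ^+ 2 * `|G| * (`|x| + 1 + `|x|) + 1.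
have K0 : 0 < K by rewrite ltr_wpDl // !mulr_ge0 // addr_ge0 // addr_ge0.
exists (Num.min 1 (e / K)); first by rewrite lt_min ltr01 divr_gt0.
move=> y; rewrite lt_min => /andP[y1 ye].
have -> : bform G y y - bform G x x = bform G (y - x) y + bform G x (y - x).
  by rewrite bformDl bformNl bformDr bformNr; ring.
have hy : `|y| <= `|x| + 1.
  by rewrite -(subrK x y) (le_trans (ler_normD _ _)) // addrC lerD2l ltW.
have h1 := bform_le G (y - x) y; have h2 := bform_le G x (y - x).
apply: (@le_lt_trans _ _ (K * `|y - x|)); last by rewrite mulrC -ltr_pdivlMr.
rewrite (le_trans (ler_normD _ _)) // (le_trans (lerD h1 h2)) //.
have h3 : n%:R ^+ 2 * `|G| * `|y - x| * `|y| <= n%:R ^+ 2 * `|G| * `|y - x| * (`|x| + 1).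
  by rewrite ler_wpM2l // !mulr_ge0.
rewrite (le_trans (lerD h3 (lexx _))) // /K mulrDl mul1r ler_wpDr //.
by rewrite le_eqVlt; apply/orP; left; apply/eqP; ring.
Qed.

Lemma sphere_compact n : compact [set x : 'rV[R]_n | `|x| = 1].
Proof.
apply: bounded_closed_compact.
  exists 1; split; first by rewrite num_real.
  by move=> M M1 x /= ->; exact: ltW.
have -> : [set x : 'rV[R]_n | `|x| = 1] = Num.norm @^-1` [set 1] by [].
apply: closed_comp; last exact: closed_eq.
by move=> x _; exact: norm_continuous.
Qed.

(** The constant is the minimum of the form on the compact unit sphere, carried to all vectors by
    homogeneity. In dimension 0 the sphere is empty and any constant serves. *)
Lemma posdef_coercive n (G : 'M[R]_n) : (forall x, x != 0 -> 0 < bform G x x) ->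
  exists2 mu : R, 0 < mu & forall x, mu * `|x| ^+ 2 <= bform G x x.
Proof.
move=> Gpos.
have G0 : bform G 0 0 = 0 by rewrite /bform !mul0mx mxE.
have norm1 (x : 'rV[R]_n) : x != 0 -> `| `|x|^-1 *: x | = 1.
  by move=> x0; rewrite normrZ normfV normr_id mulVf // normr_eq0.
have [[x0 x01]|nS] := pselect ([set x : 'rV[R]_n | `|x| = 1] !=set0); last first.
  exists 1 => // x; have [->|xn0] := eqVneq x 0; first by rewrite normr0 expr0n mulr0 G0.
  by exfalso; apply: nS; exists (`|x|^-1 *: x); exact: norm1.
have [//||c cS hc] := @EVT_min_rV R n (fun x => bform G x x) _ _ (@sphere_compact n).
- by exists x0.
- by apply: continuous_subspaceT => x; exact: qform_continuous.
rewrite inE /= in cS.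
have c0 : c != 0 by rewrite -normr_eq0 cS oner_eq0.
exists (bform G c c); first exact: Gpos.
move=> x; have [->|xn0] := eqVneq x 0; first by rewrite normr0 expr0n mulr0 G0.
have := hc (`|x|^-1 *: x); rewrite inE /= => /(_ (norm1 _ xn0)).
have xx : 0 < `|x| ^+ 2 by rewrite exprn_gt0 // normr_gt0.
rewrite bformZl bformZr mulrA -expr2 => h.
have := ler_wpM2r (ltW xx) h.
by rewrite mulrAC -exprMn mulVf ?normr_eq0 // expr1n mul1r.
Qed.

Lemma is_derive_qform n (S : 'M[R]_n) (u : R -> 'rV[R]_n) (t : R) (l : 'rV[R]_n) :
  S^T = S -> is_derive t 1 u l ->
  is_derive t 1 (fun s => bform S (u s) (u s)) (2 * bform S l (u t)).
Proof.
move=> ST ul; apply/is_derive_approx => e e0.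
pose K := n%:R ^+ 2 * `|S|.
have K0 : 0 <= K by rewrite mulr_ge0.
pose c := 2 * K * `|u t| + 1.
have c0 : 0 < c by rewrite ltr_wpDl // !mulr_ge0.
pose L := `|l| + 1.
have L0 : 0 < L by rewrite ltr_wpDl.
pose e1 := Num.min 1 (e / (2 * c)).
have e10 : 0 < e1 by rewrite lt_min ltr01 divr_gt0 // mulr_gt0.
have [r r0 hr] := (is_derive_approx _ _ _).1 ul _ e10.
pose r2 := e / (2 * (K * L * L + 1)).
have KL0 : 0 < 2 * (K * L * L + 1) by rewrite mulr_gt0 // ltr_wpDl // !mulr_ge0 // ltW.
exists (Num.min r r2); first by rewrite lt_min r0 divr_gt0.
move=> s; rewrite lt_min => /andP[/hr h1 sr2].
set d := u s - u t in h1 *.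
have -> : bform S (u s) (u s) - bform S (u t) (u t) - (s - t) *: (2 * bform S l (u t)) =
    2 * bform S (d - (s - t) *: l) (u t) + bform S d d.
  have -> : u s = d + u t by rewrite subrK.
  clearbody d.
  rewrite !(bformDl, bformDr, bformNl, bformZl) (bformC (u t) d ST) /GRing.scale /=; ring.
have dl : `|d| <= L * `|s - t|.
  rewrite -(subrK ((s - t) *: l) d) (le_trans (ler_normD _ _)) // normrZ.
  rewrite mulrDl mul1r addrC mulrC lerD2l (le_trans h1) // ler_piMl //.
  by rewrite ge_min lexx.
rewrite (le_trans (ler_normD _ _)) //.
have -> : e * `|s - t| = e / 2 * `|s - t| + e / 2 * `|s - t| by rewrite -mulrDl -splitr.
rewrite lerD //.
  rewrite normrM ger0_norm //.
  have h2 := bform_le S (d - (s - t) *: l) (u t).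
  rewrite -/K in h2.
  apply: (@le_trans _ _ (c * `|d - (s - t) *: l|)).
    have -> : c * `|d - (s - t) *: l| =
        2 * (K * `|d - (s - t) *: l| * `|u t|) + `|d - (s - t) *: l| by rewrite /c; ring.
    have := normr_ge0 (d - (s - t) *: l); lra.
  have h3 : `|d - (s - t) *: l| <= e / (2 * c) * `|s - t|.
    by rewrite (le_trans h1) // ler_wpM2r // ge_min lexx orbT.
  have := ler_wpM2l (ltW c0) h3; congr (_ <= _); field; exact: lt0r_neq0.
have h2 := bform_le S d d; rewrite -/K in h2.
rewrite (le_trans h2) //.
apply: (@le_trans _ _ (K * L * L * `|s - t| * `|s - t|)).
  have h3 : `|d| * `|d| <= (L * `|s - t|) * (L * `|s - t|) by rewrite ler_pM.
  have := ler_wpM2l K0 h3; congr (_ <= _); ring.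
rewrite ler_wpM2r //.
apply: (@le_trans _ _ ((K * L * L + 1) * r2)).
  have KLL0 : 0 <= K * L * L by rewrite !mulr_ge0 // ltW.
  by apply: ler_pM; rewrite ?lerDl ?(ltW sr2).
rewrite /r2 le_eqVlt; apply/orP; left; apply/eqP; field.
by apply: lt0r_neq0; rewrite ltr_wpDl // !mulr_ge0 // ltW.
Qed.

Lemma lyapunov_coercive n (A : 'M[R]_n) :
  (forall l, eigenvalue (map_mx (complex.real_complex R) A) l -> complex.Re l != 0) ->
  exists S : 'M[R]_n, exists2 mu : R, 0 < mu & S^T = S /\
    forall x, mu * `|x| ^+ 2 <= bform S (x *m A) x.
Proof.
move=> /lyapunov[S ST SA].
have [x x0|mu mu0 h] := @posdef_coercive n (A *m S).
  by rewrite /bform mulmxA; exact: SA.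
by exists S, mu => //; split => // x; have := h x; rewrite /bform mulmxA.
Qed.

Lemma form_unitmx n (A : 'M[R]_n) : (forall x : 'rV[R]_n, x *m A = 0 -> x = 0) ->
  A \in unitmx.
Proof.
move=> h; rewrite -row_free_unit -kermx_eq0; apply/eqP/row_matrixP => i.
by rewrite row0; apply: h; rewrite -row_mul mulmx_ker row0.
Qed.

(* The same form inverted serves the adjoint equation satisfied by covectors. *)
Lemma lyapunov_dual n (A : 'M[R]_n) :
  (forall l, eigenvalue (map_mx (complex.real_complex R) A) l -> complex.Re l != 0) ->
  exists T : 'M[R]_n, exists2 mu : R, 0 < mu & T^T = T /\
    forall x, mu * `|x| ^+ 2 <= bform T (- (x *m A^T)) x.
Proof.
move=> /lyapunov[S ST SA].
have Su : S \in unitmx.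
  apply: form_unitmx => x xS; apply/eqP; apply: contraT => x0.
  have := SA x x0; rewrite -/(bform S (x *m A) x) bformC // /bform xS mul0mx mxE.
  by rewrite ltxx.
(* At [x] the form of [A^T *m invmx S] equals that of [A *m S] at [y = x *m invmx S], after one
   transposition. *)
have [x x0|mu mu0 h] := @posdef_coercive n (A^T *m invmx S).
  have y0 : x *m invmx S != 0.
    by apply: contra x0 => /eqP h; rewrite -(mulmxKV Su x) h mul0mx.
  have := SA _ y0; rewrite -!mulmxA /bform trmx_mul trmx_inv ST.
  rewrite [S *m _]mulmxA mulmxV // mul1mx.
  have -> : (x *m (invmx S *m (A *m x^T))) 0 0 = (x *m (invmx S *m (A *m x^T)))^T 0 0.
    by rewrite [RHS]mxE.
  by rewrite !trmx_mul trmxK trmx_inv ST !mulmxA.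
exists (- invmx S), mu => //; split; first by rewrite raddfN /= trmx_inv ST.
by move=> x; have := h x; rewrite /bform !mulmxA mulNmx mulmxN opprK.
Qed.

(** A kernel vector of [A] would annihilate the positive form. This invertibility is all that the
    isolation of singularities draws from hyperbolicity. *)
Lemma hyperbolic_unit n (A : 'M[R]_n) :
  (forall l, eigenvalue (map_mx (complex.real_complex R) A) l -> complex.Re l != 0) ->
  A \in unitmx.
Proof.
move=> /lyapunov[S ST SA]; apply: form_unitmx => x xA; apply/eqP; apply: contraT => x0.
by have := SA x x0; rewrite xA !mul0mx mxE ltxx.
Qed.

Lemma unitmx_lower n (A : 'M[R]_n) : A \in unitmx ->
  exists2 c : R, 0 < c & forall x : 'rV[R]_n, c * `|x| <= `|x *m A|.
Proof.
move=> Au; pose K := n%:R * `|invmx A| + 1.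
have K0 : 0 < K by rewrite ltr_wpDl // mulr_ge0.
exists K^-1; first by rewrite invr_gt0.
move=> x; rewrite mulrC ler_pdivrMr //.
rewrite -{1}(mulmxK Au x) (le_trans (mulmx_norm_le _ _)) //.
by rewrite /K mulrDr mulr1 ler_wpDr // le_eqVlt; apply/orP; left; apply/eqP; ring.
Qed.

End QuadraticForms.

(** * Charts, integral curves and flows *)

Section Charts.
Context {R : realType} {n : nat} {M : manifold R n}.
Implicit Types (c : chart R n M) (x z : M) (X : vector_field M) (gam : R -> M).

Lemma atlas_chart_at x : atlas (chart_at x).
Proof. by rewrite /chart_at; case: cid2. Qed.

Lemma chart_at_dom x : chart_dom (chart_at x) x.
Proof. by rewrite /chart_at; case: cid2. Qed.

Lemma near_chart_dom c x : chart_dom c x -> \forall z \near x, chart_dom c z.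
Proof. by move=> cx; apply: open_nbhs_nbhs; split=> //; exact: chart_dom_open. Qed.

Lemma codomP c x : chart_dom c x -> chart_codom c (c x).
Proof. by move=> cx; exists x. Qed.

Lemma chart_inv_dom c y : chart_codom c y -> chart_dom c (chart_inv c y).
Proof. by move=> [x cx <-]; rewrite chart_mapK. Qed.

Lemma chart_invK c y : chart_codom c y -> c (chart_inv c y) = y.
Proof. by move=> [x cx <-]; rewrite chart_mapK. Qed.

Lemma near_chart_inv c x (P : set M) : chart_dom c x -> (\forall z \near x, P z) ->
  \forall y \near c x, chart_codom c y /\ P (chart_inv c y).
Proof.
move=> cx Px; near=> y; split; near: y.
  by apply: open_nbhs_nbhs; split; [exact: chart_codom_open|exact: codomP].
have : chart_inv c @ c x --> chart_inv c (c x) := chart_inv_continuous (codomP cx).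
by rewrite chart_mapK //; apply.
Unshelve. all: by end_near. Qed.

Lemma near_chart c x (P : set M) : chart_dom c x -> (\forall z \near x, P z) ->
  exists2 r : R, 0 < r & forall y, `|y - c x| < r ->
    chart_codom c y /\ P (chart_inv c y).
Proof. by move=> cx Px; apply/near_normP; exact: near_chart_inv. Qed.

Lemma chart_pull c x (Q : set 'rV[R]_n) : chart_dom c x -> (\forall y \near c x, Q y) ->
  \forall z \near x, chart_dom c z /\ Q (c z).
Proof.
move=> cx Qx; near=> z; split; near: z; first exact: near_chart_dom.
exact: (chart_map_continuous cx).
Unshelve. all: by end_near. Qed.

Lemma transition_C1 c c' x : atlas c -> atlas c' -> chart_dom c x -> chart_dom c' x ->
  C1_at (c' \o chart_inv c) (c x).
Proof.
move=> ac ac' cx c'x.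
have [df Df] := atlas_compat ac ac' 1%N.
have nb : \forall y \near c x, (c @` (chart_dom c `&` chart_dom c')) y.
  apply: filterS (near_chart_inv cx (near_chart_dom c'x)) => y [cy c'y].
  exists (chart_inv c y); last exact: chart_invK.
  by split => //; exact: chart_inv_dom.
apply: near_C1_at; first by apply: filterS nb => y; exact: df.
by move=> v; apply: Df; exact: nbhs_singleton nb.
Qed.

Lemma to_coordE c x v : to_coord c x v = dif (c \o chart_inv (chart_at x)) (chart_at x x) v.
Proof. by rewrite difE. Qed.

Lemma of_coordE c x v : of_coord c x v = dif (chart_at x \o chart_inv c) (c x) v.
Proof. by rewrite difE. Qed.

Lemma transition_comp c1 c2 c3 x v : atlas c1 -> atlas c2 -> atlas c3 ->
  chart_dom c1 x -> chart_dom c2 x -> chart_dom c3 x ->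
  dif (c3 \o chart_inv c1) (c1 x) v =
  dif (c3 \o chart_inv c2) (c2 x) (dif (c2 \o chart_inv c1) (c1 x) v).
Proof.
move=> a1 a2 a3 d1 d2 d3.
have d12 := C1_at_diff (transition_C1 a1 a2 d1 d2).
have d23 := C1_at_diff (transition_C1 a2 a3 d2 d3).
have E : (c2 \o chart_inv c1) (c1 x) = c2 x by rewrite /= chart_mapK.
have d23' : differentiable (c3 \o chart_inv c2) ((c2 \o chart_inv c1) (c1 x)) by rewrite E.
have := dif_comp v d12 d23'; rewrite E => <-; symmetry.
apply: (near_eq_diff _ (C1_at_diff (transition_C1 a1 a3 d1 d3))).2.
apply: filterS (near_chart_inv d1 (near_chart_dom d2)) => y [_ dy] /=.
by rewrite chart_mapK.
Qed.

Lemma dif_transition_id c x v : atlas c -> chart_dom c x ->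
  dif (c \o chart_inv c) (c x) v = v.
Proof.
move=> ac cx.
have did : differentiable (id : 'rV[R]_n -> 'rV[R]_n) (c x) by [].
have [|_ ->] := @near_eq_diff _ _ _ id (c \o chart_inv c) (c x) _ did.
  apply: filterS (near_chart_inv cx (near_chart_dom cx)) => y [cy _] /=.
  by rewrite chart_invK.
by rewrite difE diff_val.
Qed.

Lemma of_coordK c x v : atlas c -> chart_dom c x -> to_coord c x (of_coord c x v) = v.
Proof.
move=> ac cx; have a0 := atlas_chart_at x; have d0 := chart_at_dom x.
by rewrite to_coordE of_coordE -(transition_comp _ ac a0 ac) // dif_transition_id.
Qed.

Lemma to_coordK c x v : atlas c -> chart_dom c x -> of_coord c x (to_coord c x v) = v.
Proof.
move=> ac cx; have a0 := atlas_chart_at x; have d0 := chart_at_dom x.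
by rewrite to_coordE of_coordE -(transition_comp _ a0 ac a0) // dif_transition_id.
Qed.

Lemma to_coord_chart_at x v : to_coord (chart_at x) x v = v.
Proof. by rewrite to_coordE dif_transition_id //; [exact: atlas_chart_at|exact: chart_at_dom]. Qed.

Lemma local_repE X c z : chart_dom c z -> local_rep X c (c z) = to_coord c z (X z).
Proof. by move=> cz; rewrite /local_rep chart_mapK. Qed.

Lemma to_coord0 c x : to_coord c x 0 = 0.
Proof. by rewrite to_coordE linear0. Qed.

Lemma to_coordZ c x a v : to_coord c x (a *: v) = a *: to_coord c x v.
Proof. by rewrite !to_coordE linearZ. Qed.

Lemma to_coord_eq0 c x v : atlas c -> chart_dom c x -> (to_coord c x v == 0) = (v == 0).
Proof.
move=> ac cx; apply/eqP/eqP => [|->]; last exact: to_coord0.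
by move=> h; rewrite -(to_coordK v ac cx) h of_coordE linear0.
Qed.

Lemma local_rep_C1 X c x : Ck_vector_field 1 X -> atlas c -> chart_dom c x ->
  C1_at (local_rep X c) (c x).
Proof.
move=> XC ac cx.
have [H _] := Ck1P (local_rep X c) (@chart_codom_open R n M c : open (chart_codom c)).
exact: H (XC _ ac) _ (codomP cx).
Qed.

Lemma integral_curve_derive X gam c t : integral_curve X gam -> atlas c ->
  chart_dom c (gam t) -> is_derive t 1 (c \o gam) (local_rep X c (c (gam t))).
Proof.
move=> [gc gd] ac ct; rewrite local_repE // to_coordE.
set c0 := chart_at (gam t).
have a0 : atlas c0 := atlas_chart_at _; have d0 : chart_dom c0 (gam t) := chart_at_dom _.
have dT := C1_at_diff (transition_C1 a0 ac d0 ct).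
have := is_derive_chain (dT : differentiable (c \o chart_inv c0) ((c0 \o gam) t)) (gd t).
apply: near_eq_is_derive.
have nb : \forall s \near t, chart_dom c0 (gam s) := gc t _ (near_chart_dom d0).
apply: filterS nb => s ds.
by rewrite /= chart_mapK.
Qed.

Lemma integral_curve_shift X gam a : integral_curve X gam ->
  integral_curve X (fun s => gam (s + a)).
Proof.
move=> [gc gd]; split.
  move=> s; apply: continuous_comp; last exact: gc.
  by apply: cvgD; [exact: cvg_id|exact: cvg_cst].
move=> t; have H := gd (t + a).
apply/is_derive_approx => e e0; have [r r0 hr] := (is_derive_approx _ _ _).1 H _ e0.
exists r => // s st; have := hr (s + a).
by rewrite opprD addrACA subrr addr0 => /(_ st).
Qed.

Lemma integral_curve_cst X x : X x = 0 -> integral_curve X (fun=> x).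
Proof.
move=> Xx; split; first by move=> ?; exact: cvg_cst.
by move=> t; rewrite Xx; exact: is_derive_cst.
Qed.

(** Companion of [first_hitting]: a closed condition valid strictly before the hitting time [t0]
    persists at [t0], which is approached by the points [(1 - m) * t0]. *)
Lemma closed_ball_extend (A : set R) (t0 : R) : closed A -> t0 != 0 ->
  (forall t, `|t| < `|t0| -> A t) -> A t0.
Proof.
move=> cA t00 h; apply: cA => B /near_normP[r r0 hr].
have t0p : 0 < `|t0| by rewrite normr_gt0.
pose m := Num.min (r / 2) (`|t0| / 2) / `|t0|.
have m0 : 0 < m by rewrite divr_gt0 // lt_min !divr_gt0.
have m1 : m < 1.
  rewrite ltr_pdivrMr // mul1r gt_min; apply/orP; right.
  by rewrite ltr_pdivrMr // ltr_pMr // ltr1n.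
exists ((1 - m) * t0); split.
  by apply: h; rewrite normrM gtr_pMl // ger0_norm ?subr_ge0 ?(ltW m1) // gtrBl.
apply: hr; rewrite mulrBl mul1r addrAC subrr sub0r normrN normrM ger0_norm ?(ltW m0) //.
rewrite /m divfK ?gt_eqF // gt_min ltr_pdivrMr // ltr_pMr // ltr1n //.
Qed.

(** The set is the image of a compact ball under the inverse chart, hence closed in the Hausdorff
    space [M] and not merely in the chart domain. A curve therefore cannot leave the domain without
    first leaving the ball. *)
Lemma chart_ball_closed c (y0 : 'rV[R]_n) r :
  (forall y, `|y - y0| <= r -> chart_codom c y) ->
  closed [set z | chart_dom c z /\ `|c z - y0| <= r].
Proof.
move=> hr.
have -> : [set z | chart_dom c z /\ `|c z - y0| <= r] =
    chart_inv c @` [set y | `|y - y0| <= r].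
  apply/seteqP; split => [z [cz hz]|_ [y hy <-]].
    by exists (c z); rewrite // chart_mapK.
  by split; [exact/chart_inv_dom/hr|rewrite chart_invK //; exact: hr].
apply: compact_closed; first exact: manifold_hausdorff.
apply: continuous_compact.
  apply: continuous_in_subspaceT => y; rewrite inE /= => hy.
  exact/chart_inv_continuous/hr.
apply: bounded_closed_compact.
  exists (r + `|y0|); split; first by rewrite num_real.
  move=> m hm y /= hy; rewrite -(subrK y0 y) (le_trans (ler_normD _ _)) //.
  by rewrite (le_trans _ (ltW hm)) // lerD2r.
have -> : [set y : 'rV[R]_n | `|y - y0| <= r] = (fun y => `|y - y0|) @^-1` [set s | s <= r] by [].
apply: closed_comp; last exact: closed_le.
by move=> y _; exact: dist_continuous.
Qed.

Lemma chart_ball_open c (y0 : 'rV[R]_n) r :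
  open [set z | chart_dom c z /\ `|c z - y0| < r].
Proof.
rewrite openE => z [cz hz]; rewrite /interior.
apply: (@chart_pull c z (fun y => `|y - y0| < r)) => //.
apply/near_normP; exists (r - `|c z - y0|); first by rewrite subr_gt0.
move=> y; rewrite ltrBrDr => h; apply: le_lt_trans h.
by rewrite -(subrKA (c z)) ler_normD.
Qed.

(** Close to [c x] the speed is at most [K]. The radius [d] solves [d + K * d = r3 / 2], so at a
    supposed first time outside the ball of radius [r3] the curve would still lie within [r3 / 2].
    One [d] serves all integral curves, in both time directions. *)
Lemma escape X c x : Ck_vector_field 1 X -> atlas c -> chart_dom c x ->
  forall r : R, 0 < r -> exists2 d : R, 0 < d & forall gam, integral_curve X gam ->
    chart_dom c (gam 0) -> `|c (gam 0) - c x| < d -> forall t, `|t| < d ->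
    chart_dom c (gam t) /\ `|c (gam t) - c x| < r.
Proof.
move=> XC ac cx r r0; set F := local_rep X c.
have FC : C1_at F (c x) by exact: local_rep_C1.
pose K := `|F (c x)| + 1.
have K0 : 0 < K by rewrite ltr_wpDl.
have [r1 r10 h1] := (continuous_normP _ _).1 (differentiable_continuous (C1_at_diff FC)) 1 ltr01.
have [r2 r20 h2] := near_chart cx (near_chart_dom cx).
pose r3 := Num.min r (Num.min r1 r2).
have r30 : 0 < r3 by rewrite !lt_min r0 r10.
have FK y : `|y - c x| < r3 -> `|F y| <= K.
  rewrite !lt_min => /and3P[_ /h1 h _].
  rewrite -(subrK (F (c x)) (F y)) (le_trans (ler_normD _ _)) // addrC lerD2l ltW //.
pose d := r3 / (2 * (K + 1)).
have K10 : 0 < 2 * (K + 1) by rewrite mulr_gt0 // ltr_wpDl // ltW.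
have d0 : 0 < d by rewrite divr_gt0.
have dE : d + K * d = r3 / 2 by rewrite /d; field; rewrite gt_eqF // ltr_wpDl // ltW.
exists d => // gam gI g0 gd t td.
pose W := [set z | chart_dom c z /\ `|c z - c x| < r3].
suff : W (gam t) by move=> [? h]; split => //; apply: lt_le_trans h _; rewrite ge_min lexx.
apply: contrapT => nW.
have cA : closed (gam @^-1` (~` W)).
  apply: closed_comp; first by move=> s _; exact: gI.1.
  by apply: open_closedC; exact: chart_ball_open.
have [t0 [At0 t0t hit]] := first_hitting cA nW.
have t0n0 : t0 != 0.
  apply: contra_notN At0 => /eqP ->; split => //.
  by rewrite (lt_le_trans gd) // ltW // -(ltr_pM2r (_ : 0 < 2 * (K + 1))) // divfK ?gt_eqF // ltr_pMr //; lra.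
pose N := [set z | chart_dom c z /\ `|c z - c x| <= r3 / 2].
have cN : closed (gam @^-1` N).
  apply: closed_comp; first by move=> s _; exact: gI.1.
  apply: chart_ball_closed => y hy; apply: (h2 y _).1.
  apply: le_lt_trans hy _; apply: (@lt_le_trans _ _ r3); first lra.
  by rewrite !ge_min lexx !orbT.
have inW s : `|s| < `|t0| -> W (gam s) by move=> /hit/contrapT.
have inN s : `|s| < `|t0| -> N (gam s).
  move=> st; have [cs _] := inW _ st; split => //.
  have := @curve_mvt_sym R _ _ (c \o gam) (fun t => F (c (gam t))) 0 s K 0.
  rewrite !subr0 scaler0 subr0 => h.
  rewrite -(subrKA (c (gam 0))) (le_trans (ler_normD _ _)) //.
  have {}h : `|c (gam s) - c (gam 0)| <= K * `|s|.
    apply: h => q; rewrite subr0 => qs; have [cq hq] := inW _ (le_lt_trans qs st).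
      exact: integral_curve_derive.
    by rewrite subr0; exact: FK.
  have sd : `|s| <= d by rewrite ltW // (lt_trans st) // (le_lt_trans t0t).
  have := ler_wpM2l (ltW K0) sd; move: h gd dE; lra.
have [ct0 ht0] := closed_ball_extend cN t0n0 inN.
by apply: At0; split => //; apply: le_lt_trans ht0 _; lra.
Qed.

(* This stands in for the differentiability of the flow in the initial condition. *)
Lemma flow_variation X c x : Ck_vector_field 1 X -> atlas c -> chart_dom c x ->
  forall eta : R, 0 < eta -> exists2 d : R, 0 < d & forall gam1 gam2,
    integral_curve X gam1 -> integral_curve X gam2 ->
    chart_dom c (gam1 0) -> chart_dom c (gam2 0) ->
    `|c (gam1 0) - c x| < d -> `|c (gam2 0) - c x| < d ->
    forall h, `|h| < d ->
    [/\ chart_dom c (gam1 h), chart_dom c (gam2 h),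
        `|c (gam2 h) - c (gam1 h)| <= 2 * `|c (gam2 0) - c (gam1 0)| &
        `|(c (gam2 h) - c (gam1 h)) - (c (gam2 0) - c (gam1 0)) -
          h *: dif (local_rep X c) (c x) (c (gam2 0) - c (gam1 0))|
        <= eta * `|h| * `|c (gam2 0) - c (gam1 0)|].
Proof.
move=> XC ac cx eta eta0; set F := local_rep X c.
have FC : C1_at F (c x) by exact: local_rep_C1.
have [k k0 hk] := dif_lipschitz (C1_at_diff FC).
pose e1 := Num.min 1 (eta / 4).
have e10 : 0 < e1 by rewrite lt_min ltr01 divr_gt0.
have [r r0 hr] := C1_at_strict FC e10.
pose L := k + 1.
have L0 : 0 < L by rewrite ltr_wpDl // ltW.
have FL a b : `|a - c x| < r -> `|b - c x| < r -> `|F a - F b| <= L * `|a - b|.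
  move=> ha hb; rewrite -(subrK (dif F (c x) (a - b)) (F a - F b)).
  rewrite (le_trans (ler_normD _ _)) // /L mulrDl addrC lerD ?hk //.
  rewrite (le_trans (hr _ _ ha hb)) // ler_wpM2r // ge_min lexx //.
have [d1 d10 hd1] := escape XC ac cx r0.
(* The second entry gives [d * L <= 1 / 2], hence the factor 2 in the third conclusion. The last one
   keeps the drift of [D], seen through the differential, below [eta / 2]; the other [eta / 2] comes
   from [e1 <= eta / 4] and that factor 2. *)
pose d := Num.min d1 (Num.min (2 * L)^-1 (eta / (4 * k * L))).
have d0 : 0 < d by rewrite !lt_min d10 invr_gt0 divr_gt0 ?mulr_gt0.
exists d => // gam1 gam2 I1 I2 c1 c2 g1 g2 h hh.
have dd1 : d <= d1 by rewrite ge_min lexx.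
have dL : d * L <= 2^-1.
  have : d <= (2 * L)^-1 by rewrite !ge_min lexx orbT.
  by move=> /(ler_wpM2r (ltW L0)) /le_trans; apply; rewrite invfM divfK // gt_eqF.
have dk : k * (L * 2 * d) <= eta / 2.
  have : d <= eta / (4 * k * L) by rewrite !ge_min lexx !orbT.
  move=> /(ler_wpM2l (ltW (mulr_gt0 k0 (mulr_gt0 L0 (ltr0Sn R 1))))).
  rewrite -(mulrA k) => /le_trans; apply.
  by rewrite le_eqVlt; apply/orP; left; apply/eqP; field; rewrite !gt_eqF.
pose D t := c (gam2 t) - c (gam1 t).
have in1 t : `|t| <= `|h| -> chart_dom c (gam1 t) /\ `|c (gam1 t) - c x| < r.
  move=> th; apply: hd1 => //; first exact: lt_le_trans g1 dd1.
  by rewrite (le_lt_trans th) // (lt_le_trans hh).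
have in2 t : `|t| <= `|h| -> chart_dom c (gam2 t) /\ `|c (gam2 t) - c x| < r.
  move=> th; apply: hd1 => //; first exact: lt_le_trans g2 dd1.
  by rewrite (le_lt_trans th) // (lt_le_trans hh).
pose D' t := F (c (gam2 t)) - F (c (gam1 t)).
have dD (t : R) : `|t| <= `|h| -> is_derive t 1 D (D' t).
  move=> th; have [ct1 _] := in1 _ th; have [ct2 _] := in2 _ th.
  have H1 := integral_curve_derive I1 ac ct1; have H2 := integral_curve_derive I2 ac ct2.
  exact: is_deriveB.
have D'L t : `|t| <= `|h| -> `|D' t| <= L * `|D t|.
  by move=> th; apply: FL; [have [] := in2 _ th|have [] := in1 _ th].
(* Bounding at the maximum of [|D|] closes the estimate on itself:
   [|D tm| <= |D 0| + |D tm| / 2]. *)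
have [tm tmh tmax] : exists2 tm, `|tm| <= `|h| & forall t, `|t| <= `|h| -> `|D t| <= `|D tm|.
  have [||tm] := @EVT_max R (fun t => `|D t|) (- `|h|) `|h|.
  - by rewrite (@le_trans _ _ 0) // oppr_le0.
  - apply: continuous_in_subspaceT => t; rewrite inE /= in_itv /= -ler_norml => th.
    apply: cvg_norm; exact: is_derive_continuous (dD _ th).
  rewrite in_itv /= -ler_norml => tmh tmax; exists tm => // t th.
  by apply: tmax; rewrite in_itv /= -ler_norml.
have D2 t : `|t| <= `|h| -> `|D t - D 0| <= L * `|D tm| * `|t|.
  move=> th; have := @curve_mvt_sym R _ _ D D' 0 t (L * `|D tm|) 0.
  rewrite !subr0 scaler0 subr0; apply => q; rewrite subr0 => qt.
    by apply: dD; exact: le_trans th.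
  have qh := le_trans qt th.
  by rewrite subr0 (le_trans (D'L _ qh)) // ler_wpM2l ?(ltW L0) // tmax.
have hd (t : R) : `|t| <= `|h| -> `|t| <= d by move=> th; rewrite (le_trans th) // ltW.
have tmb : `|D tm| <= 2 * `|D 0|.
  have h1 := D2 _ tmh; have h2 := ler_wpM2l (_ : 0 <= L * `|D tm|) (hd _ tmh).
  have h3 := ler_wpM2r (normr_ge0 (D tm)) dL.
  have h4 : `|D tm| <= `|D tm - D 0| + `|D 0| by rewrite -{1}(subrK (D 0) (D tm)) ler_normD.
  have {}h2 := h2 (mulr_ge0 (ltW L0) (normr_ge0 _)).
  have e : L * `|D tm| * d = d * L * `|D tm| by ring.
  rewrite e in h2; lra.
have [ch1 _] := in1 _ (lexx _); have [ch2 _] := in2 _ (lexx _).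
split => //; first by rewrite (le_trans (tmax _ (lexx _))).
have := @curve_mvt_sym R _ _ D D' 0 h (eta * `|D 0|) (dif F (c x) (D 0)).
rewrite !subr0 -/(D h) -/(D 0) mulrAC; apply => t; rewrite subr0 => th; first exact: dD.
rewrite -(subrKA (dif F (c x) (D t))) (le_trans (ler_normD _ _)) //.
have h1 : `|D' t - dif F (c x) (D t)| <= e1 * `|D t|.
  by apply: hr; [have [] := in2 _ th|have [] := in1 _ th].
have h2 : `|D t| <= 2 * `|D 0| by rewrite (le_trans (tmax _ th)).
have h3 : e1 * `|D t| <= eta / 4 * (2 * `|D 0|).
  by apply: ler_pM => //; [exact: ltW|rewrite ge_min lexx orbT].
have h4 : `|dif F (c x) (D t) - dif F (c x) (D 0)| <= k * (L * (2 * `|D 0|) * d).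
  rewrite -linearB (le_trans (hk _)) // ler_wpM2l ?(ltW k0) // (le_trans (D2 _ th)) //.
  apply: ler_pM => //; [by rewrite mulr_ge0 // ltW| |exact: hd].
  by rewrite ler_wpM2l // ltW.
have h5 := ler_wpM2r (normr_ge0 (D 0)) dk.
have e : k * (L * (2 * `|D 0|) * d) = k * (L * 2 * d) * `|D 0| by ring.
rewrite e in h4; lra.
Qed.

(** The agreement set is closed because [M] is Hausdorff, and open because [flow_variation] bounds
    the distance of the curves by twice an initial distance of zero. A first time of disagreement
    cannot exist. *)
Lemma integral_curve_unique X gam1 gam2 : Ck_vector_field 1 X ->
  integral_curve X gam1 -> integral_curve X gam2 -> gam1 0 = gam2 0 -> gam1 =1 gam2.
Proof.
move=> XC I1 I2 g0.
pose E := [set t | gam1 t = gam2 t].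
have oE : open E.
  rewrite openE => t Et; rewrite /interior.
  have [c ac ct] := atlas_cover (gam1 t).
  have [d d0 hd] := flow_variation XC ac ct ltr01.
  apply: (near_normP (t : R) E).2; exists d => // s st.
  have := hd _ _ (integral_curve_shift t I1) (integral_curve_shift t I2).
  rewrite !add0r -Et subrr normr0 => /(_ ct ct d0 d0 (s - t) st).
  rewrite subrK mulr0 => -[cs1 cs2].
  rewrite normr_le0 subr_eq0 => /eqP e _.
  by rewrite /E /= -(chart_mapK cs1) -(chart_mapK cs2) e.
have cE : closed E.
  move=> t clt; apply: (@manifold_hausdorff R n M).
  move=> A B At Bt.
  have At' : \forall s \near t, A (gam1 s) := I1.1 t _ At.
  have Bt' : \forall s \near t, B (gam2 s) := I2.1 t _ Bt.
  have AB := filterI At' Bt'.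
  have [s [Es [As Bs]]] := clt _ (AB _).
  by exists (gam1 s); split => //; rewrite Es.
move=> t; apply: contrapT => nEt.
have [t0 [nE0 _ h]] := first_hitting (open_closedC oE) nEt.
apply: (nE0); apply: closed_ball_extend => //.
  by apply: contra_notN (nE0) => /eqP ->; exact: g0.
by move=> s /h /contrapT.
Qed.

Section Flow.
Variables (X : vector_field M) (phi : R -> M -> M).
Hypothesis XC : Ck_vector_field 1 X.
Hypothesis phiX : is_flow X phi.

Lemma flow0 x : phi 0 x = x.
Proof. by have [] := phiX x. Qed.

Lemma flow_curve x : integral_curve X (phi ^~ x).
Proof. by have [] := phiX x. Qed.

Lemma flowD s t x : phi (s + t) x = phi s (phi t x).
Proof.
have I1 := integral_curve_shift t (flow_curve x).
have := integral_curve_unique XC I1 (flow_curve (phi t x)).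
by apply; rewrite add0r flow0.
Qed.

Lemma flowK t x : phi (- t) (phi t x) = x.
Proof. by rewrite -flowD addNr flow0. Qed.

Lemma flow_rest x t : X x = 0 -> phi t x = x.
Proof.
move=> Xx; apply: (integral_curve_unique XC (flow_curve x) (integral_curve_cst Xx)).
by rewrite flow0.
Qed.

Lemma rest_flow x : (forall t, phi t x = x) -> X x = 0.
Proof.
move=> h; have [_ /(_ 0)] := flow_curve x; rewrite flow0.
have -> : chart_at x \o phi^~ x = cst (chart_at x x) by apply/funext => t /=; rewrite h.
move=> H; apply: (is_derive_unique H); exact: is_derive_cst.
Qed.

Lemma flow_nonsing x t : X x != 0 -> X (phi t x) != 0.
Proof.
apply: contra => /eqP h; apply/eqP.
by rewrite -(flowK t x) (flow_rest _ h) h.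
Qed.

End Flow.
End Charts.

(** * Consequences of rescaling separation *)

Section Metric.
Context {R : realType}.

Lemma continuous_near_eq (V W : normedModType R) (f g : V -> W) (x : V) :
  (\forall y \near x, f y = g y) -> {for x, continuous f} -> {for x, continuous g}.
Proof.
move=> fg /continuous_normP fx; have fgx := nbhs_singleton fg.
apply/continuous_normP => e e0; have [r r0 hr] := fx _ e0.
have /near_normP[r' r'0 hr'] := fg.
exists (Num.min r r'); first by rewrite lt_min r0.
by move=> y; rewrite lt_min => /andP[/hr h /hr' <-]; rewrite -fgx.
Qed.

Lemma continuousZ_at (V W : normedModType R) (f : V -> W) (a : R) (x : V) :
  {for x, continuous f} -> {for x, continuous (fun y => a *: f y)}.
Proof. by move=> fx; exact: continuous_comp fx (@scaler_continuous _ W a (f x)). Qed.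

Lemma bform_suml n (G : 'M[R]_n) (I : finType) (F : I -> 'rV[R]_n) y :
  bform G (\sum_i F i) y = \sum_i bform G (F i) y.
Proof. by rewrite /bform !mulmx_suml summxE. Qed.

Lemma bform_sumr n (G : 'M[R]_n) (I : finType) (F : I -> 'rV[R]_n) y :
  bform G y (\sum_i F i) = \sum_i bform G y (F i).
Proof. by rewrite /bform raddf_sum mulmx_sumr summxE. Qed.

Lemma integral_le_cst (f : R -> R) (L : R) :
  (forall t, 0 <= t <= 1 -> 0 <= f t <= L) ->
  (\int[lebesgue_measure]_(t in `[0%R, 1%R]) (f t)%:E <= L%:E)%E.
Proof.
move=> h.
have L0 : 0 <= L by have /andP[h1 h2] := h 0 (introT andP (conj (lexx 0) ler01)); exact: le_trans h2.
apply: (@le_trans _ _ (\int[lebesgue_measure]_(t in `[0%R, 1%R]) (cst L%:E t))%E); last first.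
  rewrite integral_cst //= lebesgue_measure_itv /= lte01 /=.
  by rewrite oppr0 adde0 mule1.
(* [f] is not assumed measurable, so the integrals are compared as suprema over the simple functions
   lying below. *)
rewrite !ge0_integralE; last 2 first.
- by move=> t _ /=; rewrite lee_fin.
- by move=> t /=; rewrite in_itv /= => /h /andP[]; rewrite lee_fin.
apply: le_ereal_sup => _ [k hk <-]; exists k => // t.
apply: (le_trans (hk t)); rewrite !patchE; case: ifPn => //; rewrite inE /= in_itv /= => /h /andP[_].
by rewrite lee_fin.
Qed.

Lemma dif_jacobian m n (f : 'rV[R]_m -> 'rV[R]_n) x v : dif f x v = v *m jacobian f x.
Proof. by rewrite difE /jacobian mul_rV_lin1. Qed.

Lemma bformBG n (G H : 'M[R]_n) x y : bform (G - H) x y = bform G x y - bform H x y.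
Proof. by rewrite /bform mulmxBr mulmxBl !mxE. Qed.

Context {n : nat} {M : manifold R n}.
Implicit Types (c : chart R n M) (x z : M) (X Y : vector_field M) (gam : R -> M).

Lemma tnormE (g : riemannian_metric M) z v : tnorm g z v = Num.sqrt (bform (gram g z) v v).
Proof. by []. Qed.

Lemma tnorm_ge0 (g : riemannian_metric M) z v : 0 <= tnorm g z v.
Proof. exact: sqrtr_ge0. Qed.

Lemma tnormZ (g : riemannian_metric M) z s v : tnorm g z (s *: v) = `|s| * tnorm g z v.
Proof.
by rewrite !tnormE bformZl bformZr mulrA -expr2 sqrtrM ?sqr_ge0 // sqrtr_sqr.
Qed.

(** The preferred chart at [z] varies without continuity, so the metric is read in the fixed chart
    [c], where its Gram matrix [G] has continuous entries. Positive definiteness at [c x] gives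
    [mu], and moving the entries by [e] changes the form by at most [mu / 2] times the square of the
    norm. *)
Lemma tnorm_equiv (g : riemannian_metric M) c x : atlas c -> chart_dom c x ->
  exists a b d : R, [/\ 0 < a, 0 < b, 0 < d & forall z, chart_dom c z ->
    `|c z - c x| < d -> forall v,
    a * `|to_coord c z v| <= tnorm g z v <= b * `|to_coord c z v|].
Proof.
move=> ac cx.
pose G (y : 'rV[R]_n) : 'M[R]_n := \matrix_(i, j)
  bform (gram g (chart_inv c y)) (of_coord c (chart_inv c y) (delta_mx 0 i))
    (of_coord c (chart_inv c y) (delta_mx 0 j)).
have GE z u v : chart_dom c z ->
    bform (G (c z)) u v = bform (gram g z) (of_coord c z u) (of_coord c z v).
  move=> cz; rewrite !of_coordE (linear_delta_sum (dif _ _) u) (linear_delta_sum (dif _ _) v).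
  rewrite bformE bform_sumr; apply: eq_bigr => k _.
  rewrite bform_suml; apply: eq_bigr => j _.
  rewrite bformZl bformZr mxE chart_mapK // !of_coordE; ring.
have Gc i j : {for c x, continuous (fun y => G y i j)}.
  have := gram_smooth g ac (delta_mx 0 i) (delta_mx 0 j) 0%N _ (codomP cx).
  by apply: continuous_near_eq; apply: filterE => y; rewrite mxE.
clearbody G.
have [v v0|mu mu0 hmu] := @posdef_coercive R n (G (c x)).
  rewrite GE //; apply: gram_posdef.
  by apply: contra v0 => /eqP h; rewrite -(of_coordK v ac cx) h to_coord0.
pose e := mu / (2 * (n%:R ^+ 2 + 1)).
have n0 : 0 < n%:R ^+ 2 + 1 :> R by rewrite ltr_wpDl // sqr_ge0.
have e0 : 0 < e by rewrite divr_gt0 // mulr_gt0.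
have en : n%:R ^+ 2 * e <= mu / 2.
  have -> : n%:R ^+ 2 * e = mu / 2 * (n%:R ^+ 2 / (n%:R ^+ 2 + 1)).
    by rewrite /e; field; rewrite gt_eqF.
  rewrite ler_piMr ?divr_ge0 ?(ltW mu0) //.
  by rewrite ler_pdivrMr // mul1r lerDl.
have /near_normP[d d0 hd] : \forall y \near c x, forall ij : 'I_n * 'I_n,
    `|G y ij.1 ij.2 - G (c x) ij.1 ij.2| < e.
  apply: (@filter_forall _ _ (fun ij y => `|G y ij.1 ij.2 - G (c x) ij.1 ij.2| < e)
    (nbhs (c x)) _) => -[i j] /=.
  have [r r0 hr] := (continuous_normP _ _).1 (Gc i j) _ e0.
  by apply: (near_normP (c x) _).2; exists r.
pose B := n%:R ^+ 2 * `|G (c x)| + mu / 2 + 1.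
have B0 : 0 < B by rewrite ltr_wpDl // addr_ge0 // ?mulr_ge0 ?divr_ge0 ?(ltW mu0) ?sqr_ge0.
exists (Num.sqrt (mu / 2)), (Num.sqrt B), d; split => //; rewrite ?sqrtr_gt0 ?divr_gt0 //.
move=> z cz zd v; set w := to_coord c z v.
rewrite tnormE; have <- : bform (G (c z)) w w = bform (gram g z) v v.
  by rewrite GE // to_coordK.
have nG : `|G (c z) - G (c x)| <= e.
  by apply: mx_norm_le => [|i j]; [exact: ltW|rewrite !mxE ltW //; exact: hd _ zd (i, j)].
have h1 : `|bform (G (c z)) w w - bform (G (c x)) w w| <= mu / 2 * `|w| ^+ 2.
  rewrite -bformBG (le_trans (bform_le _ _ _)) // -mulrA -expr2 ler_wpM2r ?sqr_ge0 //.
  by rewrite (le_trans _ en) // ler_wpM2l // sqr_ge0.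
have h2 := hmu w.
have h3 : bform (G (c x)) w w <= n%:R ^+ 2 * `|G (c x)| * `|w| ^+ 2.
  by rewrite expr2 mulrA (le_trans (ler_norm _)) // bform_le.
have sqE s : 0 <= s -> Num.sqrt s * `|w| = Num.sqrt (s * `|w| ^+ 2).
  by move=> s0; rewrite sqrtrM // sqrtr_sqr normr_id.
have w2 : 0 <= `|w| ^+ 2 by exact: sqr_ge0.
move: h1; rewrite ler_norml => /andP[h1 h1'].
rewrite !sqE ?(ltW B0) ?divr_ge0 ?(ltW mu0) //.
apply/andP; split; apply: ler_wsqrtr; first by lra.
rewrite /B !mulrDl mul1r; lra.
Qed.

Lemma C1_curve_integral X gam : Ck_vector_field 1 X -> integral_curve X gam -> C1_curve gam.
Proof.
move=> XC gI; split; first exact: gI.1.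
move=> c ac; split=> [t ct|v t ct].
  apply/derivable1_diffP; by have [] := integral_curve_derive gI ac ct.
have F_cont : {for t, continuous (fun s => v *: local_rep X c (c (gam s)))}.
  have Fc := differentiable_continuous (C1_at_diff (local_rep_C1 XC ac ct)).
  have uc := is_derive_continuous (integral_curve_derive gI ac ct).
  exact: continuousZ_at (continuous_comp uc Fc).
apply: continuous_near_eq F_cont.
have nb : \forall s \near t, chart_dom c (gam s) := gI.1 t _ (near_chart_dom ct).
apply: filterS nb => s cs.
have H := integral_curve_derive gI ac cs.
have dH : differentiable (c \o gam) s by apply/derivable1_diffP; have [] := H.
have -> : v = v *: 1 by rewrite [RHS]mulr1.
by rewrite derive_dif // linearZ /= -derive_dif // [v *: 1]mulr1 derive_val.
Qed.

Lemma distance_integral_curve (g : riemannian_metric M) X gam (L : R) :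
  Ck_vector_field 1 X -> integral_curve X gam ->
  (forall t, 0 <= t <= 1 -> tnorm g (gam t) (X (gam t)) <= L) ->
  (riemannian_distance g (gam 0%R) (gam 1%R) <= L%:E)%E.
Proof.
move=> XC gI hL; rewrite /riemannian_distance.
apply: (@le_trans _ _ (curve_length g gam + 0)%E).
  apply: ereal_inf_lbound; apply: path_cons; last exact: path_nil.
  exact: C1_curve_integral XC gI.
rewrite adde0; apply: integral_le_cst => t t01.
have -> : velocity gam t = X (gam t) by have [_ /(_ t)[]] := gI.
by rewrite tnorm_ge0 hL.
Qed.

Lemma Ck_vector_field_scale s X : Ck_vector_field 1 X -> Ck_vector_field 1 (fun x => s *: X x).
Proof.
move=> XC c ac; have oc := @chart_codom_open R n M c : open (chart_codom c).
have -> : local_rep (fun x => s *: X x) c = s *: local_rep X c.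
  by apply/funext => y; rewrite /local_rep to_coordZ.
have [dF DF] := XC c ac.
split=> [y /dF h|v y cy]; first exact: differentiableZ.
have : {for y, continuous (fun y => s *: 'D_v (local_rep X c) y)}.
  by apply: continuousZ_at; exact: DF.
apply: continuous_near_eq.
have nb : \forall z \near y, chart_codom c z by exact: open_nbhs_nbhs.
apply: filterS nb => z /dF h.
by rewrite deriveZ //; exact: diff_derivable.
Qed.

Lemma integral_curve_scale s X gam : integral_curve X gam ->
  integral_curve (fun x => s *: X x) (fun t => gam (s * t)).
Proof.
move=> [gc gd]; split.
  move=> t; apply: continuous_comp; last exact: gc.
  exact: scaler_continuous.
move=> t; have H := gd (s * t).
have ds : is_derive t 1 (fun t : R => s * t) s.
  apply/is_derive_approx => e e0; exists 1 => // r _.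
  by rewrite -mulrBr mulrC subrr normr0 mulr_ge0 // ltW.
have dH : differentiable (chart_at (gam (s * t)) \o gam) (s * t).
  by apply/derivable1_diffP; have [] := H.
have H2 := is_derive_chain (dH : differentiable _ ((fun t : R => s * t) t)) ds.
apply: (is_derive_eq H2); rewrite -[X in dif _ _ X]mulr1 -[s * 1]/(s *: (1 : R)) linearZ /=.
by rewrite -derive_dif // derive_val.
Qed.

(** Lengths are integrals over the unit interval, so the arc from [z] to [psi s z] is run there as
    an integral curve of [s *: Y]; a negative [s] is covered as well. *)
Lemma flow_distance (g : riemannian_metric M) Y psi z (s L : R) :
  Ck_vector_field 1 Y -> is_flow Y psi ->
  (forall t, `|t| <= `|s| -> tnorm g (psi t z) (Y (psi t z)) <= L) ->
  (riemannian_distance g z (psi s z) <= (`|s| * L)%:E)%E.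
Proof.
move=> YC psiY hL.
have I := integral_curve_scale s (flow_curve psiY z).
have := @distance_integral_curve g _ _ (`|s| * L) (Ck_vector_field_scale s YC) I.
rewrite mulr0 mulr1 (flow0 psiY); apply => t /andP[t0 t1].
rewrite tnormZ ler_wpM2l // hL // normrM (ger0_norm t0).
by rewrite ler_piMr.
Qed.

(** The invertible linear part stretches by at least twice the final constant, and the nonlinear
    remainder can cancel at most half of that. *)
Lemma singularity_lower X c x : Ck_vector_field 1 X -> atlas c -> chart_dom c x ->
  X x = 0 -> jacobian (local_rep X c) (c x) \in unitmx ->
  exists2 a : R, 0 < a & exists2 r : R, 0 < r & forall y,
    `|y - c x| < r -> a * `|y - c x| <= `|local_rep X c y|.
Proof.
move=> XC ac cx Xx /unitmx_lower[a a0 ha].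
have a20 : 0 < a / 2 by rewrite divr_gt0.
exists (a / 2) => //.
have [r r0 hr] := C1_at_strict (local_rep_C1 XC ac cx) a20.
exists r => // y yr; have := hr y (c x) yr.
rewrite subrr normr0 => /(_ r0).
rewrite [local_rep X c (c x)]local_repE // Xx to_coord0 subr0 dif_jacobian => h1.
have h2 := ha (y - c x).
have h3 : `|(y - c x) *m jacobian (local_rep X c) (c x)| <=
  `|local_rep X c y - (y - c x) *m jacobian (local_rep X c) (c x)| + `|local_rep X c y|.
  by rewrite -{1}(subrK (local_rep X c y) (_ *m _)) (le_trans (ler_normD _ _)) // distrC.
lra.
Qed.

Lemma C1_at_bound m (F : 'rV[R]_n -> 'rV[R]_m) y0 : C1_at F y0 ->
  exists2 L : R, 0 < L & exists2 r : R, 0 < r & forall y, `|y - y0| < r ->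
    `|F y - F y0| <= L * `|y - y0|.
Proof.
move=> FC; have [k k0 hk] := dif_lipschitz (C1_at_diff FC).
exists (k + 1); first by rewrite ltr_wpDl // ltW.
have [r r0 hr] := diff_approx (C1_at_diff FC) ltr01.
exists r => // y /hr h; have := hk (y - y0).
have := ler_normD (F y - F y0 - dif F y0 (y - y0)) (dif F y0 (y - y0)).
rewrite subrK mulrDl; lra.
Qed.

Section Commuting.
Variables (X Y : vector_field M) (phi psi : R -> M -> M).
Hypotheses (XC : Ck_vector_field 1 X) (YC : Ck_vector_field 1 Y).
Hypotheses (phiX : is_flow X phi) (psiY : is_flow Y psi).
Hypothesis comm : forall (s t : R) (x : M), psi s (phi t x) = phi t (psi s x).
Hypothesis nondeg : forall x, X x = 0 ->
  jacobian (local_rep X (chart_at x)) (chart_at x x) \in unitmx.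

Lemma singularity_preserved x : X x = 0 -> Y x = 0.
Proof.
move=> Xx; set c := chart_at x.
have ac : atlas c := atlas_chart_at x; have cx : chart_dom c x := chart_at_dom x.
have [a a0 [r r0 hr]] := singularity_lower XC ac cx Xx (nondeg Xx).
have near0 : \forall s \near (0 : R), psi s x = x.
  have Wx : \forall z \near psi 0 x, chart_dom c z /\ `|c z - c x| < r.
    rewrite (flow0 psiY); apply: (@chart_pull _ _ _ c x (fun y => `|y - c x| < r)) => //.
    by apply/near_normP; exists r.
  have nb : \forall s \near (0 : R), chart_dom c (psi s x) /\ `|c (psi s x) - c x| < r.
    exact: (flow_curve psiY x).1 0 _ Wx.
  apply: filterS nb => s [cs /hr].
  have Xs : X (psi s x) = 0.
    apply: (rest_flow phiX) => t; rewrite -comm.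
    by rewrite (flow_rest XC phiX).
  rewrite local_repE // Xs to_coord0 normr0 pmulr_rle0 // normr_le0 subr_eq0 => /eqP h.
  by rewrite -(chart_mapK cs) h chart_mapK.
have H := (flow_curve psiY x).2 0; rewrite (flow0 psiY) in H.
apply: (is_derive_unique H).
have : is_derive (0 : R) 1 (cst (c x)) 0 by exact: is_derive_cst.
by apply: near_eq_is_derive; apply: filterS near0 => s /= ->.
Qed.

(** [Y] is evaluated along the arc and [X] only at its starting point, as the length estimate
    requires. At a singularity [Y] is at most [L] times the distance to [x], [X] at least [a] times
    it, and comparison with the constant orbit at [x] lets that distance at most double along the
    arc. At a regular point [X] is bounded below and [Y] above. *)
Lemma local_ratio x : let c := chart_at x in forall d : R, 0 < d ->
  exists2 C : R, 0 < C & exists2 r : R, 0 < r & forall z t, chart_dom c z ->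
    `|c z - c x| < r -> `|t| < r ->
    [/\ chart_dom c (psi t z), `|c (psi t z) - c x| < d &
        `|local_rep Y c (c (psi t z))| <= C * `|local_rep X c (c z)|].
Proof.
move=> c d d0.
have ac : atlas c := atlas_chart_at x; have cx : chart_dom c x := chart_at_dom x.
have FX := local_rep_C1 XC ac cx; have FY := local_rep_C1 YC ac cx.
have [L L0 [r1 r10 hL]] := C1_at_bound FY.
have [X0|Xn0] := eqVneq (X x) 0.
  have Y0 := singularity_preserved X0.
  have [a a0 [r2 r20 ha]] := singularity_lower XC ac cx X0 (nondeg X0).
  have dm : 0 < Num.min d r1 by rewrite lt_min d0.
  have [r3 r30 h3] := escape YC ac cx dm.
  have [r4 r40 h4] := flow_variation YC ac cx ltr01.
  exists (2 * L / a); first by rewrite divr_gt0 // mulr_gt0.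
  exists (Num.min r2 (Num.min r3 r4)); first by rewrite !lt_min r20 r30.
  move=> z t cz; rewrite !lt_min => /and3P[z2 z3 z4] /and3P[_ t3 t4].
  have z0 : psi 0 z = z by rewrite (flow0 psiY).
  have := h3 _ (flow_curve psiY z); rewrite z0 => /(_ cz z3 _ t3)[ct].
  rewrite lt_min => /andP[td t1]; split => //.
  have := h4 _ _ (integral_curve_cst Y0) (flow_curve psiY z).
  rewrite z0 subrr normr0 => /(_ cx cz r40 z4 _ t4)[_ _ h _].
  have := hL _ t1; rewrite [local_rep Y c (c x)]local_repE // Y0 to_coord0 subr0 => h5.
  have h6 := ha _ z2.
  have h7 := ler_wpM2l (ltW L0) h.
  have h8 : 2 * L * `|c z - c x| <= 2 * L / a * `|local_rep X c (c z)|.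
    rewrite -(mulrA _ a^-1); apply: ler_wpM2l; first by rewrite mulr_ge0 ?(ltW L0).
    by rewrite mulrC ler_pdivlMr // mulrC.
  by rewrite (le_trans h5) // (le_trans h7) // (le_trans _ h8) // mulrA [L * 2]mulrC.
have Fn0 : local_rep X c (c x) != 0 by rewrite local_repE // to_coord_eq0.
pose m := `|local_rep X c (c x)| / 2.
have m0 : 0 < m by rewrite divr_gt0 // normr_gt0.
have [r2 r20 h2] := (continuous_normP _ _).1 (differentiable_continuous (C1_at_diff FX)) _ m0.
have dm : 0 < Num.min d (Num.min 1 r1) by rewrite !lt_min d0 ltr01.
have [r3 r30 h3] := escape YC ac cx dm.
pose K := L + `|local_rep Y c (c x)|.
have K0 : 0 < K by rewrite ltr_pwDl.
exists (K / m); first by rewrite divr_gt0.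
exists (Num.min r2 r3); first by rewrite !lt_min r20.
move=> z t cz; rewrite !lt_min => /andP[z2 z3] /andP[_ t3].
have z0 : psi 0 z = z by rewrite (flow0 psiY).
have := h3 _ (flow_curve psiY z); rewrite z0 => /(_ cz z3 _ t3)[ct].
rewrite !lt_min => /and3P[td t1 t2]; split => //.
have h4 : `|local_rep Y c (c (psi t z))| <= K.
  rewrite -(subrK (local_rep Y c (c x)) (local_rep Y c _)) (le_trans (ler_normD _ _)) //.
  rewrite lerD2r (le_trans (hL _ t2)) // ler_piMr ?(ltW L0) // ltW //.
have h5 : m <= `|local_rep X c (c z)|.
  have := h2 _ z2; have := ler_normD (local_rep X c (c x) - local_rep X c (c z)) (local_rep X c (c z)).
  rewrite subrK distrC /m; lra.
by rewrite (le_trans h4) // -[leLHS](divfK (lt0r_neq0 m0)) ler_wpM2l // divr_ge0 // ltW.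
Qed.

Lemma local_rescaled (g : riemannian_metric M) (e : R) x : 0 < e ->
  \forall z \near x & s \near (0 : R),
    (riemannian_distance g z (psi s z) <= (e * tnorm g z (X z))%:E)%E.
Proof.
move=> e0; pose c := chart_at x.
have ac : atlas c := atlas_chart_at x; have cx : chart_dom c x := chart_at_dom x.
have [a [b [d [a0 b0 d0 hab]]]] := tnorm_equiv g ac cx.
have [C C0 [r r0 hr]] := local_ratio x d0; rewrite -/c in hr.
pose r' := Num.min d r.
(* This makes [s0 * (b * C / a) <= e]: [a] and [b] convert between chart and Riemannian norms, [C]
   bounds [Y] by [X]. *)
pose s0 := Num.min r (e * a / (b * C)).
have s00 : 0 < s0 by rewrite lt_min r0 divr_gt0 // mulr_gt0.
exists ([set z | chart_dom c z /\ `|c z - c x| < r'], [set s | `|s| < s0]).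
  split=> /=.
    apply: (@chart_pull _ _ _ c x (fun y => `|y - c x| < r')) => //.
    by apply/near_normP; exists r'; rewrite // lt_min d0.
  by apply: (near_normP (0 : R) _).2; exists s0 => // s; rewrite subr0.
move=> [z s] [/= [cz]]; rewrite /r' /s0 !lt_min => /andP[zd zr] /andP[sr ss].
have /andP[hX _] := hab z cz zd (X z).
apply: (@le_trans _ _ (`|s| * (b * C / a * tnorm g z (X z)))%:E); last first.
  rewrite lee_fin mulrA ler_wpM2r ?tnorm_ge0 //.
  have h := ltW ss; rewrite -(ler_pM2r (_ : 0 < b * C / a)) ?divr_gt0 ?mulr_gt0 // in h.
  apply: (le_trans h); rewrite le_eqVlt; apply/orP; left; apply/eqP; field.
  by rewrite !gt_eqF.
apply: (flow_distance YC psiY) => t ts.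
have [ct td hC] := hr z t cz zr (le_lt_trans ts sr).
have /andP[_ hY] := hab _ ct td (Y (psi t z)).
apply: (le_trans hY); rewrite !local_repE // in hC.
apply: (le_trans (ler_wpM2l (ltW b0) hC)).
rewrite mulrA -(mulrA _ a^-1) ler_wpM2l ?mulr_ge0 ?(ltW b0) ?(ltW C0) //.
by rewrite mulrC ler_pdivlMr // mulrC.
Qed.

(** Commutation rewrites [phi t (psi s x)] as [psi s (phi t x)], so the estimate for all times [t]
    is a single estimate at the points [phi t x], uniform in the point by compactness. *)
Lemma centralizer_orbit (g : riemannian_metric M) : compact [set: M] ->
  rescaling_separating g X phi ->
  exists2 s0 : R, 0 < s0 & forall s x, `|s| < s0 -> orbit_of phi x (psi s x).
Proof.
move=> cM [e e0 he].
have /compact_near_coveringP/(_ _ (nbhs (0 : R))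
  (fun s z => (riemannian_distance g z (psi s z) <= (e * tnorm g z (X z))%:E)%E) _) := cM.
move=> /(_ (fun x _ => local_rescaled g x e0)) /near_normP[s0 s00 hs].
exists s0 => // s x ss; apply: he => t.
by rewrite -comm; apply: hs; rewrite ?subr0.
Qed.

End Commuting.
End Metric.

(** * Quantitative independence and collinearity of the two fields *)

Section Collinearity.
Context {R : realType}.

(** Linear independence in a form stable under errors. Coordinate [j] of the small vector bounds
    [|t|] by [k * |s|]. Eliminating [t] by means of coordinate [j] leaves [s * W 0 i] with [W 0 i]
    nonzero, which outweighs the error unless [s = 0]. *)
Lemma independent_gap n (X0 Y0 : 'rV[R]_n) : X0 != 0 -> (forall a, Y0 != a *: X0) ->
  exists2 eta : R, 0 < eta & forall s t : R,
    `|s *: Y0 - t *: X0| <= eta * (`|s| + `|t|) -> s = 0.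
Proof.
move=> X0n0 hY.
have [j Xj] : exists j, X0 0 j != 0.
  apply: contrapT => /forallNP h; move/eqP: X0n0; apply; apply/rowP => j.
  by rewrite mxE; have /negP := h j; rewrite negbK => /eqP.
pose W := Y0 - (Y0 0 j / X0 0 j) *: X0.
have [i Wi] : exists i, W 0 i != 0.
  apply: contrapT => /forallNP h; have /negP := hY (Y0 0 j / X0 0 j); apply.
  rewrite -subr_eq0; apply/eqP/rowP => i; rewrite [RHS]mxE.
  by have /negP := h i; rewrite negbK => /eqP.
pose b := `|X0 0 i / X0 0 j|.
pose m := `|X0 0 j|.
have m0 : 0 < m by rewrite normr_gt0.
pose k := (2 * `|Y0 0 j| + m) / m.
have k0 : 0 <= k by rewrite divr_ge0 ?(ltW m0) // addr_ge0 ?mulr_ge0 ?(ltW m0).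
have b0 : 0 <= b by exact: normr_ge0.
have c0 : 0 < 2 * (1 + b) * (1 + k) by rewrite !mulr_gt0 // ltr_pwDl.
(* The first entry lets [|t| * m] absorb its own error term; the second leaves an error of at most
   half of [|s| * |W 0 i|]. *)
pose eta := Num.min (m / 2) (`|W 0 i| / (2 * (1 + b) * (1 + k))).
have eta0 : 0 < eta by rewrite lt_min !divr_gt0 // normr_gt0.
exists eta => // s t.
set v := s *: Y0 - t *: X0 => hv.
have vj := norm_coord_le v 0 j; have vi := norm_coord_le v 0 i.
have hj : `|t| * m <= `|v 0 j| + `|s| * `|Y0 0 j|.
  rewrite /m -!normrM.
  have -> : t * X0 0 j = - v 0 j + s * Y0 0 j by rewrite /v !mxE; ring.
  by rewrite (le_trans (ler_normD _ _)) // normrN.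
have em : eta <= m / 2 by rewrite ge_min lexx.
have s0 := normr_ge0 s; have t0 := normr_ge0 t.
have h1 : eta * (`|s| + `|t|) <= m / 2 * (`|s| + `|t|) by rewrite ler_wpM2r // addr_ge0.
have tk : `|t| <= k * `|s|.
  rewrite /k mulrAC ler_pdivlMr // mulrDl.
  have : m / 2 * (`|s| + `|t|) = m * `|s| / 2 + `|t| * m / 2 by field.
  move: hj h1 hv vj; rewrite [`|s| * `|Y0 0 j|]mulrC -(mulrA 2); lra.
have hi : `|s| * `|W 0 i| <= `|v 0 i| + b * `|v 0 j|.
  rewrite /b -!normrM.
  have -> : s * W 0 i = v 0 i - (X0 0 i / X0 0 j) * v 0 j by rewrite /v /W !mxE; field.
  by rewrite (le_trans (ler_normD _ _)) // normrN.
have h2 : `|v 0 i| + b * `|v 0 j| <= (1 + b) * `|v|.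
  by rewrite mulrDl mul1r lerD // ler_wpM2l.
have h3 : (1 + b) * `|v| <= (1 + b) * (eta * ((1 + k) * `|s|)).
  rewrite ler_wpM2l ?addr_ge0 // (le_trans hv) // ler_wpM2l ?(ltW eta0) //.
  by rewrite mulrDl mul1r lerD2l.
have h4 : (1 + b) * (eta * ((1 + k) * `|s|)) <= `|W 0 i| / 2 * `|s|.
  have : eta <= `|W 0 i| / (2 * (1 + b) * (1 + k)) by rewrite ge_min lexx orbT.
  move=> /(ler_wpM2r (_ : 0 <= (1 + b) * (1 + k) * `|s|)).
  rewrite !mulr_ge0 ?addr_ge0 // => /(_ isT) h.
  have e1 : (1 + b) * (eta * ((1 + k) * `|s|)) = eta * ((1 + b) * (1 + k) * `|s|) by ring.
  rewrite e1; apply: (le_trans h); rewrite le_eqVlt; apply/orP; left; apply/eqP.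
  by field; rewrite !gt_eqF // ltr_pwDl.
have Wi0 : 0 < `|W 0 i| by rewrite normr_gt0.
have : `|s| * `|W 0 i| <= `|W 0 i| / 2 * `|s|.
  by rewrite (le_trans hi) // (le_trans h2) // (le_trans h3).
move=> h; apply/eqP; rewrite -normr_le0 -(ler_pM2r Wi0) mul0r.
have e2 : `|W 0 i| / 2 * `|s| = `|s| * `|W 0 i| / 2 by field.
rewrite e2 in h; lra.
Qed.

(** Such an injection would make the interval countable, hence Lebesgue null, whereas its measure is
    [d + d]. *)
Lemma interval_not_injective (f : R -> int) (d : R) : 0 < d ->
  (forall s t, `|s| < d -> `|t| < d -> f s = f t -> s = t) -> False.
Proof.
move=> d0 finj.
have cA : countable [set` `]- d, d[].
  apply/countable_injP; exists (fun s => choice.pickle (f s)) => s t.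
  rewrite !inE /= !in_itv /= -!ltr_norml => sd td /(pcan_inj choice.pickleK) fst.
  exact: finj.
have := countable_lebesgue_measure0 cA.
rewrite lebesgue_measure_itv /= lte_fin gtrN // -EFinD opprK => -[] /eqP.
by rewrite gt_eqF // addr_gt0.
Qed.

Context {n : nat} {M : manifold R n}.

(** If two parameters have times with the same integer part after division by [dX], the [phi]-arc
    between the two points lasts less than [dX] and stays where [X] is close to [X0]. The [psi]-arc
    joins the same points with [Y] close to [Y0]. Hence [(s' - s) *: Y0] nearly equals [tau *: X0],
    and [independent_gap] gives [s = s']. *)
Lemma orbit_collinear (X Y : vector_field M) (phi psi : R -> M -> M) (s0 : R) :
  Ck_vector_field 1 X -> Ck_vector_field 1 Y -> is_flow X phi -> is_flow Y psi ->
  0 < s0 -> (forall s x, `|s| < s0 -> orbit_of phi x (psi s x)) ->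
  forall x, X x != 0 -> exists a : R, Y x = a *: X x.
Proof.
move=> XC YC phiX psiY s00 horb x Xx; apply: contrapT => /forallNP nY.
pose c := chart_at x.
have ac : atlas c := atlas_chart_at x; have cx : chart_dom c x := chart_at_dom x.
have FX := local_rep_C1 XC ac cx; have FY := local_rep_C1 YC ac cx.
set X0 := local_rep X c (c x); set Y0 := local_rep Y c (c x).
have X0n0 : X0 != 0 by rewrite /X0 local_repE // to_coord_eq0.
have hY a : Y0 != a *: X0.
  apply/negP; rewrite /Y0 /X0 !local_repE // -to_coordZ => /eqP h; apply: (nY a).
  by rewrite -(to_coordK (Y x) ac cx) h to_coordK.
have [eta eta0 gap] := independent_gap X0n0 hY.
have [r1 r10 h1] := (continuous_normP _ _).1 (differentiable_continuous (C1_at_diff FX)) _ eta0.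
have [r2 r20 h2] := (continuous_normP _ _).1 (differentiable_continuous (C1_at_diff FY)) _ eta0.
have [dX dX0 eX] := escape XC ac cx r10.
have dm : 0 < Num.min r2 dX by rewrite lt_min r20.
have [dY dY0 eY] := escape YC ac cx dm.
(* A time [u] between [s] and [s'] is estimated by [|s| + |s' - s|], which is below [3 * d]. *)
pose d := Num.min s0 (dY / 3).
have d0 : 0 < d by rewrite lt_min s00 divr_gt0.
(* The times come from choice, with 0 as default for parameters out of range. *)
have [t ht] : exists t : R -> R, forall s, `|s| < d -> phi (t s) x = psi s x.
  pose P s u := `|s| < d -> phi u x = psi s x.
  have hP s : exists u, P s u.
    have [sd|sd] := ltrP `|s| d; last by exists 0 => h; move: sd; rewrite leNgt h.
    have [|u _ hu] := horb s x; last by exists u.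
    by rewrite (lt_le_trans sd) // ge_min lexx.
  by have [t ht] := choice hP; exists t.
apply: (@interval_not_injective (fun s => Num.floor (t s / dX)) d d0) => s s' sd s'd fE.
pose tau := t s' - t s.
have htau : `|tau| < dX.
  have /andP[f1 f2] := Num.Theory.floor_itv (t s / dX).
  have /andP[f1' f2'] := Num.Theory.floor_itv (t s' / dX).
  rewrite fE in f1 f2; move: f1 f2 f1' f2'; rewrite intrD.
  rewrite !ler_pdivlMr // !ltr_pdivrMr // !mulrDl !mul1r => f1 f2 f1' f2'.
  rewrite /tau ltr_norml; apply/andP; split; lra.
have x0 : psi 0 x = x by rewrite (flow0 psiY).
have inY u : `|u| < dY -> chart_dom c (psi u x) /\ `|c (psi u x) - c x| < Num.min r2 dX.
  by apply: (eY _ (flow_curve psiY x)); rewrite x0 // subrr normr0.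
have dd : d <= dY / 3 by rewrite ge_min lexx orbT.
have sY : `|s| < dY by rewrite (lt_le_trans sd) // (le_trans dd) // ler_pdivrMr // ler_pMr // ler1n.
have hs : `|c (psi s' x) - c (psi s x) - (s' - s) *: Y0| <= eta * `|s' - s|.
  apply: (@curve_mvt_sym R _ _ (c \o psi^~ x) (fun u => local_rep Y c (c (psi u x)))) => u us.
    apply: integral_curve_derive => //; first exact: flow_curve.
    have [] // := inY u; rewrite -(subrK s u) (le_lt_trans (ler_normD _ _)) //.
    have := ler_normB s' s; move: us sd s'd dd; lra.
  apply: ltW; apply: h2.
  have [|_] := inY u; last by rewrite lt_min => /andP[].
  rewrite -(subrK s u) (le_lt_trans (ler_normD _ _)) //.
  have := ler_normB s' s; move: us sd s'd dd; lra.
have [cz] := inY _ sY; rewrite lt_min => /andP[_ zd].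
set z := psi s x in cz zd hs.
have inX u : `|u| < dX -> chart_dom c (phi u z) /\ `|c (phi u z) - c x| < r1.
  by apply: (eX _ (flow_curve phiX z)); rewrite (flow0 phiX).
have ztau : phi tau z = psi s' x.
  by rewrite /z -(ht s sd) -(flowD XC phiX) /tau subrK ht.
have hx : `|c (psi s' x) - c z - tau *: X0| <= eta * `|tau|.
  have := @curve_mvt_sym R _ _ (c \o phi^~ z) (fun u => local_rep X c (c (phi u z))) 0 tau eta X0.
  rewrite /= (flow0 phiX) ztau !subr0; apply => u; rewrite subr0 => ut.
    apply: (integral_curve_derive (flow_curve phiX z) ac).
    by have [] := inX u (le_lt_trans ut htau).
  by apply: ltW; apply: h1; have [] := inX u (le_lt_trans ut htau).
apply/eqP; rewrite eq_sym -subr_eq0; apply/eqP; apply: (gap _ tau).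
have -> : (s' - s) *: Y0 - tau *: X0 =
  (c (psi s' x) - c z - tau *: X0) - (c (psi s' x) - c z - (s' - s) *: Y0).
  by apply/rowP => i; rewrite !mxE; ring.
by rewrite (le_trans (ler_normB _ _)) // addrC mulrDr lerD.
Qed.

End Collinearity.

(** * The ratio of two commuting collinear fields *)

Section Quotient.
Context {R : realType}.

(** Passage from increments to derivatives: through it, estimates on finite displacements of orbits
    become the bracket identity and the adjoint equation. *)
Lemma derive_norm_le (V W : normedModType R) (u : R -> V) (w : R -> W) (t K : R) a b :
  0 <= K -> is_derive t 1 u a -> is_derive t 1 w b ->
  (\forall s \near t, `|u s - u t| <= K * `|w s - w t|) -> `|a| <= K * `|b|.
Proof.
move=> K0 /is_derive_approx hu /is_derive_approx hw /near_normP[r r0 hr].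
apply/ler_addgt0Pr => e e0.
have e10 : 0 < e / (K + 1) by rewrite divr_gt0 // ltr_wpDl.
have [r1 r10 h1] := hu _ e10; have [r2 r20 h2] := hw _ e10.
pose m := Num.min r (Num.min r1 r2).
have m0 : 0 < m by rewrite !lt_min r0 r10.
pose s := t + m / 2.
have sm : `|s - t| = m / 2 by rewrite /s addrC addKr ger0_norm // divr_ge0 // ltW.
have : `|s - t| < m by rewrite sm ltr_pdivrMr // ltr_pMr // ltr1n.
rewrite !lt_min => /and3P[/hr hs /h1 hs1 /h2 hs2].
have p0 : 0 < `|s - t| by rewrite sm divr_gt0.
have ha : `|s - t| * `|a| <= `|u s - u t| + e / (K + 1) * `|s - t|.
  rewrite -normrZ -[X in `|X|](subKr (u s - u t)) (le_trans (ler_normB _ _)) //.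
  by rewrite lerD2l.
have hb : `|w s - w t| <= `|s - t| * `|b| + e / (K + 1) * `|s - t|.
  rewrite -normrZ -{1}(subrK ((s - t) *: b) (w s - w t)) (le_trans (ler_normD _ _)) //.
  by rewrite addrC lerD2l.
have hb' := ler_wpM2l K0 hb.
rewrite -(ler_pM2l p0) (le_trans ha) //.
have -> : `|s - t| * (K * `|b| + e) =
    K * (`|s - t| * `|b| + e / (K + 1) * `|s - t|) + e / (K + 1) * `|s - t|.
  by field; rewrite gt_eqF // ltr_wpDl.
by rewrite lerD2r (le_trans hs).
Qed.

Lemma linear_funB (V W : lmodType R) (L : V -> W) u v : linear L -> L (u - v) = L u - L v.
Proof. by move=> lL; have := lL (-1) v u; rewrite !scaleN1r [- v + u]addrC => ->; rewrite addrC. Qed.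

Lemma linear_funZ (V W : lmodType R) (L : V -> W) a u : linear L -> L (a *: u) = a *: L u.
Proof.
move=> lL; have L0 : L 0 = 0 by rewrite -(subrr 0) (linear_funB _ _ lL) subrr.
by have := lL a u 0; rewrite L0 !addr0.
Qed.

Lemma is_derive_linear (V W : normedModType R) (L : V -> W) (k : R) (u : R -> V) (t : R) l :
  linear L -> 0 < k -> (forall v, `|L v| <= k * `|v|) ->
  is_derive t 1 u l -> is_derive t 1 (fun s => L (u s)) (L l).
Proof.
move=> lL k0 hk /is_derive_approx hu; apply/is_derive_approx => e e0.
have [r r0 hr] := hu _ (divr_gt0 e0 k0).
exists r => // s /hr h.
have -> : L (u s) - L (u t) - (s - t) *: L l = L (u s - u t - (s - t) *: l).
  by rewrite !(linear_funB _ _ lL) (linear_funZ _ _ lL).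
rewrite (le_trans (hk _)) // -(ler_pM2l (_ : 0 < k^-1)) ?invr_gt0 // mulKf ?gt_eqF //.
by rewrite (le_trans h) // mulrA [k^-1 * e]mulrC.
Qed.

Lemma C1_at_linear n (W : normedModType R) (L : 'rV[R]_n -> W) (k : R) x :
  linear L -> 0 < k -> (forall v, `|L v| <= k * `|v|) -> C1_at L x.
Proof.
move=> lL k0 hk.
have LB u v : L (u - v) = L u - L v by exact: linear_funB.
have dL y : differentiable L y /\ forall v, dif L y v = L v.
  apply: diff_of_approx => //.
    move=> z; apply/continuous_normP => e e0; exists (e / k); first by rewrite divr_gt0.
    by move=> z' h; rewrite -LB (le_lt_trans (hk _)) // mulrC -ltr_pdivlMr.
  by move=> e e0; exists 1 => // z _; rewrite -LB subrr normr0 mulr_ge0 // ltW.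
move=> e e0; exists 1 => // y _; split; first exact: (dL y).1.
by move=> v; rewrite !(dL _).2 subrr normr0 mulr_ge0 // ltW.
Qed.

Lemma C1_at_coord n m (F : 'rV[R]_n -> 'rV[R]_m) j x : C1_at F x ->
  C1_at (fun y => F y 0 j : R) x.
Proof.
move=> FC; apply: (C1_at_comp FC (f := fun w : 'rV[R]_m => w 0 j : R)).
apply: (@C1_at_linear _ _ _ 1) => //; first by move=> a u v; rewrite !mxE.
by move=> v; rewrite mul1r norm_coord_le.
Qed.

Lemma C1_at_near_diff n (W : normedModType R) (f : 'rV[R]_n -> W) x :
  C1_at f x -> \forall y \near x, differentiable f y.
Proof.
by move=> /(_ _ ltr01)[r r0 hr]; apply/near_normP; exists r => // y /hr[].
Qed.

Lemma quotient_continuous (V : normedModType R) (p q dp dq : V -> R) x :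
  {for x, continuous p} -> {for x, continuous q} -> {for x, continuous dp} ->
  {for x, continuous dq} -> q x != 0 ->
  {for x, continuous (fun y => p y * (- ((q y)^-1 * (q y)^-1 * dq y)) + (q y)^-1 * dp y)}.
Proof.
move=> pc qc dpc dqc qx.
have h1 : {for x, continuous (fun y => (q y)^-1)} by exact: continuousV.
have h2 := continuousM (continuousM h1 h1) dqc.
exact: continuousD (continuousM pc (continuousN h2)) (continuousM h1 dpc).
Qed.

Lemma C1_at_div n (p q : 'rV[R]_n -> R) x : C1_at p x -> C1_at q x -> q x != 0 ->
  C1_at (fun y => p y / q y) x.
Proof.
move=> pC qC qx.
have dp := C1_at_near_diff pC; have dq := C1_at_near_diff qC.
have pc := differentiable_continuous (C1_at_diff pC).
have qc := differentiable_continuous (C1_at_diff qC).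
have qn : \forall y \near x, q y != 0.
  have qx0 : 0 < `|q x| by rewrite normr_gt0.
  have [r r0 hr] := (continuous_normP _ _).1 qc _ qx0.
  apply/near_normP; exists r => // y /hr h.
  by apply: contraTneq h => ->; rewrite sub0r normrN ltxx.
have dE v : \forall y \near x, p y * (- ((q y)^-1 * (q y)^-1 * 'D_v q y)) + (q y)^-1 * 'D_v p y =
    'D_v (fun y => p y / q y) y.
  near=> y.
  have dpy : derivable p y v by apply: diff_derivable; near: y.
  have dqy : derivable q y v by apply: diff_derivable; near: y.
  have qy : q y != 0 by near: y.
  have -> : (fun y => p y / q y) = p * (fun y => (q y)^-1) by [].
  have dqi : derivable (fun y => (q y)^-1) y v by exact: derivableV.
  by rewrite (deriveM dpy dqi) (deriveV qy dqy) scaleNr -exprVn expr2.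
apply: near_C1_at.
  near=> y.
  have dpy : differentiable p y by near: y.
  have dqy : differentiable q y by near: y.
  have qy : q y != 0 by near: y.
  have -> : (fun y => p y / q y) = p * (fun y => (q y)^-1) by [].
  by apply: differentiableM => //; exact: differentiableV.
move=> v; apply: continuous_near_eq (dE v) _.
have Dpc := @C1_at_continuous_derive _ _ _ p x v pC.
have Dqc := @C1_at_continuous_derive _ _ _ q x v qC.
exact: quotient_continuous.
Unshelve. all: by end_near. Qed.

(** The multipliers on [e ord0] and [e k] agree because the sum of the two vectors is again an
    eigenvector. *)
Lemma scalar_mx_of_eigen n (C : 'M[R]_n) :
  (forall w : 'rV[R]_n, exists a : R, w *m C = a *: w) -> exists a : R, C = a%:M.
Proof.
case: n C => [C _|n C h]; first by exists 0; apply/matrixP => -[].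
pose e (k : 'I_n.+1) : 'rV[R]_n.+1 := delta_mx 0 k.
have [a0 h0] := h (e ord0).
exists a0; apply/row_matrixP => k; rewrite !rowE mul_mx_scalar.
rewrite -[delta_mx 0 k]/(e k).
have [->|k0] := eqVneq k ord0; first exact: h0.
have [ak hk] := h (e k); have [b hb] := h (e ord0 + e k).
rewrite hk; congr (_ *: _).
rewrite mulmxDl h0 hk scalerDr in hb.
have E0 := congr1 (fun v : 'rV[R]_n.+1 => v 0 ord0) hb.
have Ek := congr1 (fun v : 'rV[R]_n.+1 => v 0 k) hb.
rewrite !mxE !eqxx /= eq_sym (negbTE k0) /= !mulr0 !mulr1 !addr0 in E0.
rewrite !mxE !eqxx /= (negbTE k0) /= !mulr0 !mulr1 !add0r in Ek.
by rewrite E0.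
Qed.

Context {n : nat} {M : manifold R n}.

Section Collinear.
Variables (X Y : vector_field M) (phi psi : R -> M -> M).
Hypotheses (XC : Ck_vector_field 1 X) (YC : Ck_vector_field 1 Y).
Hypotheses (phiX : is_flow X phi) (psiY : is_flow Y psi).
Hypothesis comm : forall (s t : R) (x : M), psi s (phi t x) = phi t (psi s x).

(** [FY] at [phi h x] is the velocity at [s = 0] of [psi s (phi h x)], which is [phi h (psi s x)].
    Differentiating [flow_variation] in [s] between the orbits of [x] and [psi s x] yields
    [FY (c x) + h *: dif FX (c x) (FY (c x))] up to [eta * |h| * |FY (c x)|]. The derivative of [FY]
    along [X] can then be read off. *)
Lemma commuting_bracket c x : atlas c -> chart_dom c x ->
  dif (local_rep Y c) (c x) (local_rep X c (c x)) =
  dif (local_rep X c) (c x) (local_rep Y c (c x)).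
Proof.
move=> ac cx; set FX := local_rep X c; set FY := local_rep Y c.
have CX : C1_at FX (c x) := local_rep_C1 XC ac cx.
have CY : C1_at FY (c x) := local_rep_C1 YC ac cx.
have phi0 : phi 0 x = x := flow0 phiX x.
have psi0 y : psi 0 y = y := flow0 psiY y.
have curve : is_derive (0 : R) 1 (c \o phi^~ x) (FX (c x)).
  have c0 : chart_dom c (phi 0 x) by rewrite phi0.
  by have := integral_curve_derive (flow_curve phiX x) ac c0; rewrite phi0.
have H1 : is_derive (0 : R) 1 (FY \o (c \o phi^~ x)) (dif FY (c x) (FX (c x))).
  have dF : differentiable FY ((c \o phi^~ x) 0) by rewrite /= phi0; exact: C1_at_diff.
  by have := is_derive_chain dF curve; rewrite /= phi0.
apply: (is_derive_unique H1).
apply/is_derive_approx => e e0.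
pose eta := e / (`|FY (c x)| + 1).
have N0 : 0 < `|FY (c x)| + 1 by rewrite ltr_wpDl.
have eta0 : 0 < eta by rewrite divr_gt0.
have [d d0 hd] := flow_variation XC ac cx eta0.
have [k k0 hk] := dif_lipschitz (C1_at_diff CX).
exists d => // h; rewrite subr0 => hh /=; rewrite phi0.
have hx := hd _ _ (flow_curve phiX x) (flow_curve phiX x).
rewrite phi0 subrr normr0 in hx; have [ch _ _ _] := hx cx cx d0 d0 h hh.
suff : `|FY (c (phi h x)) - FY (c x) - h *: dif FX (c x) (FY (c x))| <=
    eta * `|h| * `|FY (c x)|.
  move=> /le_trans; apply; rewrite mulrAC ler_wpM2r // /eta mulrAC ler_pdivrMr //.
  by rewrite ler_pM2l // lerDl.
have dV : is_derive (0 : R) 1 (c \o psi^~ x) (FY (c x)).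
  have c0 : chart_dom c (psi 0 x) by rewrite psi0.
  by have := integral_curve_derive (flow_curve psiY x) ac c0; rewrite psi0.
have dU : is_derive (0 : R) 1 (c \o psi^~ (phi h x)) (FY (c (phi h x))).
  have c0 : chart_dom c (psi 0 (phi h x)) by rewrite psi0.
  by have := integral_curve_derive (flow_curve psiY (phi h x)) ac c0; rewrite psi0.
have dA := is_derive_linear (dif_linear FX (c x)) k0 hk dV.
have dB := is_deriveB (is_deriveB dU dV) (is_deriveZ h dA).
apply: (derive_norm_le _ dB dV); first by rewrite mulr_ge0 // ltW.
have Wx : \forall z \near psi 0 x, chart_dom c z /\ `|c z - c x| < d.
  rewrite psi0; apply: (@chart_pull _ _ _ c x (fun y => `|y - c x| < d)) => //.
  by apply/near_normP; exists d.
have nb : \forall s \near (0 : R), chart_dom c (psi s x) /\ `|c (psi s x) - c x| < d.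
  exact: (flow_curve psiY x).1 0 _ Wx.
apply: filterS nb => s [cs hs].
have := hd _ _ (flow_curve phiX x) (flow_curve phiX (psi s x)).
rewrite phi0 (flow0 phiX) subrr normr0 => /(_ cx cs d0 hs h hh)[_ _ _].
rewrite -comm /= !psi0; congr (_ <= _); congr `| _ |.
rewrite -[(_ - _ - _ : R -> _) s]/(c (psi s (phi h x)) - c (psi s x) - h *: dif FX (c x) (c (psi s x))).
rewrite -[(_ - _ - _ : R -> _) 0]/(c (psi 0 (phi h x)) - c (psi 0 x) - h *: dif FX (c x) (c (psi 0 x))).
rewrite !psi0.
have -> : dif FX (c x) (c (psi s x) - c x) = dif FX (c x) (c (psi s x)) - dif FX (c x) (c x).
  exact: linearB.
by apply/rowP => i; rewrite !mxE; ring.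
Qed.

Variable f : M -> R.
Hypothesis f_coll : forall x, Y x = f x *: X x.

Lemma local_rep_coll c z : chart_dom c z ->
  local_rep Y c (c z) = f z *: local_rep X c (c z).
Proof. by move=> cz; rewrite !local_repE // f_coll to_coordZ. Qed.

Lemma ratio_C1 c x : atlas c -> chart_dom c x -> X x != 0 ->
  C1_at (f \o chart_inv c) (c x).
Proof.
move=> ac cx Xx.
have CX := local_rep_C1 XC ac cx; have CY := local_rep_C1 YC ac cx.
have [j Xj] : exists j, local_rep X c (c x) 0 j != 0.
  apply: contrapT => /forallNP h; move/eqP: Xx; apply; apply/eqP.
  rewrite -(to_coord_eq0 _ ac cx) -local_repE //; apply/eqP/rowP => j.
  by rewrite [RHS]mxE; have /negP := h j; rewrite negbK => /eqP.
have CXj := C1_at_coord j CX.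
apply: C1_at_near_eq (C1_at_div (C1_at_coord j CY) CXj Xj).
have Xj0 : 0 < `|local_rep X c (c x) 0 j| by rewrite normr_gt0.
have [r r0 hr] := (continuous_normP _ _).1 (differentiable_continuous (C1_at_diff CXj)) _ Xj0.
have nX : \forall y \near c x, local_rep X c y 0 j != 0.
  apply/near_normP; exists r => // y /hr h.
  by apply: contraTneq h => ->; rewrite sub0r normrN ltxx.
have nb := near_chart_inv cx (near_chart_dom cx).
apply: filterS (filterI nX nb) => y [Xy [cy _]] /=.
have dy := chart_inv_dom cy.
have E := local_rep_coll dy; rewrite chart_invK // in E.
by rewrite E mxE mulfK.
Qed.

(** Differentiating [FY = f FX] along an orbit of [X] produces [X(f) FX] plus [f] times the
    derivative of [FX] along [X]. The bracket identity equates the whole with this last term, so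
    [X(f)] vanishes on a nonzero coordinate of [FX]. *)
Lemma ratio_derive c x : atlas c -> chart_dom c x -> X x != 0 ->
  dif (f \o chart_inv c) (c x) (local_rep X c (c x)) = 0.
Proof.
move=> ac cx Xx.
set FX := local_rep X c; set FY := local_rep Y c.
have CX : C1_at FX (c x) := local_rep_C1 XC ac cx.
have CY : C1_at FY (c x) := local_rep_C1 YC ac cx.
have Cf := ratio_C1 ac cx Xx.
have phi0 : phi 0 x = x := flow0 phiX x.
have curve : is_derive (0 : R) 1 (c \o phi^~ x) (FX (c x)).
  have c0 : chart_dom c (phi 0 x) by rewrite phi0.
  by have := integral_curve_derive (flow_curve phiX x) ac c0; rewrite phi0.
have chain (W : normedModType R) (F : 'rV[R]_n -> W) : C1_at F (c x) ->
    is_derive (0 : R) 1 (F \o (c \o phi^~ x)) (dif F (c x) (FX (c x))).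
  move=> /C1_at_diff dF; have dF' : differentiable F ((c \o phi^~ x) 0) by rewrite /= phi0.
  by have := is_derive_chain dF' curve; rewrite /= phi0.
have [j Xj] : exists j, FX (c x) 0 j != 0.
  apply: contrapT => /forallNP h; move/eqP: Xx; apply; apply/eqP.
  rewrite -(to_coord_eq0 _ ac cx) -local_repE //; apply/eqP/rowP => j.
  by rewrite [RHS]mxE; have /negP := h j; rewrite negbK => /eqP.
have dY := is_derive_coord 0 j (chain _ _ CY).
have dX := is_derive_coord 0 j (chain _ _ CX).
have df := chain _ _ Cf.
have dM := is_deriveM df dX.
have near_dom : \forall t \near (0 : R), chart_dom c (phi t x).
  have := near_chart_dom cx; rewrite -{1}phi0 => Wx.
  exact: (flow_curve phiX x).1 0 _ Wx.
have dM' : is_derive (0 : R) 1 (fun s => (FY \o (c \o phi^~ x)) s 0 j)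
    ((f \o chart_inv c \o (c \o phi^~ x)) 0 *: dif FX (c x) (FX (c x)) 0 j +
     FX (c (phi 0 x)) 0 j *: dif (f \o chart_inv c) (c x) (FX (c x))).
  apply: near_eq_is_derive dM; apply: filterS near_dom => t ct /=.
  rewrite -[LHS]/(f (chart_inv c (c (phi t x))) * FX (c (phi t x)) 0 j).
  by rewrite chart_mapK // /FY local_rep_coll // mxE.
have := is_derive_unique dM' dY.
rewrite /= phi0 chart_mapK // commuting_bracket // local_rep_coll // linearZ /= mxE.
move=> h; apply/eqP; have : FX (c x) 0 j * dif (f \o chart_inv c) (c x) (FX (c x)) = 0.
  by apply: (addrI (f x * dif FX (c x) (FX (c x)) 0 j)); rewrite addr0.
by move=> /eqP; rewrite mulf_eq0 (negbTE Xj).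
Qed.

Lemma ratio_invariant x t : f (phi t x) = f x.
Proof.
have [X0|Xn0] := eqVneq (X x) 0; first by rewrite (flow_rest XC phiX).
have df (s : R) : is_derive s 1 (fun t => f (phi t x)) 0.
  pose z := phi s x; pose c := chart_at z.
  have ac : atlas c := atlas_chart_at z; have cz : chart_dom c z := chart_at_dom z.
  have Xz : X z != 0 := flow_nonsing XC phiX s Xn0.
  have dF : differentiable (f \o chart_inv c) ((c \o phi^~ x) s).
    exact: C1_at_diff (ratio_C1 ac cz Xz).
  have := is_derive_chain dF (integral_curve_derive (flow_curve phiX x) ac cz).
  rewrite [dif _ _ _](ratio_derive ac cz Xz); apply: near_eq_is_derive.
  have nb : \forall t \near s, chart_dom c (phi t x).
    exact: (flow_curve phiX x).1 s _ (near_chart_dom cz).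
  by apply: filterS nb => u cu; rewrite /= chart_mapK.
rewrite -[in RHS](flow0 phiX x); have [t0|/ltW t0] := lerP 0 t.
  have [_ _ /eqP] := @scalar_mvt R _ _ 0 t t0 (fun s _ => df s).
  by rewrite mul0r subr_eq0 => /eqP.
have [_ _ /eqP] := @scalar_mvt R _ _ t 0 t0 (fun s _ => df s).
by rewrite mul0r subr_eq0 => /eqP.
Qed.

End Collinear.
End Quotient.

(** * The adjoint equation for the gradient of the first integral *)

Section Gradient.
Context {R : realType}.

(** A covector stored as a row, so that quadratic forms apply to it; it pairs with vectors through
    [bform 1%:M]. *)
Definition grad n (f : 'rV[R]_n -> R) (y : 'rV[R]_n) : 'rV[R]_n :=
  \row_i dif f y (delta_mx 0 i).

Lemma bform1E n (x y : 'rV[R]_n) : bform 1%:M x y = \sum_i x 0 i * y 0 i.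
Proof. by rewrite /bform mulmx1 mxE; apply: eq_bigr => i _; rewrite mxE. Qed.

Lemma grad_dif n (f : 'rV[R]_n -> R) y v : dif f y v = bform 1%:M (grad f y) v.
Proof.
rewrite bform1E (linear_delta_sum (dif f y) v); apply: eq_bigr => i _.
by rewrite mxE mulrC.
Qed.

(** The largest-entry norm is not differentiable along curves. Growth estimates therefore use the
    Euclidean square [bform 1%:M q q], which exceeds this one by a factor of at most [n ^ 2]. *)
Lemma norm2_ge n (q : 'rV[R]_n) : `|q| ^+ 2 <= bform 1%:M q q.
Proof.
have q0 : 0 <= bform 1%:M q q.
  by rewrite bform1E; apply: sumr_ge0 => i _; rewrite -expr2 sqr_ge0.
rewrite -[leRHS]sqr_sqrtr // lerXn2r ?nnegrE ?sqrtr_ge0 //.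
apply: mx_norm_le => [|i j]; first exact: sqrtr_ge0.
rewrite ord1 -sqrtr_sqr ler_wsqrtr // bform1E (bigD1 j) //= -expr2 lerDl.
by apply: sumr_ge0 => k _; rewrite -expr2 sqr_ge0.
Qed.

Lemma delta_norm_le n (i : 'I_n) : `|delta_mx 0 i : 'rV[R]_n| <= 1.
Proof.
apply: mx_norm_le => // a b; rewrite mxE.
by case: (_ && _); rewrite ?normr1 ?normr0.
Qed.

Lemma scalar1_norm_le n : `|1%:M : 'M[R]_n| <= 1.
Proof.
apply: mx_norm_le => // a b; rewrite mxE.
by case: (_ == _); rewrite ?normr1 ?normr0.
Qed.

Lemma bform1_le n (x y : 'rV[R]_n) : `|bform 1%:M x y| <= n%:R ^+ 2 * `|x| * `|y|.
Proof.
rewrite (le_trans (bform_le _ _ _)) // !ler_wpM2r // ler_piMr ?sqr_ge0 //.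
exact: scalar1_norm_le.
Qed.

Lemma norm2_le n (q : 'rV[R]_n) : bform 1%:M q q <= n%:R ^+ 2 * `|q| ^+ 2.
Proof. by rewrite expr2 mulrA (le_trans (ler_norm _)) // bform1_le. Qed.

Lemma grad_continuous n (f : 'rV[R]_n -> R) y : C1_at f y -> {for y, continuous (grad f)}.
Proof.
move=> fC; apply/continuous_normP => e e0.
have [r r0 hr] := fC (e / 2) (divr_gt0 e0 (ltr0Sn R 1)).
exists r => // z /hr[_ h]; apply: (@le_lt_trans _ _ (e / 2)); last first.
  by rewrite ltr_pdivrMr // ltr_pMr // ltr1n.
apply: mx_norm_le => [|i j]; first by rewrite divr_ge0 // ltW.
rewrite !mxE (le_trans (h _)) // ler_piMr ?delta_norm_le //.
by rewrite divr_ge0 // ltW.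
Qed.

Lemma derive_le_of_linear_approx (g : R -> R) (t l w k : R) :
  0 <= k -> is_derive t 1 g l ->
  (forall e, 0 < e -> \forall s \near t, `|g s - g t - (s - t) * w| <= (k + e) * `|s - t|) ->
  `|l - w| <= k.
Proof.
move=> k0 dg H; apply/ler_addgt0Pr => e e0.
have dl (a : R) : is_derive t 1 (fun s : R => s * a) a.
  apply/is_derive_approx => e1 e10; exists 1 => // s _.
  by rewrite -mulrBl subrr normr0 mulr_ge0 // ltW.
have h := derive_norm_le (addr_ge0 k0 (ltW e0)) (is_deriveB dg (dl w)) (dl 1).
have <- : (k + e) * `|1| = k + e by rewrite normr1 mulr1.
apply: h.
apply: filterS (H _ e0) => s; rewrite !mulr1; congr (_ <= _); congr `| _ |.
rewrite -[(_ - _ : R -> R) s]/(g s - s * w) -[(_ - _ : R -> R) t]/(g t - t * w); ring.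
Qed.

Context {n : nat} {M : manifold R n}.
Variables (X Y : vector_field M) (phi psi : R -> M -> M).
Hypotheses (XC : Ck_vector_field 1 X) (YC : Ck_vector_field 1 Y).
Hypotheses (phiX : is_flow X phi) (psiY : is_flow Y psi).
Hypothesis comm : forall (s t : R) (x : M), psi s (phi t x) = phi t (psi s x).
Variable f : M -> R.
Hypothesis f_coll : forall x, Y x = f x *: X x.

(** Invariance gives [F (c w) - F (c z) = F (c (phi h w)) - F (c (phi h z))], and [flow_variation]
    describes the displacement at time [h] by the one at time 0. Only first derivatives of [F]
    appear, yet the result differentiates its gradient in time. *)
Lemma grad_ode0 c z : atlas c -> chart_dom c z -> X z != 0 ->
  is_derive (0 : R) 1 (fun h => grad (f \o chart_inv c) (c (phi h z)))
    (- (grad (f \o chart_inv c) (c z) *m (jacobian (local_rep X c) (c z))^T)).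
Proof.
move=> ac cz Xz; set F := f \o chart_inv c; set FX := local_rep X c.
have phi0 w : phi 0 w = w := flow0 phiX w.
have FC : C1_at F (c z) := ratio_C1 XC YC f_coll ac cz Xz.
have [K0 K00 hK0] := dif_lipschitz (C1_at_diff FC).
have [k k0 hk] := dif_lipschitz (C1_at_diff (local_rep_C1 XC ac cz)).
apply/is_derive_approx => e e0.
pose K := K0 + 1.
have K_gt0 : 0 < K by rewrite ltr_wpDl // ltW.
have eta0 : 0 < e / (2 * K) by rewrite divr_gt0 // mulr_gt0.
have e20 : 0 < Num.min 1 (e / (2 * k)) by rewrite lt_min ltr01 divr_gt0 // mulr_gt0.
have [d d0 hd] := flow_variation XC ac cz eta0.
have [r r0 hr] := FC _ e20.
have [d1 d10 hd1] := escape XC ac cz r0.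
exists (Num.min d d1); first by rewrite lt_min d0.
move=> h; rewrite subr0 lt_min => /andP[hhd hhd1].
have := hd1 _ (flow_curve phiX z); rewrite phi0 subrr normr0.
move=> /(_ cz d10 h hhd1)[ch hrh].
have [dFh hFh] := hr _ hrh.
have Kh w : `|dif F (c (phi h z)) w| <= K * `|w|.
  rewrite -(subrK (dif F (c z) w) (dif F (c (phi h z)) w)) (le_trans (ler_normD _ _)) //.
  rewrite /K mulrDl mul1r addrC lerD // (le_trans (hFh _)) // -[leRHS]mul1r ler_wpM2r //.
  by rewrite ge_min lexx.
(* With [h] fixed, [w] runs over [c z + s *: v] and [s] tends to 0: the differential at [z] is the
   one at [phi h z] precomposed with the linearised flow, to first order in [h]. *)
have key v : `|v| <= 1 ->
    `|dif F (c z) v - dif F (c (phi h z)) (v + h *: dif FX (c z) v)| <= e / 2 * `|h|.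
  move=> v1.
  have dp : is_derive (0 : R) 1 (fun s : R => c z + s *: v) v.
    apply/is_derive_approx => e1 e10; exists 1 => // s _.
    by rewrite !subr0 scale0r addr0 [c z + _]addrC addrK subrr normr0 mulr_ge0 // ltW.
  have dF0 : differentiable F (c z + (0 : R) *: v) by rewrite scale0r addr0; exact: C1_at_diff.
  have dg := is_derive_chain (u := fun s : R => c z + s *: v) dF0 dp.
  rewrite /= scale0r addr0 in dg.
  apply: (derive_le_of_linear_approx _ dg); first by rewrite mulr_ge0 // divr_ge0 // ltW.
  move=> e1 e10.
  have e110 : 0 < e1 / 2 by rewrite divr_gt0.
  have [r1 r10 h1] := diff_approx dFh e110.
  have [r2 r20 h2] := near_chart cz (near_chart_dom cz).
  apply: (near_normP (0 : R) _).2.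
  exists (Num.min d (Num.min (r1 / 2) r2)); first by rewrite !lt_min d0 divr_gt0.
  move=> s; rewrite subr0 !lt_min => /and3P[sd s1 s2].
  have sv : `|s *: v| <= `|s| by rewrite normrZ ler_piMr.
  pose w := chart_inv c (c z + s *: v).
  have [cod_w _] : chart_codom c (c z + s *: v) /\ chart_dom c (chart_inv c (c z + s *: v)).
    by apply: h2; rewrite addrC addKr (le_lt_trans sv).
  have cw : chart_dom c w := chart_inv_dom cod_w.
  have cwE : c w = c z + s *: v by rewrite chart_invK.
  have := hd _ _ (flow_curve phiX z) (flow_curve phiX w).
  have wz : c w - c z = s *: v by rewrite cwE [c z + _]addrC addrK.
  rewrite !phi0 wz subrr normr0.
  move=> /(_ cz cw d0 (le_lt_trans sv sd) h hhd)[_ chw D2 Dh].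
  set D := c (phi h w) - c (phi h z) in D2 Dh.
  have FE a : chart_dom c a -> F (c a) = f a by move=> ca; rewrite /F /= chart_mapK.
  have inv a : f (phi h a) = f a := ratio_invariant XC YC phiX psiY comm f_coll a h.
  have := h1 (c (phi h w)); rewrite -/D => /(_ _) h3.
  have {}h3 : `|F (c (phi h w)) - F (c (phi h z)) - dif F (c (phi h z)) D| <= e1 / 2 * `|D|.
    by apply: h3; move: D2 sv s1; lra.
  have {}h3 : `|F (c z + s *: v) - F (c z) - dif F (c (phi h z)) D| <= e1 / 2 * `|D|.
    by rewrite -cwE !FE // -(inv w) -(inv z) -!FE.
  rewrite -[(F \o _) s]/(F (c z + s *: v)) -[(F \o _) 0]/(F (c z + 0 *: v)) scale0r addr0.
  clearbody D; rewrite difZ in Dh.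
  have E1 : dif F (c (phi h z)) D - s * dif F (c (phi h z)) (v + h *: dif FX (c z) v) =
      dif F (c (phi h z)) (D - s *: v - h *: (s *: dif FX (c z) v)).
    have -> : D - s *: v - h *: (s *: dif FX (c z) v) = D - s *: (v + h *: dif FX (c z) v).
      by apply/rowP => i; rewrite !mxE; ring.
    by rewrite difB difZ.
  have E2 : F (c z + s *: v) - F (c z) - s * dif F (c (phi h z)) (v + h *: dif FX (c z) v) =
      (F (c z + s *: v) - F (c z) - dif F (c (phi h z)) D) +
      dif F (c (phi h z)) (D - s *: v - h *: (s *: dif FX (c z) v)).
    by rewrite -E1; ring.
  rewrite E2 (le_trans (ler_normD _ _)) // mulrDl addrC lerD //.
    rewrite (le_trans (Kh _)) // (le_trans (ler_wpM2l (ltW K_gt0) Dh)) //.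
    have -> : K * (e / (2 * K) * `|h| * `|s *: v|) = e / 2 * `|h| * `|s *: v|.
      by field; rewrite gt_eqF.
    by rewrite ler_wpM2l // mulr_ge0 // divr_ge0 // ltW.
  rewrite (le_trans h3) //; have e12 : 0 <= e1 / 2 by exact: ltW.
  have := ler_wpM2l e12 (le_trans D2 (ler_wpM2l (ltW (ltr0Sn R 1)) sv)).
  by congr (_ <= _); field.
apply: mx_norm_le => [|i j]; first by rewrite mulr_ge0 // ltW.
rewrite ord1 scalerN opprK !mxE.
pose v : 'rV[R]_n := delta_mx 0 j; rewrite -/v.
have v1 : `|v| <= 1 := delta_norm_le j.
have -> : \sum_k grad F (c z) 0 k * (jacobian FX (c z))^T k j = dif F (c z) (dif FX (c z) v).
  rewrite grad_dif bform1E; apply: eq_bigr => l _; congr (_ * _).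
  by rewrite dif_jacobian /v -rowE [LHS]mxE [RHS]mxE.
have h1 := key _ v1; rewrite difD difZ in h1.
have h2 := hFh (dif FX (c z) v); have h3 := hk v.
have h4 : `|dif F (c (phi h z)) (dif FX (c z) v) - dif F (c z) (dif FX (c z) v)| <= e / 2.
  rewrite (le_trans h2) // (@le_trans _ _ (e / (2 * k) * (k * 1))) //.
    apply: ler_pM => //; first by rewrite le_min ler01 divr_ge0 ?(ltW e0) ?mulr_ge0 ?(ltW k0).
      by rewrite ge_min lexx orbT.
    by rewrite (le_trans h3) // ler_wpM2l // ltW.
  by rewrite le_eqVlt; apply/orP; left; apply/eqP; field; rewrite gt_eqF.
set a := dif F (c (phi h z)) v in h1 *; set b := dif F (c z) v in h1 *.
set a' := dif F (c (phi h z)) _ in h1 h4; set b' := dif F (c z) (dif FX (c z) v) in h4 *.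
(* The first term is [key]; in the second, [a' - b'] is small because the differential of [F] is
   continuous at [c z]. *)
have -> : a - b + h * b' = - (b - (a + h * a')) - h * (a' - b') by ring.
rewrite (le_trans (ler_normB _ _)) // normrN normrM.
have h5 := ler_wpM2l (normr_ge0 h) h4.
have -> : e * `|h| = e / 2 * `|h| + `|h| * (e / 2) by field.
by rewrite lerD.
Qed.

Lemma grad_ode c z t : atlas c -> chart_dom c (phi t z) -> X z != 0 ->
  is_derive t 1 (fun s => grad (f \o chart_inv c) (c (phi s z)))
    (- (grad (f \o chart_inv c) (c (phi t z)) *m
        (jacobian (local_rep X c) (c (phi t z)))^T)).
Proof.
move=> ac ct Xz.
have /is_derive_approx H := grad_ode0 ac ct (flow_nonsing XC phiX t Xz).
apply/is_derive_approx => e e0; have [r r0 hr] := H _ e0.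
exists r => // s st; have := hr (s - t); rewrite subr0 => /(_ st).
by rewrite -(flowD XC phiX) subrK (flow0 phiX).
Qed.

End Gradient.

(** * Regularity at a hyperbolic singularity *)

Section SingularPoint.
Context {R : realType} {n : nat} {M : manifold R n}.
Variables (X Y : vector_field M) (phi psi : R -> M -> M).
Hypotheses (XC : Ck_vector_field 1 X) (YC : Ck_vector_field 1 Y).
Hypotheses (phiX : is_flow X phi) (psiY : is_flow Y psi).
Hypothesis comm : forall (s t : R) (x : M), psi s (phi t x) = phi t (psi s x).
Variable x : M.
Hypotheses (X0 : X x = 0) (Y0 : Y x = 0).
Hypothesis hyp : hyperbolic X x.

Local Notation c := (chart_at x).
Local Notation y0 := (chart_at x x).
Local Notation FX := (local_rep X (chart_at x)).
Local Notation FY := (local_rep Y (chart_at x)).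
Local Notation J := (jacobian (local_rep X (chart_at x)) (chart_at x x)).

Let ac : atlas c := atlas_chart_at x.
Let cx : chart_dom c x := chart_at_dom x.
Let Ju : J \in unitmx := hyperbolic_unit hyp.
Let CX : C1_at FX y0 := local_rep_C1 XC ac cx.
Let CY : C1_at FY y0 := local_rep_C1 YC ac cx.
Let FX0 : FX y0 = 0. Proof. by rewrite local_repE // X0 to_coord0. Qed.
Let FY0 : FY y0 = 0. Proof. by rewrite local_repE // Y0 to_coord0. Qed.

(** At [y0 + h *: v] the fields are [h] times their linear parts up to small errors, and
    [FY = a *: FX] there. Were the linear parts independent at [v], [independent_gap] would force
    [h = 0]. No bound on [a] is at hand, but the gap tolerates an error proportional to
    [|a * h|]. *)
Lemma singular_multiplier : (forall z, exists a : R, Y z = a *: X z) ->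
  exists a : R, forall v, dif FY y0 v = a *: dif FX y0 v.
Proof.
move=> coll.
have eig v : exists a : R, dif FY y0 v = a *: dif FX y0 v.
  apply: contrapT => /forallNP nv.
  have A0 : dif FX y0 v != 0.
    apply/eqP => vJ; apply: (nv 0); rewrite scale0r.
    have -> : v = 0 by rewrite dif_jacobian in vJ; rewrite -(mulmxK Ju v) vJ mul0mx.
    by rewrite linear0.
  have nv' a : dif FY y0 v != a *: dif FX y0 v by apply/eqP; exact: nv.
  have [eta eta0 gap] := independent_gap A0 nv'.
  have v10 : 0 < `|v| + 1 by rewrite ltr_wpDl.
  have e0 : 0 < eta / (`|v| + 1) by rewrite divr_gt0.
  have [r1 r10 h1] := diff_approx (C1_at_diff CX) e0.
  have [r2 r20 h2] := diff_approx (C1_at_diff CY) e0.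
  have [r3 r30 h3] := near_chart cx (near_chart_dom cx).
  pose m := Num.min r1 (Num.min r2 r3).
  have m0 : 0 < m by rewrite !lt_min r10 r20.
  pose h := m / (2 * (`|v| + 1)).
  have h0 : 0 < h by rewrite divr_gt0 // mulr_gt0.
  have hv : `|h *: v| < m.
    rewrite normrZ gtr0_norm // /h mulrAC ltr_pdivrMr ?mulr_gt0 // ltr_pM2l //.
    by have := normr_ge0 v; lra.
  have dy : (y0 + h *: v) - y0 = h *: v by rewrite addrC addKr.
  have hvm := hv; rewrite -dy !lt_min in hvm; case/and3P: hvm => /h1 g1 /h2 g2 /h3[cod _].
  rewrite FX0 subr0 dy difZ in g1; rewrite FY0 subr0 dy difZ in g2.
  have dz := chart_inv_dom cod; have [a ha] := coll (chart_inv c (y0 + h *: v)).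
  have E : FY (y0 + h *: v) = a *: FX (y0 + h *: v).
    by rewrite -(chart_invK cod) !local_repE // ha to_coordZ.
  suff : h = 0 by move=> hh; rewrite hh ltxx in h0.
  apply: (gap h (a * h)).
  have -> : h *: dif FY y0 v - (a * h) *: dif FX y0 v =
      a *: (FX (y0 + h *: v) - h *: dif FX y0 v) - (FY (y0 + h *: v) - h *: dif FY y0 v).
    by rewrite E; apply/rowP => i; rewrite !mxE; ring.
  clearbody h; rewrite (le_trans (ler_normB _ _)) // normrZ normrM.
  have hvn : eta / (`|v| + 1) * `|h *: v| <= eta * `|h|.
    have -> : eta / (`|v| + 1) * `|h *: v| = eta * `|h| * (`|v| / (`|v| + 1)).
      by rewrite normrZ; field; rewrite gt_eqF.
    rewrite ler_piMr ?mulr_ge0 ?(ltW eta0) // ler_pdivrMr // mul1r lerDl //.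
  have g1' := ler_wpM2l (normr_ge0 a) (le_trans g1 hvn).
  have g2' := le_trans g2 hvn.
  have -> : eta * (`|h| + `|a| * `|h|) = `|a| * (eta * `|h|) + eta * `|h| by ring.
  exact: lerD.
(* Each vector being sent to a multiple of its image under [J], every vector is an eigenvector of
   [invmx J *m jacobian FY y0]. *)
have [|a ha] := @scalar_mx_of_eigen R n (invmx J *m jacobian FY y0).
  move=> w; have [a haw] := eig (w *m invmx J); exists a.
  by rewrite mulmxA -dif_jacobian haw dif_jacobian mulmxKV.
exists a => v; rewrite !dif_jacobian.
by rewrite -{1}(mulmxK Ju v) -(mulmxA (v *m J)) ha mul_mx_scalar.
Qed.

Variable f : M -> R.
Hypothesis f_coll : forall z, Y z = f z *: X z.
Hypothesis f_sing : forall v, dif FY y0 v = f x *: dif FX y0 v.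
Local Notation F := (f \o chart_inv (chart_at x)).

(** [(f z - f x) *: FX] is a combination of the two linearisation errors, hence small against the
    distance to [y0], whereas [FX] is at least [a] times that distance. *)
Lemma ratio_near_singular (e : R) : 0 < e -> exists2 r : R, 0 < r &
  forall z, chart_dom c z -> `|c z - y0| < r -> `|f z - f x| <= e.
Proof.
move=> e0.
have [a a0 [r r0 ha]] := singularity_lower XC ac cx X0 Ju.
have l0 : 0 < 1 + `|f x| by rewrite ltr_pwDl.
have e1 : 0 < e * a / (1 + `|f x|) by rewrite divr_gt0 // mulr_gt0.
have [r1 r10 h1] := diff_approx (C1_at_diff CX) e1.
have [r2 r20 h2] := diff_approx (C1_at_diff CY) e1.
exists (Num.min r (Num.min r1 r2)); first by rewrite !lt_min r0 r10.
move=> z cz; rewrite !lt_min => /and3P[zr /h1 g1 /h2 g2].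
have [->|zx] := eqVneq z x; first by rewrite subrr normr0 ltW.
have w0 : 0 < `|c z - y0|.
  rewrite normr_gt0 subr_eq0; apply: contra zx => /eqP h; apply/eqP.
  by rewrite -(chart_mapK cz) h chart_mapK.
rewrite FX0 subr0 in g1; rewrite FY0 subr0 f_sing in g2.
have g3 := ha _ zr.
have E : (f z - f x) *: FX (c z) =
    (FY (c z) - f x *: dif FX y0 (c z - y0)) - f x *: (FX (c z) - dif FX y0 (c z - y0)).
  by rewrite (local_rep_coll f_coll cz); apply/rowP => i; rewrite !mxE; ring.
have g4 : `|f z - f x| * `|FX (c z)| <= e * a * `|c z - y0|.
  rewrite -normrZ E (le_trans (ler_normB _ _)) // normrZ.
  have g1' := ler_wpM2l (normr_ge0 (f x)) g1.
  rewrite (le_trans (lerD g2 g1')) // le_eqVlt; apply/orP; left; apply/eqP.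
  by field; rewrite gt_eqF.
have g5 := ler_wpM2l (normr_ge0 (f z - f x)) g3.
have := le_trans g5 g4; rewrite mulrA ler_pM2r // mulrC [e * a]mulrC ler_pM2l //.
Qed.

(** Halving the radius [m] secures the estimates on a closed ball, whose boundary sphere is where
    orbits exit. *)
Lemma singular_box (e1 e2 : R) : 0 < e1 -> 0 < e2 -> exists2 rho : R, 0 < rho &
  [/\ forall y, `|y - y0| <= rho -> chart_codom c y,
      forall y, `|y - y0| <= rho -> `|FX y - (y - y0) *m J| <= e1 * `|y - y0|,
      forall y, `|y - y0| <= rho -> `|jacobian FX y - J| <= e2 &
      forall z, chart_dom c z -> `|c z - y0| <= rho -> z != x -> X z != 0].
Proof.
move=> e10 e20.
have [r1 r10 h1] := diff_approx (C1_at_diff CX) e10.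
have [r2 r20 h2] := CX e20.
have [r3 r30 h3] := near_chart cx (near_chart_dom cx).
have [a a0 [r4 r40 h4]] := singularity_lower XC ac cx X0 Ju.
pose m := Num.min (Num.min r1 r2) (Num.min r3 r4).
have m0 : 0 < m by rewrite !lt_min r10 r20 r30.
exists (m / 2); first by rewrite divr_gt0.
have lt_m y : `|y - y0| <= m / 2 -> [&& `|y - y0| < r1, `|y - y0| < r2,
    `|y - y0| < r3 & `|y - y0| < r4].
  move=> h; have : `|y - y0| < m by apply: le_lt_trans h _; rewrite ltr_pdivrMr // ltr_pMr // ltr1n.
  by rewrite !lt_min => /andP[/andP[-> ->] /andP[-> ->]].
split.
- by move=> y /lt_m/and4P[_ _ /h3[]].
- by move=> y /lt_m/and4P[/h1 + _ _ _]; rewrite FX0 subr0 dif_jacobian.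
- move=> y /lt_m/and4P[_ /h2[_ h] _ _].
  have h' (v : 'rV[R]_n) : `|v *m jacobian FX y - v *m J| <= e2 * `|v|.
    have E1 := dif_jacobian FX y v.
    have E2 := dif_jacobian FX y0 v.
    have := h v.
    rewrite E1.
    by rewrite E2.
  move: (jacobian FX y) J h' => A B h'; apply: mx_norm_le => [|i j]; first exact: ltW.
  have := h' (delta_mx 0 i); rewrite -!rowE => hi.
  have := norm_coord_le (row i A - row i B) 0 j.
  have -> : (row i A - row i B) 0 j = (A - B) i j by rewrite !mxE.
  move=> /le_trans; apply; rewrite (le_trans hi) // ler_piMr ?(ltW e20) //.
  exact: delta_norm_le.
- move=> z cz /lt_m/and4P[_ _ _ /h4]; rewrite local_repE // => h zx.
  apply: contra zx => /eqP Xz; rewrite Xz to_coord0 normr0 in h.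
  rewrite pmulr_rle0 // normr_le0 subr_eq0 in h; apply/eqP.
  by rewrite -(chart_mapK cz) (eqP h) chart_mapK.
Qed.

Section Box.
Variables (S T : 'M[R]_n) (mS mT : R).
Hypotheses (mS0 : 0 < mS) (mT0 : 0 < mT) (ST : S^T = S) (TT : T^T = T).
Hypothesis SJ : forall v, mS * `|v| ^+ 2 <= bform S (v *m J) v.
Hypothesis TJ : forall v, mT * `|v| ^+ 2 <= bform T (- (v *m J^T)) v.
Local Notation N := (n%:R ^+ 2 : R).
Variables (e1 e2 rho : R).
Hypotheses (e10 : 0 < e1) (e20 : 0 < e2) (rho0 : 0 < rho).
(** [e1] and [e2] measure how far the field and its jacobian are from linear; under these two bounds
    the deviation costs at most half of the monotonicity of [S] and of [T]. *)
Hypothesis he1 : N * `|S| * e1 <= mS / 2.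
Hypothesis he2 : N * `|T| * (n%:R * e2) <= mT / 2.
Hypothesis box_codom : forall y, `|y - y0| <= rho -> chart_codom c y.
Hypothesis box_lin : forall y, `|y - y0| <= rho -> `|FX y - (y - y0) *m J| <= e1 * `|y - y0|.
Hypothesis box_jac : forall y, `|y - y0| <= rho -> `|jacobian FX y - J| <= e2.
Hypothesis box_reg : forall z, chart_dom c z -> `|c z - y0| <= rho -> z != x -> X z != 0.

Let W z := chart_dom c z /\ `|c z - y0| < rho.
Let V z := chart_dom c z /\ `|c z - y0| <= rho.

(* [eps = 1] follows the orbit forwards and [eps = -1] backwards. *)
Let curve_derive (eps : R) z t : chart_dom c (phi (eps * t) z) ->
  is_derive t 1 (fun s => c (phi (eps * s) z) - y0) (eps *: FX (c (phi (eps * t) z))).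
Proof.
move=> ct; have H := integral_curve_derive (flow_curve phiX z) ac ct.
have := is_derive_rescale H => H1.
have H2 := is_deriveB H1 (is_derive_cst y0 t 1).
by apply: (is_derive_eq H2); rewrite subr0.
Qed.

(** If [f z] differed from [f x], invariance of [f] and its continuity at [x] would keep the orbit
    at distance at least [r] from [x]. The form of [S] would then grow at rate [mS * r ^+ 2] forever
    while staying bounded in the box. The factor [eps] in [H] makes it increase in either time
    direction. *)
Lemma trapped_ratio (eps : R) z : eps ^+ 2 = 1 -> z != x ->
  (forall t, 0 <= t -> W (phi (eps * t) z)) -> f z = f x.
Proof.
move=> eps1 zx hW; apply/eqP/contraT => fzx.
have k0 : 0 < `|f z - f x| / 2 by rewrite divr_gt0 // normr_gt0 subr_eq0.
have [r r0 hr] := ratio_near_singular k0.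
have wr t : 0 <= t -> r <= `|c (phi (eps * t) z) - y0|.
  move=> t0; have [ct _] := hW t t0; rewrite leNgt; apply/negP => /(hr _ ct).
  rewrite (ratio_invariant XC YC phiX psiY comm f_coll) => h.
  by move: h k0; lra.
pose w t := c (phi (eps * t) z) - y0.
pose H t := eps * bform S (w t) (w t).
pose H' t := 2 * bform S (FX (c (phi (eps * t) z))) (w t).
have dH (t : R) : 0 <= t -> is_derive t 1 H (H' t).
  move=> t0; have [ct _] := hW t t0.
  have dq := is_derive_qform ST (curve_derive ct).
  have dZ := is_deriveZ eps dq.
  apply: (is_derive_eq dZ); rewrite bformZl /H' /w.
  by rewrite -[LHS]/(eps * (2 * (eps * _))) mulrCA [eps * (_ * _)]mulrA -expr2 eps1 mul1r.
have H'ge t : 0 <= t -> mS * r ^+ 2 <= H' t.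
  move=> t0; have [_ wt] := hW t t0; have wt' := ltW wt.
  have h1 := box_lin wt'; have h2 := SJ (w t); have h3 := wr t t0.
  rewrite -/(w t) in h1 h3.
  have -> : H' t = 2 * (bform S (w t *m J) (w t) +
      bform S (FX (c (phi (eps * t) z)) - w t *m J) (w t)).
    by rewrite -bformDl addrC subrK.
  have h4 := bform_le S (FX (c (phi (eps * t) z)) - w t *m J) (w t).
  have h5 : N * `|S| * `|FX (c (phi (eps * t) z)) - w t *m J| * `|w t| <= mS / 2 * `|w t| ^+ 2.
    have NS0 : 0 <= N * `|S| by rewrite mulr_ge0 // sqr_ge0.
    apply: (@le_trans _ _ (N * `|S| * (e1 * `|w t|) * `|w t|)).
      by rewrite ler_wpM2r // ler_wpM2l.
    by rewrite mulrA -mulrA -expr2 ler_wpM2r // sqr_ge0.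
  have h6 : r ^+ 2 <= `|w t| ^+ 2 by rewrite lerXn2r ?nnegrE ?normr_ge0 ?(ltW r0).
  have h7 := ler_wpM2l (ltW mS0) h6.
  have := ler_norm (- bform S (FX (c (phi (eps * t) z)) - w t *m J) (w t)).
  rewrite normrN; move: h2 h4 h5 h7; lra.
pose B := N * `|S| * rho ^+ 2.
have HB t : 0 <= t -> `|H t| <= B.
  move=> t0; have [_ wt] := hW t t0.
  have eps1' : `|eps| = 1.
    by apply/eqP; rewrite -sqrp_eq1 ?normr_ge0 // -normrX eps1 normr1.
  rewrite /H normrM eps1' mul1r (le_trans (bform_le _ _ _)) // /B -mulrA -expr2.
  rewrite ler_wpM2l ?mulr_ge0 ?sqr_ge0 // lerXn2r ?nnegrE ?(ltW rho0) //.
  exact: ltW.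
(* By this time [H] would have grown by [2 * B + 1], more than a function bounded by [B] can. *)
pose t := (2 * B + 1) / (mS * r ^+ 2).
have mr0 : 0 < mS * r ^+ 2 by rewrite mulr_gt0 // exprn_gt0.
have B0 : 0 <= B by rewrite mulr_ge0 ?sqr_ge0 // mulr_ge0 // sqr_ge0.
have t0 : 0 <= t by rewrite divr_ge0 ?(ltW mr0) // addr_ge0 // mulr_ge0.
have [|s /andP[s0 st] E] := @scalar_mvt R H H' 0 t t0; first by move=> s /andP[s0 _]; exact: dH.
have h1 := ler_wpM2r t0 (H'ge s s0).
rewrite subr0 in E.
have h2 : mS * r ^+ 2 * t = 2 * B + 1 by rewrite /t mulrC divfK // gt_eqF.
have h3 := HB t t0; have h4 := HB 0 (lexx _).
have h5 := ler_norm (H t); have h6 := ler_norm (- H 0); rewrite normrN in h6.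
by exfalso; move: h1 h2 h3 h4 h5 h6 E; lra.
Qed.

Definition exits (eps : R) z (tau : R) :=
  [/\ 0 < tau, `|c (phi (eps * tau) z) - y0| = rho &
      forall t, 0 <= t <= tau -> V (phi (eps * t) z)].

Lemma exit_time (eps : R) z : W z -> ~ (forall t, 0 <= t -> W (phi (eps * t) z)) ->
  exists tau, exits eps z tau.
Proof.
move=> Wz /existsNP[t1 /not_implyP[t10 nW]].
have cont : continuous (fun t => phi (eps * t) z).
  move=> t; apply: (@continuous_comp _ _ _ (fun t : R => eps * t) (phi ^~ z)).
    exact: mulrl_continuous.
  exact: (flow_curve phiX z).1.
have cA : closed ((fun t => phi (eps * t) z) @^-1` (~` [set z | W z])).
  apply: closed_comp; first by move=> t _; exact: cont.
  by apply: open_closedC; exact: chart_ball_open.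
have [tau [ntau /andP[tau0 _] hit]] := first_hitting_ge0 cA nW t10.
have taun0 : tau != 0.
  by apply: contra_notN ntau => /eqP ->; rewrite /= mulr0 (flow0 phiX).
have taup : 0 < tau by rewrite lt_neqAle eq_sym taun0.
have inW t : 0 <= t -> t < tau -> W (phi (eps * t) z).
  by move=> t0 tt; apply: contrapT; apply: hit; rewrite t0.
have cV : closed ((fun t => phi (eps * t) z) @^-1` [set z | V z]).
  apply: closed_comp; first by move=> t _; exact: cont.
  exact: chart_ball_closed.
have Vtau : V (phi (eps * tau) z).
  apply: cV => B /near_normP[r r0 hr].
  pose m := Num.min (r / 2) (tau / 2).
  have m0 : 0 < m by rewrite lt_min !divr_gt0.
  have mr : m < r by rewrite gt_min ltr_pdivrMr // ltr_pMr // ltr1n.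
  have mt : m < tau by rewrite gt_min [X in _ || X]ltr_pdivrMr // ltr_pMr // ltr1n orbT.
  exists (tau - m); split.
    have [||? ?] := @inW (tau - m); [lra|lra|].
    by split => //; exact: ltW.
  by apply: hr; rewrite addrAC subrr sub0r normrN gtr0_norm.
exists tau; split => //.
  have [ct ht] := Vtau; apply/eqP; rewrite eq_le ht /= leNgt; apply/negP => h.
  by apply: ntau.
move=> t /andP[t0]; rewrite le_eqVlt => /predU1P[->//|tt].
by have [? ?] := inW t t0 tt; split => //; exact: ltW.
Qed.

(** The Euclidean square of the distance to [y0] grows at most exponentially, so a start close to
    [y0] cannot reach the sphere of radius [rho] before a prescribed time. *)
Lemma exit_late (Tm : R) : exists2 d : R, 0 < d & forall eps z tau, eps ^+ 2 = 1 ->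
  `|c z - y0| < d -> exits eps z tau -> Tm <= tau.
Proof.
pose C := 2 * N * (n%:R * `|J| + e1).
have N0 : 0 <= N by exact: sqr_ge0.
have C0 : 0 <= C by rewrite !mulr_ge0 // addr_ge0 ?mulr_ge0 // ltW.
pose E := expR (C * Tm).
have E0 : 0 < E by exact: expR_gt0.
(* Since [d <= 1], the initial square is at most [N * d]; by time [Tm] it is at most [N * d * E],
   strictly below [rho ^+ 2] thanks to [N + 1]. *)
pose d := Num.min 1 (rho ^+ 2 / ((N + 1) * E)).
have NE0 : 0 < (N + 1) * E by rewrite mulr_gt0 // ltr_wpDl.
have d0 : 0 < d by rewrite lt_min ltr01 divr_gt0 // exprn_gt0.
exists d => // eps z tau eps1 zd [tau0 wtau hV]; rewrite leNgt; apply/negP => tT.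
have eps1' : `|eps| = 1.
  by apply/eqP; rewrite -sqrp_eq1 ?normr_ge0 // -normrX eps1 normr1.
pose w t := c (phi (eps * t) z) - y0.
pose g t := bform 1%:M (w t) (w t).
pose g' t := 2 * bform 1%:M (eps *: FX (c (phi (eps * t) z))) (w t).
have tr1 : (1%:M : 'M[R]_n)^T = 1%:M by rewrite trmx1.
have [|t tt|h _] := @gronwall R g g' C 0 tau (ltW tau0).
- by move=> t tt; have [ct _] := hV t tt; exact: is_derive_qform tr1 (curve_derive ct).
- have [_ wt] := hV t tt; have h1 := box_lin wt.
  rewrite /g' normrM bformZl normrM eps1' mul1r ger0_norm //.
  have h2 : `|FX (c (phi (eps * t) z))| <= (n%:R * `|J| + e1) * `|w t|.
    rewrite -(subrK (w t *m J) (FX _)) (le_trans (ler_normD _ _)) // mulrDl addrC lerD //.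
    by rewrite (le_trans (mulmx_norm_le _ _)) // mulrAC.
  rewrite (@le_trans _ _ (C * `|w t| ^+ 2)) ?ler_wpM2l ?norm2_ge //.
  have h3 := bform1_le (FX (c (phi (eps * t) z))) (w t).
  have h4 : N * `|FX (c (phi (eps * t) z))| * `|w t| <=
      N * ((n%:R * `|J| + e1) * `|w t|) * `|w t| by rewrite ler_wpM2r // ler_wpM2l.
  have := le_trans h3 h4; rewrite -(ler_pM2l (_ : 0 < 2)) //.
  by congr (_ <= _); rewrite /C; ring.
have g0 : g 0 <= N * d.
  rewrite /g /w mulr0 (flow0 phiX) (le_trans (norm2_le _)) // ler_wpM2l //.
  have d1 : d <= 1 by rewrite ge_min lexx.
  have := ler_pM (normr_ge0 (c z - y0)) (normr_ge0 _) (ltW zd) (le_trans (ltW zd) d1).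
  by rewrite mulr1 -expr2.
have gt : rho ^+ 2 <= g tau by rewrite -wtau norm2_ge.
have g00 : 0 <= N * d by rewrite mulr_ge0 // ltW.
have h1 : g 0 * expR (C * (tau - 0)) <= N * d * E.
  apply: ler_pM => //; first by rewrite /g (le_trans _ (norm2_ge _)) // sqr_ge0.
  by rewrite ler_expR subr0 ler_wpM2l // ltW.
have h2 : (N + 1) * E * d <= rho ^+ 2.
  have : d <= rho ^+ 2 / ((N + 1) * E) by rewrite ge_min lexx orbT.
  by rewrite ler_pdivlMr // mulrC.
have h3 : 0 < E * d by rewrite mulr_gt0.
have e : N * d * E = N * (E * d) by ring.
have e' : (N + 1) * E * d = N * (E * d) + E * d by ring.
move: h h1 h2 h3 gt; rewrite e e'; lra.
Qed.

(** [growth] is applied to [eps] times the form of [T] on the gradient and to its Euclidean square.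
    As [eps ^+ 2 = 1], the first function increases in both time directions; the sign condition
    picks the direction in which it starts nonnegative. *)
Lemma gradient_growth : exists2 K : R, 0 < K & forall eps z tau, eps ^+ 2 = 1 ->
  z != x -> exits eps z tau -> 1 <= tau ->
  0 <= eps * bform T (grad F (c z)) (grad F (c z)) ->
  bform 1%:M (grad F (c z)) (grad F (c z)) * (tau - 1) <=
  K * bform 1%:M (grad F (c (phi (eps * tau) z))) (grad F (c (phi (eps * tau) z))).
Proof.
have N0 : 0 <= N by exact: sqr_ge0.
pose m := mT / (N + 1).
have m0 : 0 < m by rewrite divr_gt0 // ltr_wpDl.
pose C := 2 * N * (n%:R * (`|J| + e2)).
have C0 : 0 <= C by rewrite !mulr_ge0 // addr_ge0 // ltW.
pose K := N * `|T| + 1.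
have K0 : 0 < K by rewrite ltr_wpDl // mulr_ge0.
have D0 : 0 < m ^+ 2 * expR (- C) by rewrite mulr_gt0 ?exprn_gt0 // expR_gt0.
exists (K ^+ 2 / (m ^+ 2 * expR (- C))); first by rewrite divr_gt0 // exprn_gt0.
move=> eps z tau eps1 zx [tau0 _ hV] tau1 L0.
have eps1' : `|eps| = 1.
  by apply/eqP; rewrite -sqrp_eq1 ?normr_ge0 // -normrX eps1 normr1.
have Xz : X z != 0.
  have [|ct ht] := hV 0; first by rewrite lexx ltW.
  by rewrite mulr0 (flow0 phiX) in ct ht; exact: box_reg.
pose q t := grad F (c (phi (eps * t) z)).
pose Jt t := jacobian FX (c (phi (eps * t) z)).
pose q' t := - (q t *m (Jt t)^T).
have dq (t : R) : 0 <= t <= tau -> is_derive t 1 q (eps *: q' t).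
  move=> tt; have [ct _] := hV t tt.
  exact: is_derive_rescale (grad_ode XC YC phiX psiY comm f_coll ac ct Xz).
have tr1 : (1%:M : 'M[R]_n)^T = 1%:M by rewrite trmx1.
pose L t := eps * bform T (q t) (q t).
pose L' t := 2 * bform T (q' t) (q t).
pose g t := bform 1%:M (q t) (q t).
pose g' t := 2 * bform 1%:M (eps *: q' t) (q t).
have dL (t : R) : 0 <= t <= tau -> is_derive t 1 L (L' t).
  move=> tt; have dZ := is_deriveZ eps (is_derive_qform TT (dq t tt)).
  apply: (is_derive_eq dZ); rewrite bformZl /L'.
  by rewrite -[LHS]/(eps * (2 * (eps * _))) mulrCA [eps * (_ * _)]mulrA -expr2 eps1 mul1r.
have g0 t : 0 <= g t by rewrite (le_trans _ (norm2_ge _)) // sqr_ge0.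
have := @growth R L L' g g' m C K tau m0 C0 K0 tau1 dL.
have E0 : q 0 = grad F (c z) by rewrite /q mulr0 (flow0 phiX).
have -> : g 0 = bform 1%:M (grad F (c z)) (grad F (c z)) by rewrite /g E0.
move=> H; rewrite mulrAC ler_pdivlMr //; apply: H.
- by move=> t tt; exact: is_derive_qform tr1 (dq t tt).
- by move=> t _.
- move=> t tt; have [_ wt] := hV t tt.
  have h1 : m * g t <= mT * `|q t| ^+ 2.
    rewrite /m mulrAC ler_pdivrMr ?ltr_wpDl // -mulrA ler_pM2l //.
    by rewrite (le_trans (norm2_le _)) // mulrC ler_wpM2l ?sqr_ge0 // lerDl.
  have h2 := TJ (q t).
  have -> : L' t = 2 * (bform T (- (q t *m J^T)) (q t) + bform T (- (q t *m (Jt t - J)^T)) (q t)).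
    rewrite -bformDl; congr (2 * bform _ _ _).
    by rewrite /q' -{1}(subrK J (Jt t)) raddfD /= mulmxDr opprD addrC.
  have h3 := bform_le T (- (q t *m (Jt t - J)^T)) (q t).
  have h4 : `|- (q t *m (Jt t - J)^T)| <= n%:R * e2 * `|q t|.
    rewrite normrN (le_trans (mulmx_norm_le _ _)) // trmx_norm mulrAC ler_wpM2r //.
    by rewrite ler_wpM2l // box_jac.
  have h5 : N * `|T| * `|- (q t *m (Jt t - J)^T)| * `|q t| <= mT / 2 * `|q t| ^+ 2.
    apply: (@le_trans _ _ (N * `|T| * (n%:R * e2 * `|q t|) * `|q t|)).
      by rewrite ler_wpM2r // ler_wpM2l // mulr_ge0.
    by rewrite mulrA -mulrA -expr2 ler_wpM2r // sqr_ge0.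
  have := ler_norm (- bform T (- (q t *m (Jt t - J)^T)) (q t)); rewrite normrN.
  move: h1 h2 h3 h5; lra.
- move=> t tt; have [_ wt] := hV t tt.
  rewrite /g' normrM bformZl normrM eps1' mul1r ger0_norm //.
  rewrite (@le_trans _ _ (C * `|q t| ^+ 2)) ?ler_wpM2l ?norm2_ge //.
  have h1 : `|q' t| <= n%:R * (`|J| + e2) * `|q t|.
    rewrite normrN (le_trans (mulmx_norm_le _ _)) // trmx_norm mulrAC ler_wpM2r //.
    rewrite ler_wpM2l // -(subrK J (Jt t)) (le_trans (ler_normD _ _)) // addrC lerD2l.
    exact: box_jac.
  have h2 := bform1_le (q' t) (q t).
  have h3 : N * `|q' t| * `|q t| <= N * (n%:R * (`|J| + e2) * `|q t|) * `|q t|.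
    by rewrite ler_wpM2r // ler_wpM2l.
  have := le_trans h2 h3; rewrite -(ler_pM2l (_ : 0 < 2)) //.
  by congr (_ <= _); rewrite /C; ring.
- move=> t tt; rewrite (le_trans (ler_norm _)) // /L normrM eps1' mul1r.
  rewrite (le_trans (bform_le _ _ _)) // -mulrA -expr2 (@le_trans _ _ (K * `|q t| ^+ 2)) //.
    by rewrite ler_wpM2r ?sqr_ge0 // lerDl.
  by rewrite ler_wpM2l ?norm2_ge // ltW.
- by rewrite /L E0.
Qed.

Lemma box_C1 y : `|y - y0| <= rho -> y != y0 -> C1_at F y.
Proof.
move=> yr yn; have cy := box_codom yr; have dz := chart_inv_dom cy.
rewrite -(chart_invK cy); apply: (ratio_C1 XC YC f_coll ac dz).
apply: box_reg => //; first by rewrite chart_invK.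
by apply: contra yn => /eqP h; rewrite -(chart_invK cy) h.
Qed.

Lemma exit_gradient_bound : exists2 K : R, 0 < K & forall y, `|y - y0| = rho ->
  bform 1%:M (grad F y) (grad F y) <= K.
Proof.
have cS : compact [set y : 'rV[R]_n | `|y - y0| = rho].
  apply: bounded_closed_compact.
    exists (rho + `|y0|); split; first by rewrite num_real.
    move=> m hm y /= hy; rewrite -(subrK y0 y) (le_trans (ler_normD _ _)) //.
    by rewrite hy ltW.
  have -> : [set y : 'rV[R]_n | `|y - y0| = rho] = (fun y => `|y - y0|) @^-1` [set rho] by [].
  apply: closed_comp; last exact: closed_eq.
  by move=> y _; exact: dist_continuous.
(* In dimension 0 the sphere is empty and carries no maximum. *)
have [[y1 hy1]|nS] := pselect ([set y : 'rV[R]_n | `|y - y0| = rho] !=set0); last first.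
  by exists 1 => // y hy; exfalso; apply: nS; exists y.
have [//||y2 hy2 hmax] := @EVT_max_rV R n (fun y => bform 1%:M (grad F y) (grad F y)) _ _ cS.
- by exists y1.
- apply: continuous_in_subspaceT => y; rewrite inE /= => hy.
  have Cy : C1_at F y.
    apply: box_C1; first by rewrite hy.
    by apply: contraTneq rho0 => h; rewrite -hy h subrr normr0 ltxx.
  exact: continuous_comp (grad_continuous Cy) (@qform_continuous R n 1%:M (grad F y)).
exists (`|bform 1%:M (grad F y2) (grad F y2)| + 1); first by rewrite ltr_wpDl.
move=> y hy; have := hmax y; rewrite inE => /(_ hy) /le_trans; apply.
by rewrite (le_trans (ler_norm _)) // lerDl.
Qed.

Lemma gradient_small (e : R) : 0 < e -> exists2 d : R, 0 < d & d <= rho /\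
  forall z, chart_dom c z -> z != x -> `|c z - y0| < d -> `|grad F (c z)| <= e.
Proof.
move=> e0.
have [K1 K10 hK1] := gradient_growth.
have [K2 K20 hK2] := exit_gradient_bound.
have KK0 : 0 < K1 * K2 by rewrite mulr_gt0.
(* With [tau - 1] at least [K1 * K2 / e ^+ 2], the bound [K1 * K2] on the product with the squared
   gradient leaves at most [e ^+ 2] for the latter. *)
have [d d0 hd] := exit_late (1 + K1 * K2 / e ^+ 2).
have ee0 : 0 < e ^+ 2 by rewrite exprn_gt0.
have KE0 : 0 < K1 * K2 / e ^+ 2 by rewrite divr_gt0.
have one_side eps z tau : eps ^+ 2 = 1 -> z != x -> `|c z - y0| < d -> exits eps z tau ->
    0 <= eps * bform T (grad F (c z)) (grad F (c z)) -> `|grad F (c z)| <= e.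
  move=> eps1 zx zd ex L0.
  have tT := hd _ _ _ eps1 zd ex.
  have tau1 : 1 <= tau by move: tT KE0; lra.
  have h1 := hK1 _ _ _ eps1 zx ex tau1 L0.
  have [_ wtau _] := ex; have h2 := hK2 _ wtau.
  have h3 := le_trans h1 (ler_wpM2l (ltW K10) h2).
  have q0 : 0 <= bform 1%:M (grad F (c z)) (grad F (c z)).
    by rewrite (le_trans _ (norm2_ge _)) // sqr_ge0.
  have h4 : bform 1%:M (grad F (c z)) (grad F (c z)) * (K1 * K2 / e ^+ 2) <= K1 * K2.
    by rewrite (le_trans _ h3) // ler_wpM2l //; move: tT; lra.
  have h5 : bform 1%:M (grad F (c z)) (grad F (c z)) <= e ^+ 2.
    rewrite mulrA ler_pdivrMr // mulrC ler_pM2l // in h4.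
  have h6 := le_trans (norm2_ge _) h5.
  by rewrite -(ler_pXn2r (_ : (0 < 2)%N)) // nnegrE // ltW.
pose d' := Num.min d rho.
have d'0 : 0 < d' by rewrite lt_min d0.
exists d' => //; split; first by rewrite ge_min lexx orbT.
move=> z cz zx zd; rewrite leNgt; apply/negP => big.
(* A point whose orbit leaves the box in both directions has a gradient of norm at
   most [e].  Near [z] this is excluded by continuity of the gradient, so each
   nearby orbit is trapped on one side and [f] is constant near [z]. *)
have zn0 : c z != y0.
  by apply: contra zx => /eqP h; rewrite -(chart_mapK cz) h chart_mapK.
have zr : `|c z - y0| < rho by move: zd; rewrite lt_min => /andP[].
have Cz : C1_at F (c z) by apply: box_C1 => //; exact: ltW.
have ge0 : 0 < `|grad F (c z)| - e by rewrite subr_gt0.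
have [r1 r10 h1] := (continuous_normP _ _).1 (grad_continuous Cz) _ ge0.
have [r2 r20 h2] := near_chart cz (near_chart_dom cz).
have w0 : 0 < `|c z - y0| by rewrite normr_gt0 subr_eq0.
pose r := Num.min (Num.min r1 r2) (Num.min (d' - `|c z - y0|) `|c z - y0|).
have r0 : 0 < r by rewrite !lt_min r10 r20 subr_gt0 zd.
have loc : forall y, `|y - c z| < r -> F y = f x.
  move=> y; rewrite !lt_min => /andP[/andP[/h1 gy /h2[cody _]] /andP[yd yn]].
  have dz := chart_inv_dom cody; set z' := chart_inv c y.
  have cz' : c z' = y by rewrite chart_invK.
  have z'd : `|c z' - y0| < d'.
    rewrite cz' -(subrKA (c z)) (le_lt_trans (ler_normD _ _)) //.
    by move: yd; lra.
  have z'x : z' != x.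
    apply/eqP => h; move: yn; rewrite -cz' h distrC ltxx //.
  have biggy : e < `|grad F (c z')|.
    rewrite cz'; have := ler_normB (grad F (c z)) (grad F y) => _.
    have := ler_normD (grad F (c z) - grad F y) (grad F y).
    by rewrite subrK distrC; move: gy; lra.
  have nosmall : ~ (`|grad F (c z')| <= e) by apply/negP; rewrite -ltNge.
  have Wz' : W z' by split => //; move: z'd; rewrite lt_min => /andP[].
  have z'dd : `|c z' - y0| < d by move: z'd; rewrite lt_min => /andP[].
  rewrite /= -/z'.
  have one2 : (1 : R) ^+ 2 = 1 by rewrite expr1n.
  have mone2 : (-1 : R) ^+ 2 = 1 by rewrite sqrrN expr1n.
  have [t1|n1] := pselect (forall t, 0 <= t -> W (phi (1 * t) z')).
    exact: trapped_ratio t1.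
  have [t2|n2] := pselect (forall t, 0 <= t -> W (phi ((-1) * t) z')).
    exact: trapped_ratio t2.
  have [tau1 ex1] := exit_time Wz' n1; have [tau2 ex2] := exit_time Wz' n2.
  exfalso; apply: nosmall.
  have [L0|/ltW L0] := lerP 0 (bform T (grad F (c z')) (grad F (c z'))).
    by apply: (one_side _ _ _ one2 z'x z'dd ex1); rewrite mul1r.
  by apply: (one_side _ _ _ mone2 z'x z'dd ex2); rewrite mulN1r oppr_ge0.
have g0 : grad F (c z) = 0.
  have dcst : differentiable (cst (f x) : 'rV[R]_n -> R) (c z) by [].
  have [|_ h] := @near_eq_diff R _ _ (cst (f x)) F (c z) _ dcst.
    by apply/near_normP; exists r => // y /loc ->.
  by apply/rowP => i; rewrite !mxE h difE diff_cst.
by move: big; rewrite g0 normr0 ltNge ltW.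
Qed.

(** The differential of [F] tends to 0 along points other than [y0], and [F] is continuous at [y0].
    The mean value theorem on segments issuing from [y0] then yields differentiability there with
    zero differential, which is also the limit required by [C1_at]. *)
Lemma singular_C1_box : C1_at F y0.
Proof.
have Fx : F y0 = f x by rewrite /= chart_mapK.
have near0 (e : R) : 0 < e -> exists2 d : R, 0 < d & forall y, `|y - y0| < d -> y != y0 ->
    differentiable F y /\ forall v, `|dif F y v| <= e * `|v|.
  move=> e0; pose e' := e / (N + 1).
  have N10 : 0 < N + 1 by rewrite ltr_wpDl // sqr_ge0.
  have [d d0 [drho hd]] := gradient_small (divr_gt0 e0 N10).
  exists d => // y yd yn.
  have yr : `|y - y0| <= rho by rewrite (le_trans (ltW yd)).
  have cy := box_codom yr; have dz := chart_inv_dom cy.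
  split=> [|v]; first exact: C1_at_diff (box_C1 yr yn).
  rewrite grad_dif (le_trans (bform1_le _ _)) // ler_wpM2r //.
  have := hd _ dz; rewrite chart_invK // => /(_ _ yd) h.
  have zx : chart_inv c y != x by apply: contra yn => /eqP hh; rewrite -(chart_invK cy) hh.
  have {}h := ler_wpM2l (sqr_ge0 (n%:R : R)) (h zx).
  rewrite (le_trans h) // mulrCA ler_piMr ?(ltW e0) // ler_pdivrMr // mul1r lerDl //.
have contF (e : R) : 0 < e -> exists2 r : R, 0 < r & forall y, `|y - y0| < r -> `|F y - F y0| <= e.
  move=> e0; have [r r0 hr] := ratio_near_singular e0.
  exists (Num.min r rho); first by rewrite lt_min r0.
  move=> y; rewrite lt_min => /andP[yr /ltW /box_codom cy].
  rewrite Fx; apply: hr; first exact: chart_inv_dom.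
  by rewrite chart_invK.
have lip (e : R) : 0 < e -> exists2 d : R, 0 < d & forall y, `|y - y0| < d ->
    `|F y - F y0| <= e * `|y - y0|.
  move=> e0; have [d d0 hd] := near0 e e0.
  exists d => // y yd; have [->|yn] := eqVneq y y0; first by rewrite !subrr !normr0 mulr0.
  pose p (t : R) := y0 + t *: (y - y0).
  have pE t : p t - y0 = t *: (y - y0) by rewrite /p addrC addKr.
  have w0 : 0 < `|y - y0| by rewrite normr_gt0 subr_eq0.
  have pd (t : R) : is_derive t 1 p (y - y0).
    apply/is_derive_approx => e' e'0; exists 1 => // s _.
    have -> : p s - p t - (s - t) *: (y - y0) = 0.
      by rewrite /p; apply/rowP => i; rewrite !mxE; ring.
    by rewrite normr0 mulr_ge0 // ltW.
  have pin (t : R) : 0 < t -> t <= 1 -> `|p t - y0| < d /\ p t != y0.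
    move=> t0 t1; split.
      by rewrite pE normrZ gtr0_norm // (le_lt_trans _ yd) // ler_piMl.
    by rewrite -subr_eq0 -normr_gt0 pE normrZ mulr_gt0 // normr_gt0 gt_eqF.
  have dg (t : R) : 0 < t -> t <= 1 -> is_derive t 1 (F \o p) (dif F (p t) (y - y0)).
    by move=> t0 t1; have [pt ptn] := pin t t0 t1; apply: is_derive_chain => //; exact: (hd _ pt ptn).1.
  (* Differentiability at the endpoint [y0] is still unknown; this form asks for derivatives inside
     the interval only, and continuity at 0 comes from [contF]. *)
  have [||s] := @MVT R (F \o p) (fun t => dif F (p t) (y - y0)) 0 1 ltr01.
  - by move=> t; rewrite in_itv /= => /andP[t0 t1]; apply: dg => //; exact: ltW.
  - apply: continuous_in_subspaceT => t; rewrite inE /= in_itv /= => /andP[t0 t1].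
    move: t0; rewrite le_eqVlt => /predU1P[<-|t0]; last exact: is_derive_continuous (dg t t0 t1).
    apply/continuous_normP => e' e'0.
    have [r r0 hr] := contF (e' / 2) (divr_gt0 e'0 (ltr0Sn R 1)).
    exists (r / `|y - y0|); first by rewrite divr_gt0.
    move=> s; rewrite subr0 => sr.
    have p0 : p 0 = y0 by rewrite /p scale0r addr0.
    rewrite /= -[f (chart_inv c (p s))]/(F (p s)) -[f (chart_inv c (p 0))]/(F (p 0)) p0.
    rewrite (le_lt_trans (hr _ _)) //; last by rewrite ltr_pdivrMr // ltr_pMr // ltr1n.
    by rewrite pE normrZ -ltr_pdivlMr.
  rewrite in_itv /= subr0 mulr1 => /andP[s0 s1] E.
  have p1 : p 1 = y by rewrite /p scale1r addrC subrK.
  have p0 : p 0 = y0 by rewrite /p scale0r addr0.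
  have [ps psn] := pin s s0 (ltW s1).
  have -> : F y - F y0 = dif F (p s) (y - y0) by rewrite -E /= p1 p0.
  by have [_ ->] := hd _ ps psn.
have [dF dF0] : differentiable F y0 /\ forall v, dif F y0 v = 0.
  apply: (@diff_of_approx R _ _ F (cst 0) y0) => //.
  - by move=> a u v; rewrite /cst scaler0 addr0.
  - exact: cst_continuous.
  move=> e e0; have [d d0 hd] := lip e e0; exists d => // y yd.
  by rewrite /cst subr0; exact: hd.
move=> e e0; have [d d0 hd] := near0 e e0; exists d => // y yd.
have [->|yn] := eqVneq y y0.
  by split=> // v; rewrite subrr normr0 mulr_ge0 // ltW.
have [dy hy] := hd y yd yn; split => // v; rewrite dF0 subr0; exact: hy.
Qed.

End Box.

Lemma singular_C1 : C1_at F y0.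
Proof.
have [S [mS mS0 [ST SJ]]] := lyapunov_coercive hyp.
have [T [mT mT0 [TT TJ]]] := lyapunov_dual hyp.
pose e1 := mS / (2 * (n%:R ^+ 2 * `|S| + 1)).
pose e2 := mT / (2 * (n%:R ^+ 2 * `|T| * n%:R + 1)).
have d1 : 0 < n%:R ^+ 2 * `|S| + 1 by rewrite ltr_wpDl // mulr_ge0 // sqr_ge0.
have d2 : 0 < n%:R ^+ 2 * `|T| * n%:R + 1 by rewrite ltr_wpDl // !mulr_ge0 // sqr_ge0.
have e10 : 0 < e1 by rewrite divr_gt0 // mulr_gt0.
have e20 : 0 < e2 by rewrite divr_gt0 // mulr_gt0.
have he1 : n%:R ^+ 2 * `|S| * e1 <= mS / 2.
  have -> : n%:R ^+ 2 * `|S| * e1 = mS / 2 * (n%:R ^+ 2 * `|S| / (n%:R ^+ 2 * `|S| + 1)).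
    by rewrite /e1; field; rewrite gt_eqF.
  by rewrite ler_piMr ?divr_ge0 ?(ltW mS0) // ler_pdivrMr // mul1r lerDl.
have he2 : n%:R ^+ 2 * `|T| * (n%:R * e2) <= mT / 2.
  have -> : n%:R ^+ 2 * `|T| * (n%:R * e2) =
      mT / 2 * (n%:R ^+ 2 * `|T| * n%:R / (n%:R ^+ 2 * `|T| * n%:R + 1)).
    by rewrite /e2; field; rewrite gt_eqF.
  by rewrite ler_piMr ?divr_ge0 ?(ltW mT0) // ler_pdivrMr // mul1r lerDl.
have [rho rho0 [b1 b2 b3 b4]] := singular_box e10 e20.
exact: (singular_C1_box mS0 mT0 ST TT SJ TJ e10 e20 rho0 he1 he2 b1 b2 b3 b4).
Qed.

End SingularPoint.

(** * Global regularity and choice of the first integral *)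

Lemma Ck_function_of_chart_at (R : realType) (n : nat) (M : manifold R n) (f : M -> R) :
  (forall x, C1_at (f \o chart_inv (chart_at x)) (chart_at x x)) -> Ck_function 1 f.
Proof.
move=> H c ac; apply/(Ck1P _ (@chart_codom_open R n M c)) => y cy.
have cx := chart_inv_dom cy; rewrite -(chart_invK cy); set x := chart_inv c y in cx *.
have ax := atlas_chart_at x; have dx := chart_at_dom x.
have E : (chart_at x \o chart_inv c) (c x) = chart_at x x by rewrite /= chart_mapK.
have Hx := H x; rewrite -E in Hx.
apply: C1_at_near_eq (C1_at_comp (transition_C1 ac ax cx dx) Hx).
apply: filterS (near_chart_inv cx (near_chart_dom dx)) => z [_ dz].
by rewrite /= chart_mapK.
Qed.

Theorem corollaryB (R : realType) (n : nat) (M : manifold R n)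
    (g : riemannian_metric M) (X : vector_field M) (phi : R -> M -> M)
    (compactM : compact [set: M])
    (X_C1 : Ck_vector_field 1 X)
    (phi_flow : is_flow X phi)
    (X_rescaling_separating : rescaling_separating g X phi)
    (X_hyperbolic : forall x : M, singularity X x -> hyperbolic X x)
    (k : nat) (k_ge1 : (1 <= k)%N) :
  quasi_trivial_centralizer k X phi.
Proof.
move=> Y [YCk [psi psiY comm]].
have YC : Ck_vector_field 1 Y by move=> c ac; exact: Ck_le k_ge1 (YCk c ac).
have nondeg x : X x = 0 -> jacobian (local_rep X (chart_at x)) (chart_at x x) \in unitmx.
  by move=> Xx; apply: hyperbolic_unit; exact: X_hyperbolic.
have [s0 s00 horb] := centralizer_orbit X_C1 YC phi_flow psiY comm nondeg
  compactM X_rescaling_separating.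
have sing x : X x = 0 -> Y x = 0 := singularity_preserved X_C1 phi_flow psiY comm nondeg (x := x).
have coll z : exists a : R, Y z = a *: X z.
  have [Xz|Xz] := eqVneq (X z) 0; first by exists 0; rewrite scale0r; exact: sing.
  exact: (orbit_collinear X_C1 YC phi_flow psiY s00 horb).
(* At a singularity [Y z = a *: X z] holds for every [a]; the second clause selects the multiplier
   of the linear parts, the value that makes [f] continuous there. *)
pose P z (a : R) := Y z = a *: X z /\ (X z = 0 -> forall v,
  dif (local_rep Y (chart_at z)) (chart_at z z) v =
  a *: dif (local_rep X (chart_at z)) (chart_at z z) v).
have [f fP] : {f : M -> R & forall z, P z (f z)}.
  apply: choice => z; have [Xz|Xz] := eqVneq (X z) 0; last first.
    by have [a ha] := coll z; exists a; split => // /eqP; rewrite (negPf Xz).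
  have Yz := sing _ Xz; have hz := X_hyperbolic _ Xz.
  have [a ha] := singular_multiplier X_C1 YC Xz Yz hz coll.
  by exists a; split => [|_ v]; [rewrite Yz Xz scaler0|exact: ha].
have f_coll z : Y z = f z *: X z := (fP z).1.
exists f; split=> //.
  apply: Ck_function_of_chart_at => x.
  have ax := atlas_chart_at x; have dx := chart_at_dom x.
  have [Xx|Xx] := eqVneq (X x) 0; last exact: (ratio_C1 X_C1 YC f_coll ax dx Xx).
  exact: (singular_C1 X_C1 YC phi_flow psiY comm Xx (sing _ Xx) (X_hyperbolic _ Xx)
    f_coll ((fP x).2 Xx)).
move=> x; rewrite /lie_derivative.
have ax := atlas_chart_at x; have dx := chart_at_dom x.
have [->|Xx] := eqVneq (X x) 0; first exact: derive0.
have Cf := ratio_C1 X_C1 YC f_coll ax dx Xx.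
rewrite derive_dif; last exact: C1_at_diff Cf.
have := ratio_derive X_C1 YC phi_flow psiY comm f_coll ax dx Xx.
by rewrite local_repE // to_coord_chart_at.
Qed.
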